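(* Let $A\ge1$ be an integer, let $X>Y>0$ and $K>0$ be real, let $q$ be a positive integer and $\kappa_1>0$ a constant. Let $\eta=(x,y)^t$ and $\eta'=(u,v)^t$ be vectors with positive integer coordinates satisfying $$\tfrac{y}{A}\le x\le y,\quad c_1\tfrac{X}{Y}\le y\le c_2\tfrac{X}{Y},\quad \gcd(x,y)=1,$$ $$\tfrac{v}{A}\le u\le v,\quad c_3X\le v\le c_4X,\quad \tfrac{2X}{K}\le v,\quad \gcd(u,v)=1,$$ for some absolute positive constants $c_1,c_2,c_3,c_4$. Let $$M=\Bigl\{\gamma=\begin{pmatrix}a&b\\c&d\end{pmatrix}\in\mathbb{Z}^{2\times2}\;\Bigl|\;0\le a\le b,\ 1\le c\le d,\ 1\le b\le d,\ \det\gamma=1\Bigr\},$$ and for $\gamma\in M$ put $\|\gamma\|=d$. Let $$\mathcal{M}=\Bigl\{\gamma\in M\;\Bigl|\;|\gamma\eta-\eta'|\le\tfrac{X}{K},\ \gamma\eta\equiv\eta'\pmod q,\ \tfrac{Y}{\kappa_1}\le\|\gamma\|\le Y\Bigr\}.$$ If $X>Y>K^4q^3$, then for every $\varepsilon>0$, $$|\mathcal{M}|\ll_{\varepsilon}\frac{Y^{2+\varepsilon}}{K^2}\cdot\frac{q^{\varepsilon}}{\sqrt q}.$$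
   Context: For a vector $w=(w_1,w_2)^t$, the condition $|w|\le X/K$ means $|w_1|\le X/K$ and $|w_2|\le X/K$ (both coordinates), and $\gamma\eta\equiv\eta'\pmod q$ means congruence coordinatewise. The implied constant in $\ll_\varepsilon$ may depend on $\varepsilon$ and on the fixed parameters $A,\kappa_1,c_1,\dots,c_4$. *)

(* Defs.v *)
(* MathComp / MathComp-Analysis *)
From HB Require Import structures.
From mathcomp Require Export all_boot all_order all_algebra.
From mathcomp Require Export finmap boolp classical_sets cardinality reals exp.

Set Implicit Arguments.
Unset Strict Implicit.
Unset Printing Implicit Defensive.

Import Order.TTheory GRing.Theory Num.Theory.

Local Open Scope classical_set_scope.
Local Open Scope ring_scope.

(* g = [a b; c d] with a = g 0 0, b = g 0 1, c = g 1 0, d = g 1 1. *)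
Definition Mset : set 'M[int]_2 :=
  [set g : 'M[int]_2 |
    [/\ 0 <= g 0 0 <= g 0 1,
        1 <= g 1 0 <= g 1 1,
        1 <= g 0 1 <= g 1 1 &
        \det g = 1]].

(* The norm d of an element of Mset, where it is the largest entry; it is not
   a norm on all of 'M[int]_2. *)
Definition Mnorm (g : 'M[int]_2) : int := g 1 1.

Definition calM (R : realType) (X Y K kappa1 : R) (q : nat)
    (eta eta' : 'cV[int]_2) : set 'M[int]_2 :=
  [set g : 'M[int]_2 |
    [/\ Mset g,
        forall i : 'I_2, `|((g *m eta - eta') i 0)%:~R| <= X / K,
        forall i : 'I_2, ((g *m eta) i 0%R = eta' i 0%R %[mod q%:Z])%Z &
        Y / kappa1 <= (Mnorm g)%:~R <= Y]].

(* Main.v *)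
(* For a fixed lower right entry [d], an element of the set is determined by [(b, c)], where
   [b * c = -1] modulo [d] and [b], [c] lie in intervals of length about [Y / K], [c] moreover
   in one class modulo [m = q / g] and [d] in one class modulo [g = gcd (x, q)].  Write [d = D * E]
   with [D] odd, squarefree and prime to [m * E].  After fixing classes modulo [E], the pairs are
   counted by Fourier analysis modulo [D], with a triangular majorant whose Fourier coefficients
   are nonnegative, and Weil's bound for Kloosterman sums to prime moduli; the trivial bound
   modulo [E] costs only a factor [sqrt E], whose average over [d] is [O (sqrt q * Y ^ eps)].
   The main terms add up to [Y ^ 2 / (K ^ 2 * q)] and the error terms to
   [Y ^ (3/2) * sqrt q], both admissible because [Y > K ^ 4 * q ^ 3].

   Weil's bound: if [S_j] is the Kloosterman sum over the field with [Q = p ^ (2 ^ j)] elements,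
   then [S_(j+1) = 2 * Q - S_j ^ 2], since a quadratic polynomial over that field has its roots
   either in it or in its quadratic extension.  So [|S_0| > 2 * sqrt p] would make
   [- S_j / sqrt Q] unbounded, whereas Stepanov's method bounds from below the sum of [S_j] over
   all additive characters of the prime field, which counts points of
   [y ^ p - y = x + b / x], i.e. [v ^ 2 = (y ^ p - y) ^ 2 - 4 * b]. *)

Require Import Defs.
From mathcomp Require Import all_boot all_order all_algebra all_field.
From mathcomp Require Import finmap boolp classical_sets cardinality reals exp.
From mathcomp Require Import zify ring lra.

Set Implicit Arguments.
Unset Strict Implicit.
Unset Printing Implicit Defensive.

Import Order.TTheory GRing.Theory Num.Theory.
Local Open Scope ring_scope.

(** * Stepanov's method *)

(** Only one-sided estimates enter Weil's bound. The auxiliary polynomial bounds from above the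
    number of [y] at which [f] takes a non-square value, hence from below the number of points on
    the curve. In the sum over characters the trivial one contributes at most the size of the field,
    and every other one but the suspected culprit is bounded above by the recursion itself, since
    the square of a real number is subtracted there. So no cancellation has to be controlled. The
    normalized culprit grows at least linearly with the height of the tower, while the error,
    divided by the square root of the field size, is a multiple of [p] independent of the height.

    The count itself needs only an upper bound. The zero frequency is therefore never isolated: it
    is the extreme case of the gcd factor in the Kloosterman bound. Splitting off [E] avoids
    Kloosterman sums to prime power moduli. *)

Lemma separable_dvdp_sqr (F : fieldType) (f s : {poly F}) :
  separable_poly f -> f %| s ^+ 2 -> f %| s.
Proof.
move=> /separable_polyP[sepf _] fs.
have [->|s0] := eqVneq s 0; first exact: dvdp0.
have h0 : gcdp f s != 0 by rewrite gcdp_eq0 negb_and s0 orbT.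
have cwt : coprimep (f %/ gcdp f s) (s %/ gcdp f s).
  by apply: coprimep_div_gcd; rewrite s0 orbT.
have fE := divpK (dvdp_gcdl f s); have sE := divpK (dvdp_gcdr f s).
move: (gcdp f s) (f %/ _) (s %/ _) h0 cwt fE sE => h w t h0 cwt fE sE.
have wh : w %| h.
  have : w %| t ^+ 2 * h.
    by rewrite -(dvdp_mul2r _ _ h0) fE -mulrA -expr2 -exprMn sE.
  by rewrite Gauss_dvdpr // coprimep_expr.
have : coprimep w w by apply: sepf; rewrite -fE dvdp_mul.
rewrite coprimepp => /eqP/eqP/size_poly1P[a a0 wE].
by rewrite -fE -sE wE mul_polyC dvdpZl // dvdp_mull.
Qed.

(** Infinite descent: [f] divides [s ^+ 2], hence [s], then [r ^+ 2], hence [r]; cancelling [f ^+ 2]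
    leaves the same equation with a smaller [r]. In effect, a nonconstant separable [f] is not a
    constant times the square of a rational function. *)
Lemma separable_sqr_mul_eq0 (F : fieldType) (f r s : {poly F}) (c : F) :
  separable_poly f -> (1 < size f)%N -> c != 0 ->
  r ^+ 2 * f = c *: s ^+ 2 -> r = 0 /\ s = 0.
Proof.
move=> sepf sf c0.
have f0 : f != 0 by rewrite -size_poly_gt0 (ltn_trans _ sf).
suff rP n : forall r s : {poly F}, (size r <= n)%N -> r ^+ 2 * f = c *: s ^+ 2 -> r = 0.
  move=> e; have r0 := rP (size r) r s (leqnn _) e; split=> //.
  by move/eqP: e; rewrite r0 expr0n mul0r eq_sym scaler_eq0 (negPf c0) sqrf_eq0 => /eqP.
elim: n => [|n IH] {}r {}s; first by rewrite leqn0 size_poly_eq0 => /eqP.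
move=> sr e; apply/eqP/negPn/negP => r0.
have /dvdpP[t tE] : f %| s.
  by apply: separable_dvdp_sqr => //; rewrite -(dvdpZr _ _ c0) -e dvdp_mull.
have {}e : r ^+ 2 = c *: (t ^+ 2 * f).
  by apply: (mulIf f0); rewrite e tE exprMn expr2 !scalerAl; ring.
have /dvdpP[r1 r1E] : f %| r.
  by apply: separable_dvdp_sqr => //; rewrite e dvdpZr // dvdp_mull.
have e1 : r1 ^+ 2 * f = c *: t ^+ 2.
  by apply: (mulIf f0); rewrite -scalerAl -e r1E; ring.
have r10 : r1 != 0 by apply: contraNneq r0 => r10; rewrite r1E r10 mul0r.
suff : r1 = 0 by move/eqP; rewrite (negPf r10).
apply: IH e1; move: sr; rewrite r1E size_mul //.
move: sf; case: (size f) => [|[|k]] // _; rewrite !addnS /= ltnS; apply: leq_trans; exact: leq_addr.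
Qed.

(** Taylor expansion with Hasse derivatives: the order [n] needed later may exceed the
    characteristic, where ordinary derivatives lose information. *)
Lemma nderivn_eq0_dvdp (F : fieldType) (u : {poly F}) (y : F) n :
  (forall k, (k < n)%N -> u^`N(k).[y] = 0) -> ('X - y%:P) ^+ n %| u.
Proof.
move=> h.
have -> : u = \sum_(i < size u) (u^`N(i).[y])%:P * ('X - y%:P) ^+ i.
  have := nderiv_taylor (u^:P) (mulrC y%:P ('X - y%:P)).
  rewrite addrC subrK size_map_polyC.
  under eq_bigr => i _ do rewrite nderivn_map horner_map /=.
  move<-; rewrite -[LHS]comp_polyXr /comp_poly //.
apply: (big_ind (fun a => _ %| a)) => [|a b|i _]; [exact: dvdp0|exact: dvdp_add|].
have [lin|nli] := ltnP i n; first by rewrite h // mul0r dvdp0.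
by rewrite dvdp_mull // dvdp_exp2l.
Qed.

(** The [Q]-th power map is additive, so the difference is the [Q]-th power of [u - u.[y]%:P], a
    multiple of ['X - y%:P]. *)
Lemma dvdp_sub_expr_pchar (F : fieldType) Q (u : {poly F}) (y : F) :
  [pchar F].-nat Q -> ('X - y%:P) ^+ Q %| u ^+ Q - (u.[y] ^+ Q)%:P.
Proof.
move=> hQ.
have -> : u ^+ Q - (u.[y] ^+ Q)%:P = (u - u.[y]%:P) ^+ Q.
  rewrite polyC_exp exprDn_pchar; last by rewrite (eq_pnat _ (pchar_poly F)).
  by congr (_ + _); rewrite exprNn_pchar // (eq_pnat _ (pchar_poly F)).
by apply: dvdp_exp2r; rewrite dvdp_XsubCl rootE !hornerE subrr.
Qed.

(** Linear algebra: the [r j] and [s j] have [J * (n + n)] coefficients, and each of the [Q]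
    identities imposes at most [M] conditions. The identities are between polynomials, so their
    number does not depend on how many points will be treated; ['X^j] stands there for the value of
    ['X^(j * Q ^ 2)] at a point of the field. *)
Lemma stepanov_coefs (L : finFieldType) (v : {poly L}) (Q J n M : nat) :
  (size v + n + J <= M.+1)%N -> (Q * M < J * (n + n))%N ->
  exists r s : 'I_J -> {poly L},
  [/\ forall j, (size (r j) <= n)%N, forall j, (size (s j) <= n)%N,
      exists j, (r j != 0) || (s j != 0) &
      forall k, (k < Q)%N ->
        \sum_(j < J) (v * (r j)^`N(k) - (s j * v)^`N(k)) * 'X^j = 0].
Proof.
move=> sM hQM.
pose r (U : 'M[L]_(J, n + n)) j := rVpoly (lsubmx (row j U)).
pose s (U : 'M[L]_(J, n + n)) j := rVpoly (rsubmx (row j U)).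
have rB U V j : r (U - V) j = r U j - r V j by rewrite /r !linearB.
have sB U V j : s (U - V) j = s U j - s V j by rewrite /s !linearB.
pose P k U := \sum_(j < J) (v * (r U j)^`N(k) - (s U j * v)^`N(k)) * 'X^j.
have PB k U V : P k (U - V) = P k U - P k V.
  rewrite /P -sumrB; apply: eq_bigr => j _.
  by rewrite rB sB [(_ - _) * v]mulrBl !nderivnB; ring.
have sr U j : (size (r U j) <= n)%N by exact: size_poly.
have ss U j : (size (s U j) <= n)%N by exact: size_poly.
have sder (w : {poly L}) k : (size w^`N(k) <= size w)%N.
  apply/leq_sizeP => i hi; rewrite coef_nderivn nth_default ?mul0rn //.
  by rewrite (leq_trans hi) ?leq_addl.
have sP k U : (size (P k U) <= M)%N.
  apply: (leq_trans (size_sum _ _ _)); apply/bigmax_leqP => j _.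
  apply: (leq_trans (size_polyMleq _ _)); rewrite size_polyXn addnS /=.
  have hj := ltn_ord j.
  have : (size (v * (r U j)^`N(k) - (s U j * v)^`N(k))%R <= (size v + n).-1)%N.
    apply: (leq_trans (size_polyD _ _)); rewrite size_polyN geq_max; apply/andP; split.
      apply: (leq_trans (size_polyMleq _ _)).
      by rewrite -!subn1 leq_sub2r // leq_add2l (leq_trans (sder _ _)).
    apply: (leq_trans (sder _ _)); apply: (leq_trans (size_polyMleq _ _)).
    by rewrite -!subn1 leq_sub2r // addnC leq_add2l.
  move: (size _) => a; move: sM; move: (size _) => b; lia.
pose Phi (U : 'M[L]_(J, n + n)) : 'M[L]_(Q, M) := \matrix_(k, i) (P k U)`_i.
have : ~ injective Phi.
  move=> /leq_card; rewrite !card_mx leqNgt => /negP; apply.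
  by rewrite ltn_exp2l // finNzRing_gt1.
move=> ninj.
have [U U0 PU] : exists2 U, U != 0 & Phi U = 0.
  case: (boolP [exists U, (U != 0) && (Phi U == 0)]) => [/existsP[U /andP[? /eqP]]|/existsPn nex].
    by exists U.
  case: ninj => U V UV; apply/eqP; rewrite -subr_eq0; apply/negPn/negP => d.
  have := nex (U - V); rewrite d /= => /negP; apply; apply/eqP/matrixP => k i.
  by move/matrixP/(_ k i): UV; rewrite !mxE PB coefB => ->; rewrite subrr.
exists (r U), (s U); split=> //.
  case: (boolP [exists j, (r U j != 0) || (s U j != 0)]) => [/existsP//|/existsPn nex].
  case/negP: U0; apply/eqP/row_matrixP => j.
  have := nex j; rewrite negb_or !negbK row0 => /andP[/eqP r0 /eqP s0].
  rewrite -[row j U]hsubmxK -[lsubmx _]rVpolyK -[rsubmx _]rVpolyK.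
  by rewrite -/(r U j) -/(s U j) r0 s0 !linear0 row_mx0.
move=> k kQ; apply/polyP => i; rewrite coef0.
have [iM|Mi] := ltnP i M; last by rewrite nth_default // (leq_trans (sP k U)).
by move/matrixP/(_ (Ordinal kQ) (Ordinal iM)): PU; rewrite !mxE.
Qed.

(** Take the least [j] with a nonzero pair and divide by ['X^(j * q)]: modulo ['X^q] only its term
    survives. Multiplying by [(r j - s j * f ^+ h') * f] produces [f ^+ q], congruent to the
    constant [f.[0]], and the size bound turns the congruence into an equality, which by
    [separable_sqr_mul_eq0] has only the zero solution. *)
Lemma stepanov_indep (L : finFieldType) (f : {poly L}) (h' J n : nat)
    (r s : 'I_J -> {poly L}) (q := #|L|) :
  [pchar L].-nat q -> q = h'.*2.+1 -> separable_poly f -> (1 < size f)%N -> f.[0] != 0 ->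
  (n + n + (size f).-1 <= q)%N ->
  (forall j, (size (r j) <= n)%N) -> (forall j, (size (s j) <= n)%N) ->
  \sum_(j < J) (r j + s j * f ^+ h') * 'X^(j * q) = 0 ->
  forall j, r j = 0 /\ s j = 0.
Proof.
move=> qnat qE sepf sf f0 nq sr ss R0.
suff IH N (j : 'I_J) : (j < N)%N -> r j = 0 /\ s j = 0.
  by move=> j; apply: (IH j.+1).
elim: N j => [//|N IH] j; rewrite ltnS leq_eqVlt => /orP[/eqP jN|]; last exact: IH.
have dvd1 : 'X^q %| r j + s j * f ^+ h'.
  have : 'X^q * 'X^(j * q) %| (r j + s j * f ^+ h') * 'X^(j * q).
    move/eqP: R0; rewrite (bigD1 j) //= addr_eq0 => /eqP ->.
    rewrite dvdpNr; apply: (big_ind (fun a => _ %| a)) => [|a b|i ij]; first exact: dvdp0.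
      exact: dvdp_add.
    have [ilt|jle] := ltnP i N; first by have [-> ->] := IH i ilt; rewrite mul0r addr0 mul0r dvdp0.
    rewrite dvdp_mull // -exprD dvdp_exp2l // -mulSn leq_mul2r.
    by rewrite -jN in jle; rewrite ltn_neqAle jle andbT (eq_sym (nat_of_ord j)) (ij : (i != j :> nat)) orbT.
  by rewrite dvdp_mul2r // -size_poly_eq0 size_polyXn.
have dvd2 : 'X^q %| r j ^+ 2 * f - f.[0] *: s j ^+ 2.
  have -> : r j ^+ 2 * f - f.[0] *: s j ^+ 2 =
     (r j + s j * f ^+ h') * ((r j - s j * f ^+ h') * f) +
     s j ^+ 2 * (f ^+ q - (f.[0] ^+ q)%:P).
    have fq : f ^+ q = f * (f ^+ h' * f ^+ h') by rewrite [in LHS]qE -addnn exprS exprD.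
    by rewrite -mul_polyC expf_card fq; ring.
  apply: dvdp_add; [by rewrite dvdp_mulr|apply: dvdp_mull].
  by have := dvdp_sub_expr_pchar f 0 qnat; rewrite subr0.
have : r j ^+ 2 * f - f.[0] *: s j ^+ 2 = 0.
  apply/eqP; apply: contraLR dvd2 => nz; apply/negP => /(dvdp_leq nz).
  rewrite size_polyXn leqNgt => /negP; apply; rewrite ltnS.
  apply: (leq_trans (size_polyD _ _)); rewrite size_polyN geq_max; apply/andP; split.
    apply: (leq_trans (size_polyMleq _ _)).
    have := size_polyMleq (r j) (r j); rewrite -expr2; move: (sr j) nq sf.
    move: (size _) (size _) (size _) => a b c; lia.
  apply: (leq_trans (size_scale_leq _ _)).
  have := size_polyMleq (s j) (s j); rewrite -expr2; move: (ss j) nq sf.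
  move: (size _) (size _) (size _) => a b c; lia.
by move/eqP; rewrite subr_eq0 => /eqP /separable_sqr_mul_eq0; apply.
Qed.

(* Modulo [('X - y) ^+ Q] both ['X ^+ (Q ^ 2)] and [f ^+ Q] are constants, so the vanishing of [R]
   to order [Q] at [y] involves only the Hasse derivatives of [r j], [s j] and [f ^+ h]. *)
Lemma stepanov_vanish (L : finFieldType) (f : {poly L}) (Q h J : nat)
    (r s : 'I_J -> {poly L}) (y : L) (R := \sum_(j < J) (r j + s j * f ^+ (h + h * Q)) * 'X^(j * Q ^ 2)) :
  #|L| = (Q ^ 2)%N -> [pchar L].-nat Q ->
  f.[y] ^+ (h + h * Q) = -1 ->
  (forall k, (k < Q)%N ->
     \sum_(j < J) (f ^+ h * (r j)^`N(k) - (s j * f ^+ h)^`N(k)) * 'X^j = 0) ->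
  ('X - y%:P) ^+ Q %| R.
Proof.
move=> cL Qnat fy P0; set D := _ ^+ Q; set a := f.[y] ^+ h.
have a0 : a != 0.
  apply/eqP => a0; move/eqP: fy; rewrite exprD -/a a0 mul0r eq_sym oppr_eq0.
  by rewrite oner_eq0.
pose R1 := \sum_(j < J) (y ^+ j)%:P * (a%:P * r j - s j * f ^+ h).
have DR1 : D %| R1.
  apply: nderivn_eq0_dvdp => k kQ.
  have := congr1 (fun u => u.[y]) (P0 k kQ); rewrite !hornerE !horner_sum => <-.
  rewrite /R1 raddf_sum horner_sum; apply: eq_bigr => j _.
  rewrite /= mul_polyC nderivnZ nderivnB [a%:P * _]mul_polyC nderivnZ.
  by rewrite !hornerE mulrC.
suff : D %| a%:P * R by rewrite mul_polyC dvdpZr.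
rewrite -(subrK R1 (a%:P * R)) dvdp_addl // /R /R1 mulr_sumr -sumrB.
apply: (big_ind (fun u => D %| u)) => [|u v|j _]; [exact: dvdp0|exact: dvdp_add|].
have dX : D %| 'X^(j * Q ^ 2) - (y ^+ j)%:P.
  have := dvdp_sub_expr_pchar ('X^(j * Q)) y Qnat.
  have yq : y ^+ (j * Q ^ 2) = y ^+ j by rewrite mulnC exprM -cL expf_card.
  by rewrite hornerXn -!exprM -mulnA mulnn yq.
have df : D %| f ^+ (h * Q) - (f.[y] ^+ (h * Q))%:P.
  by have := dvdp_sub_expr_pchar (f ^+ h) y Qnat; rewrite horner_exp -!exprM.
have aF : a%:P * (f.[y] ^+ (h * Q))%:P = -1 by rewrite -polyCM /a -exprD fy polyCN.
move: dX df aF; set Z := 'X^_; set z := (y ^+ j)%:P; set F := f ^+ (h * Q); set F0 := (_ ^+ (h * Q))%:P.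
move=> dX df aF.
have -> : a%:P * ((r j + s j * f ^+ (h + h * Q)) * Z) - z * (a%:P * r j - s j * f ^+ h) =
  a%:P * (r j + s j * f ^+ (h + h * Q)) * (Z - z) + a%:P * s j * f ^+ h * z * (F - F0).
  rewrite exprD -/F.
  transitivity (a%:P * (r j + s j * (f ^+ h * F)) * (Z - z) + a%:P * s j * f ^+ h * z * (F - F0)
    + (a%:P * F0 + 1) * (s j * f ^+ h * z)); first by ring.
  by rewrite aF addNr mul0r addr0.
by rewrite dvdp_add // dvdp_mull.
Qed.

Lemma dvdp_prod_XsubC_exp (F : fieldType) (R : {poly F}) Q (rs : seq F) :
  uniq rs -> (forall y, y \in rs -> ('X - y%:P) ^+ Q %| R) ->
  \prod_(y <- rs) ('X - y%:P) ^+ Q %| R.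
Proof.
elim: rs => [|y rs IH] /=; first by rewrite big_nil dvd1p.
move=> /andP[yrs urs] h; rewrite big_cons Gauss_dvdp.
  by rewrite h ?mem_head // IH // => z zrs; apply: h; rewrite inE zrs orbT.
apply: coprimep_expl; rewrite big_seq.
apply: (big_ind (fun u => coprimep _ u)) => [|u v cu cv|z zrs].
- exact: coprimep1.
- by rewrite coprimepMr cu.
- by rewrite coprimep_expr // coprimep_XsubC2 // subr_eq0; apply: contraNneq yrs => <-.
Qed.

(** [R] vanishes to order [Q] at every point counted, so [Q] times the count is less than its size,
    which is about [Q ^ 3 / 2] because [J] is about [Q / 2]. *)
Lemma stepanov (L : finFieldType) (f : {poly L}) (Q m : nat) :
  #|L| = (Q ^ 2)%N -> [pchar L].-nat Q -> odd Q -> separable_poly f ->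
  size f = m.+1 -> (0 < m)%N -> f.[0] != 0 -> (m < Q./2)%N ->
  (2 * #|[pred y | (f.[y] ^+ (Q ^ 2)%N./2 == -1)%R]| <= Q ^ 2 + (3 * m + 2) * Q)%N.
Proof.
move=> cL Qnat oddQ sepf sf m0 f0 mQ.
have Q_gt0 : (0 < Q)%N by case: (Q) oddQ.
pose h := Q./2; have Qh : Q = h.*2.+1 by rewrite -[LHS]odd_double_half oddQ.
(* [n] is about half of [Q ^ 2], close to the limit set by [stepanov_indep]. Each [j] then brings
   about [Q ^ 2] unknowns and each of the [Q] orders costs about [Q ^ 2 / 2] equations, so [J] has
   to exceed [Q / 2] slightly; the margin pays for the terms of lower order. *)
pose n := (Q ^ 2 - m - 1)./2; pose J := (h + m + 2)%N.
have hh : (Q ^ 2)./2 = (h + h * Q)%N by rewrite Qh; lia.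
have n2 : (n.*2 <= Q ^ 2 - m - 1)%N by rewrite half_leqif_double || lia.
have n3 : (Q ^ 2 - m - 2 <= n.*2)%N by lia.
have sfh k : size (f ^+ k) = (m * k).+1.
  rewrite -[LHS]prednK ?size_exp ?sf // lt0n size_poly_eq0 expf_neq0 //.
  by rewrite -size_poly_eq0 sf.
have [r [s [sr ss [j0 rs0] P0]]] :=
  @stepanov_coefs L (f ^+ h) Q J n (m * h + n + J) ltac:(by rewrite sfh; lia) ltac:(rewrite /J Qh; nia).
pose R := \sum_(j < J) (r j + s j * f ^+ (h + h * Q)) * 'X^(j * Q ^ 2).
have R0 : R != 0.
  apply: contraTneq rs0 => R0; rewrite negb_or !negbK.
  have := @stepanov_indep L f (h + h * Q) J n r s; rewrite cL.
  case/(_ _ _ sepf _ f0 _ sr ss R0 j0) => [| | | |-> ->]; rewrite ?eqxx ?sf ?pnatX ?Qnat //=; first by rewrite Qh; lia.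
  by lia.
set S := [pred y | _].
have dR : \prod_(y <- enum S) ('X - y%:P) ^+ Q %| R.
  apply: dvdp_prod_XsubC_exp; first exact: enum_uniq.
  by move=> y; rewrite mem_enum inE hh => /eqP fy; exact: stepanov_vanish fy P0.
have := dvdp_leq R0 dR; rewrite prodrXl.
have -> : size ((\prod_(y <- enum S) ('X - y%:P)) ^+ Q) = (#|S| * Q).+1.
  rewrite -[LHS]prednK ?size_exp ?size_prod_XsubC -?cardE //.
  by rewrite lt0n size_poly_eq0 expf_neq0 // -size_poly_eq0 size_prod_XsubC.
have sR : (size R <= n + m * (h + h * Q) + (h + m + 1) * Q ^ 2)%N.
  apply: (leq_trans (size_sum _ _ _)); apply/bigmax_leqP => j _.
  apply: (leq_trans (size_polyMleq _ _)); rewrite size_polyXn addnS /=.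
  apply: leq_add.
    apply: (leq_trans (size_polyD _ _)); rewrite geq_max; apply/andP; split.
      by rewrite (leq_trans (sr j)) // leq_addr.
    apply: (leq_trans (size_polyMleq _ _)); rewrite sfh addnS /= leq_add2r.
    exact: ss.
  by rewrite leq_mul2r -ltnS (leq_trans (ltn_ord j)) ?orbT // /J !addnS !addn0.
move=> /leq_trans/(_ sR) NR; rewrite -(leq_pmul2r Q_gt0) -ltnS.
have e1 : (2 * (h + h * Q) + 1 = Q ^ 2)%N by rewrite Qh -muln2; ring.
have e2 : (2 * (m * (h + h * Q)) + m = m * Q ^ 2)%N by rewrite -e1; ring.
have e3 : (2 * ((h + m + 1) * Q ^ 2) = Q * Q ^ 2 + (2 * m + 1) * Q ^ 2)%N.
  by rewrite [X in (_ = X * _ + _)%N]Qh -muln2; ring.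
have -> : ((Q ^ 2 + (3 * m + 2) * Q) * Q = Q * Q ^ 2 + (2 * m + 1) * Q ^ 2 + m * Q ^ 2 + Q ^ 2)%N by ring.
have n4 : (n.*2 + m + 1 <= Q ^ 2)%N by move: n2; clear -mQ Qh; lia.
rewrite -mulnA; move: NR n4 e2 e3; rewrite mul2n -!addnn; clear.
move: (#|S| * Q)%N (m * (h + h * Q))%N ((h + m + 1) * Q ^ 2)%N (m * Q ^ 2)%N (Q * Q ^ 2)%N ((2 * m + 1) * Q ^ 2)%N (Q ^ 2)%N.
lia.
Qed.

(** * Kloosterman sums over quadratic extensions *)

(** Saturation: upper bounds obtained by counting roots are attained everywhere once the total is as
    large as it can be. This gives the exact size of fibres without constructing preimages. *)
Lemma sum_nat_const_le_eq (I : finType) (P : pred I) (f : I -> nat) (c : nat) :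
  (forall i, P i -> (f i <= c)%N) -> (#|P| * c <= \sum_(i | P i) f i)%N ->
  forall i, P i -> f i = c.
Proof.
move=> fc sc i Pi; apply/eqP; rewrite eqn_leq fc //= leqNgt; apply/negP => lt.
move: sc; rewrite leqNgt => /negP; apply.
rewrite -sum_nat_const [X in (_ < X)%N](bigD1 i) //= [X in (X < _)%N](bigD1 i) //=.
by rewrite -addSn leq_add // leq_sum // => j /andP[]/fc.
Qed.

Section QuadraticStep.

Variables (L : finFieldType) (Q : nat).
Hypothesis Qnat : [pchar L].-nat Q.
Hypothesis Q1 : (1 < Q)%N.

(** Subfields of the ambient field [L] are encoded as the fixed points of a power map, so that a
    whole tower lives in one type. *)
Definition fixpow (n : nat) : pred L := [pred x | x ^+ n == x].

(** For [n] a power of the characteristic, this is the trace from the fixed points of [x ^+ (n ^ 2)]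
    to those of [x ^+ n]. *)
Definition trpow (n : nat) (x : L) : L := x + x ^+ n.

Hypothesis cE : #|fixpow (Q ^ 2)| = (Q ^ 2)%N.

Lemma expQD (x y : L) : (x + y) ^+ Q = x ^+ Q + y ^+ Q.
Proof. exact: exprDn_pchar. Qed.

Lemma fixpowD x y : fixpow Q x -> fixpow Q y -> fixpow Q (x + y).
Proof. by rewrite /fixpow /= expQD => /eqP -> /eqP ->. Qed.

Lemma fixpowM n x y : fixpow n x -> fixpow n y -> fixpow n (x * y).
Proof. by rewrite /fixpow /= exprMn => /eqP -> /eqP ->. Qed.

Lemma fixpowV n x : fixpow n x -> fixpow n x^-1.
Proof. by rewrite /fixpow /= exprVn => /eqP ->. Qed.

Lemma fixpow0 : fixpow Q 0.
Proof. by rewrite /fixpow /= expr0n (gtn_eqF (ltnW Q1)) eqxx. Qed.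

Lemma fixpow1 n : fixpow n 1.
Proof. by rewrite /fixpow /= expr1n. Qed.

Lemma fixpow_sqr x : fixpow Q x -> fixpow (Q ^ 2) x.
Proof. by move=> /eqP e; rewrite /fixpow /= -mulnn exprM !e eqxx. Qed.

Lemma card_roots_le (u : {poly L}) n : u != 0 -> (size u <= n.+1)%N ->
  (#|[pred x | root u x]| <= n)%N.
Proof.
move=> u0 su; rewrite cardE -ltnS; apply: leq_trans su.
apply: max_poly_roots => //; last exact: enum_uniq.
by apply/allP => x; rewrite mem_enum inE.
Qed.

Lemma card_fiber_trpow c : (#|[pred z | trpow Q z == c]| <= Q)%N.
Proof.
have s1 : size ('X^Q + ('X - c%:P)) = Q.+1.
  by rewrite size_polyDl size_polyXn // size_XsubC.
rewrite (eq_card (B := [pred x | root ('X^Q + ('X - c%:P)) x])).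
  by apply: card_roots_le; rewrite ?s1 // -size_poly_eq0 s1.
by move=> z; rewrite inE [RHS]inE rootE !hornerE /= subr_eq0 addrC.
Qed.

Lemma trpow_fix z : fixpow (Q ^ 2) z -> fixpow Q (trpow Q z).
Proof.
by rewrite /fixpow /trpow /= expQD -exprM mulnn => /eqP ->; rewrite addrC.
Qed.

(** The upper bound counts roots of ['X^Q - 'X]. For the lower bound, the trace maps the [Q ^ 2]
    elements of the larger field into the smaller one with fibres of at most [Q] elements. *)
Lemma card_fixpow : #|fixpow Q| = Q.
Proof.
apply/eqP; rewrite eqn_leq; apply/andP; split.
  have s1 : size ('X^Q - 'X : {poly L}) = Q.+1.
    by rewrite size_polyDl size_polyXn // size_polyN size_polyX.
  rewrite (eq_card (B := [pred x | root ('X^Q - 'X) x])).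
    by apply: card_roots_le; rewrite ?s1 // -size_poly_eq0 s1.
  by move=> z; rewrite !inE rootE !hornerE subr_eq0.
have := cE; rewrite -sum1_card (partition_big (trpow Q) (fixpow Q)) /=; last first.
  by move=> z; exact: trpow_fix.
move=> e; have : (Q * Q <= #|fixpow Q| * Q)%N.
  rewrite mulnn -e -sum_nat_const; apply: leq_sum => c _; rewrite sum1_card.
  apply: leq_trans (card_fiber_trpow c); apply: subset_leq_card.
  by apply/fintype.subsetP => z; rewrite !inE => /andP[].
by rewrite leq_pmul2r // ltnW.
Qed.

Lemma trpow_surj c : fixpow Q c -> exists2 z, fixpow (Q ^ 2) z & trpow Q z = c.
Proof.
move=> Fc.
have := cE; rewrite -sum1_card (partition_big (trpow Q) (fixpow Q)) /=; last first.
  by move=> z; exact: trpow_fix.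
move=> e.
have := @sum_nat_const_le_eq _ (fixpow Q)
  (fun c => \sum_(z | (z \in fixpow (Q ^ 2)) && (trpow Q z == c)) 1)%N Q _ _ c Fc.
rewrite sum1_card => /(_ _ _)/esym h.
have /card_gt0P[z] : (0 < #|[pred z | (z \in fixpow (Q ^ 2)) && (trpow Q z == c)]|)%N.
  rewrite -h ?(ltnW Q1) // => [i _|]; last by rewrite e card_fixpow mulnn.
  rewrite sum1_card; apply: leq_trans (card_fiber_trpow i); apply: subset_leq_card.
  by apply/fintype.subsetP => z; rewrite !inE => /andP[].
by rewrite !inE => /andP[Ez /eqP zc]; exists z.
Qed.

Definition npair (w : L * L) := #|[pred u : L * L |
  [&& fixpow Q u.1, fixpow Q u.2 & (u.1 + u.2, u.1 * u.2) == w]]|.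

Definition nroot (w : L * L) := #|[pred z |
  fixpow (Q ^ 2) z && ((trpow Q z, z ^+ Q.+1) == w)]|.

(* The roots of ['X^2 - s 'X + m]: either both lie in the small field, or they are conjugate over
   it; [npair] counts the former ordered, [nroot] the latter, and a double root is in both. *)
Lemma npair_nroot_le w : (npair w + nroot w <= 2)%N.
Proof.
case: w => s m.
have rootE z x : z \in [pred z | fixpow (Q ^ 2) z && ((trpow Q z, z ^+ Q.+1) == (s, m))] ->
    x * (s - x) = m -> (z == x) || (z == s - x).
  rewrite inE xpair_eqE => /and3P[_ /eqP zs /eqP zm] xm.
  have zQ : z ^+ Q = s - z by rewrite -zs /trpow addrC addKr.
  rewrite -subr_eq0 -[z == s - x]subr_eq0 -mulf_eq0.
  rewrite exprS zQ in zm.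
  apply/eqP; transitivity (x * (s - x) - z * (s - z)); first by ring.
  by rewrite xm zm subrr.
have card2 (T : finType) (P : pred T) a b : (forall z, z \in P -> z \in [:: a; b]) -> (#|P| <= 2)%N.
  by move=> h; rewrite (leq_trans (subset_leq_card (introT fintype.subsetP h))) // (leq_trans (card_size _)).
have card1 (T : finType) (P : pred T) a : (forall z, z \in P -> z = a) -> (#|P| <= 1)%N.
  move=> h; have h1 z : z \in P -> z \in [:: a] by move=> /h ->; exact: mem_head.
  by rewrite (leq_trans (subset_leq_card (introT fintype.subsetP h1))) // (leq_trans (card_size _)).
case: (pickP [pred u : L * L |
  [&& fixpow Q u.1, fixpow Q u.2 & (u.1 + u.2, u.1 * u.2) == (s, m)]]) => [[x y] /=|N0].
  rewrite xpair_eqE => /and4P[Fx Fy /eqP xys /eqP xym].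
  have ys : s - x = y by rewrite -xys addrC addKr.
  have xyroot : x * (s - x) = m by rewrite ys.
  have pairE u : u \in [pred u : L * L |
      [&& fixpow Q u.1, fixpow Q u.2 & (u.1 + u.2, u.1 * u.2) == (s, m)]] ->
      u \in [:: (x, y); (y, x)].
    case: u => a b; rewrite inE xpair_eqE /= => /and4P[_ _ /eqP abs /eqP abm].
    have bE : b = s - a by rewrite -abs addrC addKr.
    have : (a == x) || (a == s - x).
      rewrite -subr_eq0 -[a == s - x]subr_eq0 -mulf_eq0.
      rewrite bE in abm.
      apply/eqP; transitivity (x * (s - x) - a * (s - a)); first by ring.
      by rewrite xyroot abm subrr.
    rewrite !inE ys => /orP[] /eqP ae; rewrite bE ae ?ys ?eqxx //.
    by rewrite -xys addrK !eqxx orbT.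
  have [xy|xy] := eqVneq x y.
    rewrite -[2%N]/(1 + 1)%N leq_add //.
      by apply: (card1 _ _ (x, x)) => u /pairE; rewrite -xy !inE orbb => /eqP.
    by apply: (card1 _ _ x) => z /(rootE z x)/(_ xyroot); rewrite ys -xy orbb => /eqP.
  rewrite -[2%N]/(2 + 0)%N leq_add //; first exact: card2 pairE.
  rewrite leqn0; apply/eqP/eq_card0 => z; apply/negbTE/negP => zN.
  have := rootE z x zN xyroot; rewrite ys.
  move: zN; rewrite inE xpair_eqE /trpow -xys => /and3P[_ /eqP zs _] /orP[] /eqP ze; move: zs.
    by rewrite ze (eqP Fx) => /addrI; apply/eqP.
  by rewrite ze (eqP Fy) => /addIr/esym; apply/eqP.
rewrite /npair (eq_card0 N0) add0n /nroot.
case: (pickP [pred z | fixpow (Q ^ 2) z && ((trpow Q z, z ^+ Q.+1) == (s, m))]) => [x hx|N1].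
  apply: (card2 _ _ x (s - x)) => z /(rootE z x); rewrite !inE; apply.
  move: hx => /=; rewrite xpair_eqE => /and3P[_ /eqP zs /eqP <-].
  by rewrite -zs /trpow addrC addKr exprS.
by rewrite (eq_card0 N1).
Qed.

(** Every pair from the small field has one sum and product, every element of the large field one
    trace and norm. So over the [Q ^ 2] possible [(s, m)] the counts add up to twice [Q ^ 2], the
    maximum that [npair_nroot_le] permits. *)
Lemma npair_nroot s m : fixpow Q s -> fixpow Q m -> (npair (s, m) + nroot (s, m) = 2)%N.
Proof.
move=> Fs Fm.
pose P := [pred w : L * L | fixpow Q w.1 && fixpow Q w.2].
have cP : #|P| = (Q ^ 2)%N.
  have -> : #|P| = (#|fixpow Q| * #|fixpow Q|)%N.
    by rewrite -cardX; apply: eq_card => -[a b]; rewrite !inE.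
  by rewrite card_fixpow mulnn.
apply: (@sum_nat_const_le_eq _ P (fun w => npair w + nroot w)%N 2 _ _ (s, m)).
- by move=> w _; exact: npair_nroot_le.
- rewrite big_split /=.
  have -> : (\sum_(w | P w) npair w = #|P|)%N.
    rewrite -[RHS]sum1_card [RHS](partition_big (fun u : L * L => (u.1 + u.2, u.1 * u.2)) P) /=.
      by apply: eq_bigr => w _; rewrite /npair -sum1_card; apply: eq_bigl => u; rewrite !inE andbA.
    by move=> [a b]; rewrite !inE /= => /andP[Fa Fb]; rewrite fixpowD // fixpowM.
  have -> : (\sum_(w | P w) nroot w = #|fixpow (Q ^ 2)|)%N.
    rewrite -[RHS]sum1_card [RHS](partition_big (fun z => (trpow Q z, z ^+ Q.+1)) P) /=.
      by apply: eq_bigr => w _; rewrite /nroot -sum1_card; apply: eq_bigl => u; rewrite !inE.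
    move=> z Ez; rewrite trpow_fix //= /fixpow /= exprSr exprMn -exprM mulnn.
    by rewrite (eqP Ez) mulrC.
  by rewrite cE cP addnn muln2.
- by rewrite /P /= Fs Fm.
Qed.

End QuadraticStep.

(** A nontrivial additive character of the subfield [fixpow n], given as a function on all of [L]
    that is constrained on the subfield. [fchar_conj] says that its values are unitary. *)
Record fchar (L : finFieldType) (n : nat) (psi : L -> algC) : Prop := Fchar {
  fcharD : forall x y, fixpow n x -> fixpow n y -> psi (x + y) = psi x * psi y;
  fchar_conj : forall x, fixpow n x -> (psi x)^* = psi (- x);
  fchar0 : psi 0 = 1;
  fchar_nt : exists2 x, fixpow n x & psi x != 1 }.

(** The Kloosterman sum over the subfield [fixpow n]. *)
Definition klf (L : finFieldType) (n : nat) (psi : L -> algC) (b : L) : algC :=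
  \sum_(x | fixpow n x && (x != 0)) psi (x + b / x).

Section KloostermanStep.

Variables (L : finFieldType) (Q : nat).
Hypothesis Qnat : [pchar L].-nat Q.
Hypothesis Q1 : (1 < Q)%N.

Local Notation F := (@fixpow L Q).
Local Notation E := (@fixpow L (Q ^ 2)).
Local Notation tr := (@trpow L Q).

Lemma fixpowN x : F x -> F (- x).
Proof.
move=> Fx; rewrite /fixpow /= -subr_eq0 opprK addrC.
by rewrite -[X in X + _](eqP Fx) -(expQD Qnat) subrr; exact: fixpow0.
Qed.

Lemma fchar_sum0 psi t : fchar Q psi -> F t -> t != 0 ->
  \sum_(x | F x) psi (x * t) = 0.
Proof.
move=> [psiD _ _ [x0 Fx0 psi1]] Ft t0.
have Fu : F (x0 / t) by apply: fixpowM => //; exact: fixpowV.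
apply: (@mulfI _ (psi x0 - 1)); first by rewrite subr_eq0.
rewrite mulr0 mulrBl mul1r mulr_sumr; apply/eqP; rewrite subr_eq0; apply/eqP.
rewrite [RHS](reindex_inj (addIr (x0 / t))) /=.
apply: eq_big => [x|x Fx].
  apply/idP/idP => [Fx|]; first exact: fixpowD.
  by move=> h; rewrite -[x](addrK (x0 / t)) (fixpowD Qnat) // fixpowN.
by rewrite mulrDl divfK // [RHS]psiD 1?mulrC // fixpowM.
Qed.

Lemma fchar_sum psi t : fchar Q psi -> F t ->
  \sum_(x | F x) psi (x * t) = if t == 0 then #|F|%:R else 0.
Proof.
move=> fpsi Ft; case: eqP => [->|/eqP t0]; last exact: fchar_sum0.
under eq_bigr => x _ do rewrite mulr0 (fchar0 fpsi).
by rewrite sumr_const.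
Qed.

(** Conjugation amounts to replacing [x] by [- x]. Being real, the sum has a nonnegative square, on
    which the one-sided bounds rely. *)
Lemma klf_real psi b : fchar Q psi -> F b -> klf Q psi b \is Num.real.
Proof.
move=> fpsi Fb; rewrite CrealE; apply/eqP.
rewrite /klf rmorph_sum [RHS](reindex_inj (@oppr_inj L)) /=.
apply: eq_big => [x|x /andP[Fx _]].
  rewrite oppr_eq0; congr (_ && _); apply/idP/idP => Fx; last rewrite -[x]opprK.
    exact: fixpowN.
  exact: fixpowN.
by rewrite (fchar_conj fpsi) ?opprD ?invrN ?mulrN // fixpowD // fixpowM // fixpowV.
Qed.

Hypothesis cE : #|E| = (Q ^ 2)%N.

Lemma trpowD x y : tr (x + y) = tr x + tr y.
Proof. by rewrite /trpow (expQD Qnat) addrACA. Qed.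

Lemma fchar_step psi : fchar Q psi -> fchar (Q ^ 2) (psi \o tr).
Proof.
move=> fpsi; have tr0 : tr 0 = 0 by apply: (@addrI _ (tr 0)); rewrite -trpowD !addr0.
split=> [x y Ex Ey|x Ex||] /=.
- by rewrite trpowD (fcharD fpsi) // trpow_fix.
- rewrite (fchar_conj fpsi) ?trpow_fix //; congr psi.
  by apply/esym/eqP; rewrite -addr_eq0 -trpowD addNr tr0.
- by rewrite tr0 (fchar0 fpsi).
- have [x Fx psi1] := fchar_nt fpsi.
  by have [z Ez zx] := trpow_surj Qnat Q1 cE Fx; exists z; rewrite //= zx.
Qed.

(** If [x] and [y] have sum [s] and product [m], then [(x + b / x) + (y + b / y) = s * (1 + b / m)].
    This covers pairs from the small field as well as conjugates [z] and [z ^+ Q], so the square of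
    the small sum and the large sum are sums of the same [G], with weights [npair] and [nroot]. *)
Let G (psi : L -> algC) (b : L) (w : L * L) := psi (w.1 * (1 + b / w.2)).

Let W := [pred w : L * L | [&& F w.1, F w.2 & w.2 != 0]].

Lemma klf_step_top psi b : F b ->
  klf (Q ^ 2) (psi \o tr) b = \sum_(w | W w) G psi b w *+ nroot Q w.
Proof.
move=> Fb; rewrite /klf (partition_big (fun z => (tr z, z ^+ Q.+1)) W) /=; last first.
  move=> z /andP[Ez z0]; rewrite trpow_fix //= expf_neq0 // andbT.
  by rewrite /fixpow /= exprSr exprMn -exprM mulnn (eqP Ez) mulrC.
apply: eq_bigr => w /and3P[_ _ w0]; rewrite /nroot -sumr_const.
apply: eq_big => [z|z /andP[/andP[Ez z0] /eqP zw]].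
  rewrite !inE; case: ((tr z, _) =P w) => [zw|]; last by rewrite !andbF.
  have -> : z != 0 by apply: contraNneq w0 => z0; rewrite -zw z0 /= expr0n.
  by rewrite !andbT.
rewrite /G -zw /=; congr psi; rewrite /trpow (expQD Qnat) exprMn exprVn (eqP Fb) exprS.
have zQ0 : z ^+ Q != 0 by rewrite expf_neq0.
by field; rewrite zQ0.
Qed.

Lemma klf_step_sqr psi b : fchar Q psi -> F b ->
  klf Q psi b ^+ 2 = \sum_(w | W w) G psi b w *+ npair Q w.
Proof.
move=> fpsi Fb; rewrite /klf expr2 big_distrlr /=.
rewrite pair_big /= (partition_big (fun u : L * L => (u.1 + u.2, u.1 * u.2)) W) /=; last first.
  move=> [x y] /= /andP[/andP[Fx x0] /andP[Fy y0]].
  by rewrite (fixpowD Qnat) // fixpowM // mulf_neq0.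
apply: eq_bigr => w /and3P[_ _ w0]; rewrite /npair -sumr_const.
apply: eq_big => [[x y]|[x y] /andP[/andP[/andP[Fx x0] /andP[Fy y0]] /eqP xyw]] /=.
  rewrite !inE /=; case: ((x + y, _) =P w) => [xyw|]; last by rewrite !andbF.
  rewrite !andbT; have : (x * y != 0) by move: w0; rewrite -xyw.
  by rewrite mulf_eq0 negb_or => /andP[-> ->]; rewrite !andbT.
move: Fx x0 Fy y0 xyw => /= Fx x0 Fy y0 xyw.
rewrite -(fcharD fpsi) ?(fixpowD Qnat) ?fixpowM ?fixpowV // /G -xyw /=; congr psi.
by field; rewrite x0 y0.
Qed.

(** By [npair_nroot] the two weights add up to 2 for every sum [s] and product [m]. Summing over [s]
    first leaves only the [m] with [1 + b / m = 0]. *)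
Lemma klf_step psi b : fchar Q psi -> F b -> b != 0 ->
  klf (Q ^ 2) (psi \o tr) b = (2 * Q)%:R - klf Q psi b ^+ 2.
Proof.
move=> fpsi Fb b0; apply/eqP; rewrite eq_sym subr_eq eq_sym; apply/eqP.
rewrite klf_step_top // klf_step_sqr // -big_split /=.
transitivity (\sum_(w | W w) G psi b w *+ 2).
  apply: eq_bigr => -[s m] /and3P[/= Fs Fm m0].
  by rewrite -mulrnDr addnC npair_nroot.
rewrite sumrMnl natrM mulr_natl; congr (_ *+ 2).
transitivity (\sum_(m | F m && (m != 0)) \sum_(s | F s) psi (s * (1 + b / m))).
  rewrite exchange_big pair_big /=; apply: eq_big => [[s m]|[s m] _] //=.
rewrite (bigD1 (- b)) /=; last by rewrite fixpowN // oppr_eq0.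
rewrite fchar_sum //; last first.
  by rewrite (fixpowD Qnat) ?fixpow1 // fixpowM // fixpowV // fixpowN.
rewrite invrN mulrN divff // subrr eqxx card_fixpow // big1 ?addr0 //.
move=> m /andP[/andP[Fm m0] mb]; rewrite fchar_sum0 //.
  by rewrite (fixpowD Qnat) ?fixpow1 // fixpowM // fixpowV.
apply: contraNneq mb => e; rewrite -subr_eq0 opprK -(mulIr_eq0 _ (@mulIf _ m^-1 _)) ?invr_eq0 //.
by rewrite mulrDl divff // e.
Qed.

End KloostermanStep.

(** * Weil's bound at primes *)

(** Euler's criterion by counting: each nonzero square has at most two roots, so there are at least
    [h] of them, and all lie among the at most [h] roots of ['X^h - 1]. *)
Lemma finField_sqrtP (L : finFieldType) (x : L) :
  odd #|L| -> x != 0 -> x ^+ #|L|./2 != -1 -> exists y, y ^+ 2 = x.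
Proof.
move=> oddL x0 x1.
set h := #|L|./2 in x1; have Lh : #|L| = h.*2.+1 by rewrite -[LHS]odd_double_half oddL.
have h0 : (0 < h)%N by have := finNzRing_gt1 L; rewrite Lh; lia.
pose SQ := [set y ^+ 2 | y in [pred y : L | y != 0]].
pose A := [set z : L | z ^+ h == 1].
have Lx (y : L) : y != 0 -> (y ^+ h) ^+ 2 = 1.
  by move=> y0; apply: (mulIf y0); rewrite -exprM muln2 -exprSr -Lh expf_card mul1r.
have SA : SQ \subset A.
  by apply/fintype.subsetP => z /imsetP[y y0 ->]; rewrite inE -exprM mulnC exprM Lx.
have cA : (#|A| <= h)%N.
  rewrite (eq_card (B := [pred x | root ('X^h - 1) x])).
    by apply: card_roots_le; rewrite ?size_XnsubC // -size_poly_eq0 size_XnsubC.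
  by move=> z; rewrite !inE rootE !hornerE subr_eq0.
have cS : (h <= #|SQ|)%N.
  have c0 : #|[pred y : L | y != 0]| = h.*2.
    have := cardC (pred1 (0 : L)); rewrite card1 Lh add1n => -[<-].
    by apply: eq_card.
  suff : (#|[pred y : L | y != 0%R]| <= #|SQ| * 2)%N by rewrite c0 muln2 leq_double.
  rewrite -[X in (X <= _)%N]sum1_card (partition_big (fun y => y ^+ 2) (mem SQ)) /=; last first.
    by move=> y y0; apply: imset_f; rewrite inE.
  rewrite -sum_nat_const; apply: leq_sum => z /imsetP[y y0 zE]; rewrite sum1_card.
  have sub : [pred i : L | (i \in [pred y : L | y != 0]) && (i ^+ 2 == z)] \subset [:: y; - y].
    by apply/fintype.subsetP => w; rewrite !inE zE eqf_sqr => /andP[].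
  exact: leq_trans (subset_leq_card sub) (card_size _).
have AS : SQ = A by apply/eqP; rewrite eqEcard SA (leq_trans cA).
have : x \in SQ.
  have := Lx x x0; move/eqP; rewrite AS inE sqrf_eq1 => /orP[//|].
  by rewrite (negPf x1).
by case/imsetP => y _ ->; exists y.
Qed.

(** * The tower of quadratic extensions and its additive characters *)

Section Tower.

Variables (L : finFieldType) (p k : nat).
Hypothesis pL : p \in [pchar L].
Hypothesis cL : #|L| = (p ^ 2 ^ k)%N.

Local Notation Q j := (p ^ 2 ^ j)%N.
Local Notation F j := (@fixpow L (Q j)).

Let pp : prime p := pcharf_prime pL.

Lemma QS j : Q j.+1 = (Q j ^ 2)%N.
Proof. by rewrite expnSr expnM. Qed.

Lemma pcharQ j : [pchar L].-nat (Q j).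
Proof. by rewrite (eq_pnat _ (pcharf_eq pL)) pnatX pnat_id. Qed.

Lemma Q_gt1 j : (1 < Q j)%N.
Proof. by have := @ltn_exp2l p 0 (2 ^ j) (prime_gt1 pp); rewrite expn0 expn_gt0 => ->. Qed.

(** Descent from the top: [L] itself is level [k], and [card_fixpow] passes from each level to the
    one below. *)
Lemma card_tower j : (j <= k)%N -> #|F j| = Q j.
Proof.
move=> jk; rewrite -(subKn jk); elim: (k - j)%N (leq_subr j k) => [_|i IH ik].
  rewrite subn0 -cL; apply: eq_card => x; rewrite inE /= unfold_in /=.
  by rewrite expf_card eqxx.
have := IH (ltnW ik); rewrite -(subnSK ik) QS => e.
by apply: card_fixpow e; [exact: pcharQ|exact: Q_gt1].
Qed.

(** The trace from level [j] to the prime field, built from quadratic traces so that one level of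
    the tower is one application of [klf_step]. *)
Fixpoint Trj (j : nat) (z : L) : L :=
  if j is i.+1 then Trj i (trpow (Q i) z) else z.

Lemma TrjD j x y : Trj j (x + y) = Trj j x + Trj j y.
Proof.
elim: j x y => [//|j IH] x y /=.
by rewrite (trpowD (pcharQ j) x y) IH.
Qed.

Lemma Trj0 j : Trj j 0 = 0.
Proof. by apply: (@addrI _ (Trj j 0)); rewrite -TrjD !addr0. Qed.

Lemma TrjN j x : Trj j (- x) = - Trj j x.
Proof. by apply/eqP; rewrite -addr_eq0 -TrjD addNr Trj0. Qed.

Lemma Trj_fix j z : F j z -> F 0 (Trj j z).
Proof.
elim: j z => [//|j IH] z; rewrite QS => Fz /=; apply: IH.
by apply: trpow_fix => //; exact: pcharQ.
Qed.

Lemma Trj_Frobenius j z : Trj j (z ^+ p) = Trj j z ^+ p.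
Proof.
elim: j z => [//|j IH] z /=; rewrite -IH /trpow.
by rewrite (@expQD _ _ (pcharQ 0)) -!exprM mulnC.
Qed.

Lemma fixpow_top z : F k z.
Proof. by rewrite /fixpow /= -cL expf_card. Qed.

Section Characters.

Variable psi : L -> algC.
Hypothesis fpsi : fchar p psi.

(** As [a] runs through the prime field, these are the characters of level [j] that factor through
    the trace; [a = 0] gives the trivial one. *)
Definition tchar (a : L) (j : nat) (z : L) := psi (a * Trj j z).

Lemma fchar_tchar a j : F 0 a -> a != 0 -> (j <= k)%N -> fchar (Q j) (tchar a j).
Proof.
move=> Fa a0; elim: j => [_|j IH jk]; last first.
  rewrite QS; apply: (@fchar_step _ (Q j) (pcharQ j) (Q_gt1 j) _ (tchar a j)).
    by rewrite -QS card_tower.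
  exact/IH/ltnW.
have Fm x : F 0 x -> F 0 (a * x) by exact: fixpowM.
split=> [x y Fx Fy|x Fx||]; rewrite /tchar /=.
- by rewrite mulrDr (fcharD fpsi) //; exact: Fm.
- by rewrite mulrN (fchar_conj fpsi) //; exact: Fm.
- by rewrite mulr0 (fchar0 fpsi).
- have [x Fx psi1] := fchar_nt fpsi; exists (x / a).
    by apply: fixpowM => //; exact: fixpowV.
  by rewrite mulrC divfK.
Qed.

Lemma klf_tower_step a b j : F 0 a -> a != 0 -> F 0 b -> b != 0 -> (j < k)%N ->
  klf (Q j.+1) (tchar a j.+1) b = (2 * Q j)%:R - klf (Q j) (tchar a j) b ^+ 2.
Proof.
move=> Fa a0 Fb b0 jk; have Fjb i : F i b.
  elim: i => [//|i IH]; rewrite QS; exact: fixpow_sqr.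
have := @klf_step _ (Q j) (pcharQ j) (Q_gt1 j) _ (tchar a j) b _ (Fjb j) b0.
rewrite -QS card_tower // => /(_ erefl (fchar_tchar Fa a0 (ltnW jk))) <-.
by [].
Qed.

Lemma sum_tchar z : \sum_(a | F 0 a) tchar a k z = if Trj k z == 0 then p%:R else 0.
Proof.
have c0 : #|F 0| = p by rewrite card_tower.
rewrite -[in RHS]c0 -(fchar_sum (pcharQ 0) (Q_gt1 0) fpsi) //.
exact/Trj_fix/fixpow_top.
Qed.

(** The sum of [tchar a k z] over [a] and [z] in both orders: summing over [a] first detects the
    kernel, summing over [z] first leaves only [a = 0]. *)
Lemma card_Trj_ker : (p * #|[pred z | Trj k z == 0%R]|)%N = #|L|.
Proof.
apply/eqP; rewrite -(eqr_nat algC) natrM mulr_natr -sumr_const.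
have -> : \sum_(z in [pred z | Trj k z == 0]) p%:R = \sum_z \sum_(a | F 0 a) tchar a k z.
  by rewrite big_mkcond /=; apply: eq_bigr => z _; rewrite sum_tchar inE.
rewrite exchange_big (bigD1 0) /=; last exact: (fixpow0 _ (Q_gt1 0)).
rewrite [X in _ + X]big1 ?addr0 => [|a /andP[Fa a0]].
  under eq_bigr => z _ do rewrite /tchar mul0r (fchar0 fpsi).
  by rewrite sumr_const.
rewrite -[RHS](fchar_sum0 (pcharQ k) (Q_gt1 k) (fchar_tchar Fa a0 (leqnn k)) (@fixpow1 L (Q k)) (oner_neq0 L)).
by apply: eq_big => [z|z _]; rewrite ?fixpow_top ?mulr1.
Qed.

Lemma card_artin_schreier z :
  #|[pred y | y ^+ p - y == z]| = if Trj k z == 0 then p else 0.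
Proof.
have kerP (y : L) : Trj k (y ^+ p - y) = 0.
  rewrite TrjD TrjN Trj_Frobenius; apply/eqP; rewrite subr_eq0.
  exact: (Trj_fix (fixpow_top y)).
case: eqP => [z0|z0]; last first.
  by apply: eq_card0 => y; rewrite !inE; apply/eqP => e; rewrite -e kerP in z0.
apply: (@sum_nat_const_le_eq _ [pred z | Trj k z == 0]
  (fun z => #|[pred y | y ^+ p - y == z]|) p); last by rewrite /= z0.
  move=> c _; have p1 := prime_gt1 pp.
  have s1 : size ('X^p - ('X + c%:P)) = p.+1.
    by rewrite size_polyDl size_polyXn // size_polyN size_XaddC.
  rewrite (eq_card (B := [pred x | root ('X^p - ('X + c%:P)) x])).
    by apply: card_roots_le; rewrite ?s1 // -size_poly_eq0 s1.
  by move=> y; rewrite inE [RHS]inE rootE !hornerE /= subr_eq0 subr_eq addrC.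
rewrite mulnC card_Trj_ker -sum1_card (partition_big (fun y => y ^+ p - y) [pred z | Trj k z == 0]) /=.
  by apply: leq_sum => w _; rewrite -sum1_card; apply: eq_leq; apply: eq_bigl => y; rewrite !inE.
by move=> y _; rewrite kerP.
Qed.

End Characters.

End Tower.

(** * Points on the Artin-Schreier curve *)

Definition klcount (L : finFieldType) (p : nat) (b : L) : nat :=
  \sum_(x : L | x != 0%R) #|[pred y | (y ^+ p - y == x + b / x)%R]|.

Lemma sum_klf (L : finFieldType) (p k : nat) (psi : L -> algC) (b : L) :
  p \in [pchar L] -> #|L| = (p ^ 2 ^ k)%N -> fchar p psi ->
  \sum_(a | fixpow p a) klf (p ^ 2 ^ k) (tchar p psi a k) b = (klcount p b)%:R.
Proof.
move=> pL cL fpsi; rewrite /klcount natr_sum /klf exchange_big /=.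
apply: eq_big => [x|x _]; first by rewrite fixpow_top.
rewrite (card_artin_schreier pL cL fpsi) (sum_tchar pL cL fpsi).
by case: ifP.
Qed.

(** For given [y], the equation of the curve is quadratic in [x] with discriminant [f.[y]], so each
    [y] with [f.[y]] a nonzero square gives two points. The other [y] are at most [2 * p] roots of
    [f] and those bounded by [stepanov] with degree [m = 2 * p], the source of [6 * p + 2]. *)
Lemma klcount_ge (L : finFieldType) (p i : nat) (b : L) :
  p \in [pchar L] -> #|L| = (p ^ 2 ^ i.+1)%N -> odd p -> b != 0 ->
  (4 * p < p ^ 2 ^ i - 1)%N ->
  (#|L| <= klcount p b + 4 * p + (6 * p + 2) * p ^ 2 ^ i)%N.
Proof.
move=> pL cL oddp b0 pi; set Q := (p ^ 2 ^ i)%N in pi *.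
have cQ : #|L| = (Q ^ 2)%N by rewrite cL expnSr expnM.
have oddQ : odd Q by rewrite /Q oddX oddp orbT.
have pp := pcharf_prime pL.
have two0 : (2%:R : L) != 0.
  by rewrite -(dvdn_pcharf pL) dvdn_prime2 //; apply: contraTneq oddp => ->.
pose u : {poly L} := 'X^p - 'X.
pose c := 4%:R * b; pose f := u ^+ 2 - c%:P.
have c0 : c != 0 by rewrite mulf_neq0 // (natrM _ 2 2) mulf_neq0.
have su : size u = p.+1.
  by rewrite size_polyDl size_polyXn // size_polyN size_polyX ltnS prime_gt1.
have sf : size f = (2 * p).+1.
  have su2 : size (u ^+ 2) = (2 * p).+1.
    rewrite -[LHS]prednK ?size_exp ?su // ?(mulnC 2) //.
    by rewrite lt0n size_poly_eq0 expf_neq0 // -size_poly_eq0 su.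
  rewrite size_polyDl su2 // size_polyN (leq_ltn_trans (size_polyC_leq1 _)) //.
  by have := prime_gt0 pp; lia.
have f00 : f.[0] != 0.
  by rewrite !hornerE expr0n gtn_eqF ?prime_gt0 //= subrr expr0n /= sub0r oppr_eq0.
have fder : f^`() = - (2%:R *: u).
  have u' : u^`() = -1.
    by rewrite /u derivB derivXn derivX -mulr_natr -polyC_natr (pcharf0 pL) mulr0 sub0r.
  by rewrite /f derivB derivC subr0 deriv_exp u' mulN1r mulNrn expr1 scaler_nat.
have sepf : separable_poly f.
  rewrite separable_poly.unlock fder; apply/Bezout_eq1_coprimepP.
  (* Bezout coefficients read off from [u ^+ 2 - f = c%:P] and the derivative [-2 * u] of [f]. *)
  exists (- c^-1%:P, - (c^-1 / 2%:R) *: u) => /=.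
  have e1 : c^-1%:P * c%:P = 1 by rewrite -polyCM mulVf.
  have e2 : 2%:R^-1%:P * 2%:R%:P = 1 :> {poly L} by rewrite -polyCM mulVf.
  rewrite scaleNr -!mul_polyC polyCM /f.
  transitivity (c^-1%:P * c%:P + c^-1%:P * u ^+ 2 * (2%:R^-1%:P * 2%:R%:P - 1)); first by ring.
  by rewrite e1 e2 subrr mulr0 addr0.
have := stepanov cQ (pcharQ pL i) oddQ sepf sf _ f00 _.
rewrite muln_gt0 /= => /(_ (prime_gt0 pp)) st.
have {}st := st ltac:(by move: oddQ pi; clear; clearbody Q; lia); move: st.
set Nm := #|_| => hNm.
have hN0 : (#|[pred y | f.[y] == 0%R]| <= 2 * p)%N.
  rewrite (eq_card (B := [pred x | root f x])) => [|y]; last by rewrite !inE.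
  by apply: card_roots_le; rewrite ?sf // -size_poly_eq0 sf.
pose good := [pred y | (f.[y] != 0) && (f.[y] ^+ (Q ^ 2)%N./2 != -1)].
have hgood : (#|L| <= #|good| + (#|[pred y | f.[y] == 0%R]| + Nm))%N.
  rewrite -(cardC good) leq_add2l.
  apply: leq_trans (leq_add (leqnn _) (leqnn _)).
  rewrite -cardUI; apply: leq_trans (leq_addr _ _); apply: subset_leq_card.
  by apply/fintype.subsetP => y; rewrite !inE negb_and !negbK.
have hcount : (2 * #|good| <= klcount p b)%N.
  rewrite /klcount; under eq_bigr => x _ do rewrite -sum1_card.
  rewrite (exchange_big_dep predT) //= mulnC -sum_nat_const.
  rewrite [X in (_ <= X)%N](bigID good) /= -[X in (X <= _)%N]addn0 leq_add //.
  apply: leq_sum => y /andP[fy0 fy1]; rewrite sum1_card.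
  have [r rE] : exists r, r ^+ 2 = f.[y].
    by apply: finField_sqrtP; rewrite ?cQ // oddX oddQ.
  have fyE : f.[y] = (y ^+ p - y) ^+ 2 - 4%:R * b by rewrite !hornerE.
  set w := y ^+ p - y in fyE.
  have r0 : r != 0 by apply: contraNneq fy0 => r0; rewrite -rE r0 expr0n.
  have xP s : s ^+ 2 = f.[y] -> [/\ (w + s) / 2%:R != 0 & w = (w + s) / 2%:R + b / ((w + s) / 2%:R)].
    move=> sE; have ws : (w + s) * (w - s) = 4%:R * b.
      by rewrite mulrC -subr_sqr sE fyE opprB addrC subrK.
    have ws0 : w + s != 0.
      by apply: contraNneq c0 => ws0; rewrite /c -ws ws0 mul0r.
    split; first by rewrite mulf_neq0 // invr_eq0.
    have bE : b = (w + s) * (w - s) / 4%:R.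
      by rewrite ws mulrAC divff ?mul1r // (natrM _ 2 2) mulf_neq0.
    rewrite bE; field.
    by rewrite two0 ws0 (natrM _ 2 2) mulf_neq0.
  have sub : [:: (w + r) / 2%:R; (w - r) / 2%:R] \subset
      [pred x : L | (x != 0) && (y \in [pred y | (y ^+ p - y == x + b / x)%R])].
    apply/fintype.subsetP => x; rewrite !inE -/w => /orP[] /eqP ->.
      by have [-> <-] := xP r rE; rewrite eqxx.
    by have [-> <-] := xP (- r) ltac:(by rewrite sqrrN); rewrite eqxx.
  apply: leq_trans (subset_leq_card sub).
  rewrite (card_uniqP _) //= inE andbT.
  apply: contraNneq r0 => /(mulIf (invr_neq0 two0)) /addrI e.
  have : r *+ 2 = 0 by rewrite mulr2n [X in X + _]e addNr.
  by rewrite -mulr_natr => /eqP; rewrite mulf_eq0 (negPf two0) orbF.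
move: hgood hcount hNm hN0; rewrite cQ.
clear; clearbody Q; move: (#|good|) (#|_|) (klcount _ _) => A B N; lia.
Qed.

Lemma conj_unity_root (z : algC) n : (0 < n)%N -> z ^+ n = 1 -> z^* = z^-1.
Proof.
move=> n0 zn; have z1 : `|z| = 1.
  by apply/eqP; rewrite -(@pexpr_eq1 _ _ n) // -normrX zn normr1.
by rewrite invC_norm z1 expr1n invr1 mul1r.
Qed.

Lemma natr_pchar_inj (R : nzRingType) (p : nat) (i j : nat) : p \in [pchar R] ->
  (i < p)%N -> (j < p)%N -> i%:R = j%:R :> R -> i = j.
Proof.
move=> pR; wlog ij : i j / (i <= j)%N.
  by move=> W ip jp e; case: (leqP i j) => [|/ltnW] h; [|apply/esym]; apply: W.
move=> _ jp /eqP; rewrite eq_sym -subr_eq0 -natrB // -(dvdn_pcharf pR) => d.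
apply/eqP; rewrite eqn_leq ij -subn_eq0 /=; move: d.
have [//|k0 d] := posnP (j - i).
by have := dvdn_leq k0 d; lia.
Qed.

Section PrimeFieldCharacter.

Variables (L : finFieldType) (p k : nat) (zeta : algC).
Hypothesis pL : p \in [pchar L].
Hypothesis cL : #|L| = (p ^ 2 ^ k)%N.
Hypothesis prz : p.-primitive_root zeta.

Let pp : prime p := pcharf_prime pL.
Let p0 := prime_gt0 pp.

(** The index [i] is the residue that [x] represents; the value 1 is a default outside the prime
    field. *)
Definition natchar (x : L) : algC :=
  if [pick i : 'I_p | i%:R == x] is Some i then zeta ^+ i else 1.

Lemma natr_modp n : (n %% p)%:R = n%:R :> L.
Proof. by rewrite [in RHS](divn_eq n p) natrD natrM (pcharf0 pL) mulr0 add0r. Qed.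

Lemma natchar_nat n : natchar n%:R = zeta ^+ n.
Proof.
rewrite /natchar; case: pickP => [i /eqP|/(_ (Ordinal (ltn_pmod n p0)))] /=.
  rewrite -(natr_modp n) => /(natr_pchar_inj pL (ltn_ord i) (ltn_pmod n p0)) ->.
  by rewrite (prim_expr_mod prz).
by rewrite natr_modp eqxx.
Qed.

Lemma fixpow_natr n : fixpow p (n%:R : L).
Proof. by rewrite /fixpow /= -(pFrobenius_autE pL) rmorph_nat. Qed.

Lemma fixpow_natP (x : L) : fixpow p x -> exists i : 'I_p, x = i%:R.
Proof.
move=> Fx.
have c0 : #|@fixpow L p| = p := card_tower pL cL (leq0n k).
have inj : injective (fun i : 'I_p => i%:R : L).
  by move=> i j /(natr_pchar_inj pL (ltn_ord i) (ltn_ord j)) /val_inj.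
have sub : codom (fun i : 'I_p => i%:R : L) \subset fixpow p.
  by apply/fintype.subsetP => y /codomP[i ->]; exact: fixpow_natr.
have : x \in codom (fun i : 'I_p => i%:R : L).
  have /subset_cardP := sub; rewrite c0 card_codom // card_ord => /(_ erefl) ->.
  exact: Fx.
by case/codomP => i ->; exists i.
Qed.

Lemma fchar_natchar : fchar p natchar.
Proof.
split=> [x y /fixpow_natP[i ->] /fixpow_natP[j ->]|x /fixpow_natP[i ->]||].
- by rewrite -natrD !natchar_nat exprD.
- have -> : - i%:R = (i * p.-1)%:R :> L.
    apply/eqP; rewrite eq_sym -addr_eq0 -natrD -mulnSr prednK //.
    by rewrite natrM (pcharf0 pL) mulr0.
  have zp := prim_expr_order prz.
  rewrite !natchar_nat (@conj_unity_root _ p) //; last by rewrite exprAC zp expr1n.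
  apply: (@mulIf _ (zeta ^+ i)).
    by rewrite expf_neq0 // (prim_root_eq0 prz) -lt0n.
  rewrite -exprD -mulnSr prednK // mulnC exprM zp expr1n mulVf //.
  by rewrite expf_neq0 // (prim_root_eq0 prz) -lt0n.
- by rewrite -[0]/(0%:R) natchar_nat expr0.
- exists 1; first exact: fixpow1.
  have -> : natchar 1 = zeta by rewrite -[zeta]expr1 -natchar_nat.
  rewrite -[zeta]expr1 -(prim_order_dvd prz).
  by rewrite dvdn1 gtn_eqF // prime_gt1.
Qed.

(** Passage from field elements to residues. As [p] does not divide [beta], the condition on [x * y]
    excludes [x = 0] and otherwise determines [y]. *)
Lemma klf_natchar (beta : nat) : ~~ (p %| beta)%N ->
  klf p natchar beta%:R =
  \sum_(x < p) \sum_(y < p | (x * y == beta %[mod p])%N) zeta ^+ (x + y).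
Proof.
move=> pb; have b0 : (beta%:R : L) != 0 by rewrite -(dvdn_pcharf pL).
have modE m n : (m == n %[mod p])%N = (m%:R == n%:R :> L).
  apply/eqP/eqP => [e|e]; first by rewrite -natr_modp e natr_modp.
  apply: (natr_pchar_inj pL (ltn_pmod m p0) (ltn_pmod n p0)).
  by rewrite !natr_modp.
rewrite /klf (reindex (fun i : 'I_p => i%:R : L)) /=; last first.
  exists (fun x => odflt (Ordinal p0) [pick i : 'I_p | i%:R == x]) => [i _|x].
    case: pickP => [j /eqP|/(_ i)] /=; last by rewrite eqxx.
    by move/(natr_pchar_inj pL (ltn_ord j) (ltn_ord i)) /val_inj.
  rewrite inE => /andP[/fixpow_natP[i xi] _].
  by case: pickP => [j /eqP //|/(_ i)]; rewrite xi eqxx.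
rewrite [RHS](bigID (fun x : 'I_p => x%:R == 0 :> L)) /= [X in _ = X + _]big1 ?add0r.
  apply: eq_big => [i|i /andP[_ i0]]; first by rewrite fixpow_natr.
  have [y yE] : exists y : 'I_p, beta%:R / i%:R = y%:R :> L.
    by apply: fixpow_natP; apply: fixpowM; [|apply: fixpowV]; exact: fixpow_natr.
  rewrite (big_pred1 y) ?yE -?natrD ?natchar_nat // => z /=.
  rewrite modE natrM; apply/eqP/eqP => [e|->].
    apply/val_inj/(natr_pchar_inj pL (ltn_ord z) (ltn_ord y)).
    by rewrite -yE -e mulrAC divff // mul1r.
  by rewrite -yE mulrC divfK.
move=> i /eqP i0; apply: big1 => y; rewrite modE natrM i0 mul0r => /eqP/esym.
by move/eqP: b0.
Qed.

End PrimeFieldCharacter.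

(** With [t j = - T j.+1 / q j] the recursion reads [t j.+1 = t j ^+ 2 - 2], which repels from its
    fixed point 2: an initial excess [delta] grows by at least [delta] at every step. This linear
    growth is enough. *)
Lemma tower_growth (T : nat -> algC) (q : nat -> nat) (delta : algC) n :
  (forall j, q j.+1 = (q j ^ 2)%N) ->
  (forall j, (j < n)%N -> T j.+1 = (2 * q j)%:R - T j ^+ 2) ->
  0 <= delta -> (4%:R + delta) * (q 0%N)%:R <= T 0%N ^+ 2 ->
  forall j, (j < n)%N -> (2%:R + j.+1%:R * delta) * (q j)%:R <= - T j.+1.
Proof.
move=> qS TS d0 T0; elim=> [|j IH] jn; rewrite TS // opprB natrM lerBrDr.
  by apply: le_trans T0; rewrite -mulrDl mul1r addrAC -natrD.
have := IH (ltnW jn); set D := - T j.+1 => hD.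
rewrite -[T j.+1]opprK -/D sqrrN -mulrDl qS.
apply: le_trans (_ : ((2%:R + j.+1%:R * delta) * (q j)%:R) ^+ 2 <= _); last first.
  have h0 : 0 <= (2%:R + j.+1%:R * delta) * (q j)%:R.
    by rewrite mulr_ge0 ?ler0n // addr_ge0 ?ler0n // mulr_ge0 ?ler0n.
  by rewrite lerXn2r // nnegrE // (le_trans h0).
rewrite exprMn natrX ler_wpM2r ?exprn_ge0 ?ler0n //.
rewrite -subr_ge0.
have -> : (2%:R + j.+1%:R * delta) ^+ 2 - (2%:R + j.+2%:R * delta + 2%:R) =
   (j.+1%:R * delta) ^+ 2 + (2%:R + 3%:R * j%:R) * delta.
  by rewrite -[in j.+2%:R]addn1 -[in j.+1%:R]addn1 !natrD; ring.
by rewrite addr_ge0 ?mulr_ge0 ?exprn_ge0 ?addr_ge0 ?mulr_ge0 ?ler0n.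
Qed.

(** The term [a = 0] is at most the size of the field, and [a = 1] is kept. For every other [a] the
    last step of the tower subtracts the square of a real number from [2 * p ^ 2 ^ i]. *)
Lemma sum_klf_le (L : finFieldType) (p i : nat) (psi : L -> algC) (b : L) :
  p \in [pchar L] -> #|L| = (p ^ 2 ^ i.+1)%N -> fchar p psi ->
  fixpow p b -> b != 0 ->
  \sum_(a | fixpow p a) klf (p ^ 2 ^ i.+1) (tchar p psi a i.+1) b <=
    #|L|%:R + klf (p ^ 2 ^ i.+1) (tchar p psi 1 i.+1) b + (2 * p * p ^ 2 ^ i)%:R.
Proof.
move=> pL cL fpsi Fb b0.
rewrite (bigD1 0) /=; last exact: (fixpow0 _ (Q_gt1 pL 0)).
rewrite (bigD1 1) /=; last by rewrite oner_eq0 andbT; exact: (@fixpow1 L p).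
rewrite addrA lerD //.
  rewrite lerD2r /klf; under eq_bigr => x _ do rewrite /tchar mul0r (fchar0 fpsi).
  by rewrite sumr_const ler_nat; exact: max_card.
have c0 : #|@fixpow L p| = p := card_tower pL cL (leq0n _).
apply: (@le_trans _ _ (\sum_(a | @fixpow L p a) (2 * p ^ 2 ^ i)%:R)); last first.
  by rewrite sumr_const c0 -mulrnA mulnAC.
have -> : \sum_(a | @fixpow L p a) (2 * p ^ 2 ^ i)%:R =
   \sum_(a | @fixpow L p a && (a != 0) && (a != 1)) (2 * p ^ 2 ^ i)%:R +
   \sum_(a | @fixpow L p a && ~~ ((a != 0) && (a != 1))) (2 * p ^ 2 ^ i)%:R :> algC.
  rewrite (bigID (fun a : L => (a != 0) && (a != 1))) /=; congr (_ + _).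
  by apply: eq_bigl => a; rewrite andbA.
rewrite ler_wpDr ?sumr_ge0 //.
apply: ler_sum => a /andP[/andP[Fa a0] _].
rewrite (klf_tower_step pL cL fpsi Fa a0 Fb b0 (ltnSn i)).
rewrite gerBl -realEsqr; apply: (klf_real (pcharQ pL i) (Q_gt1 pL i)).
  exact: (fchar_tchar pL cL fpsi Fa a0 (leqnSn i)).
have Fjb j : fixpow (p ^ 2 ^ j) b.
  by elim: j => [//|j IH]; rewrite QS; exact: fixpow_sqr.
exact: Fjb.
Qed.

Lemma weil_prime (p beta : nat) (zeta : algC) :
  prime p -> odd p -> p.-primitive_root zeta -> ~~ (p %| beta)%N ->
  `|\sum_(x < p) \sum_(y < p | (x * y == beta %[mod p])%N) zeta ^+ (x + y)| ^+ 2
    <= 4%:R * p%:R.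
Proof.
move=> pp oddp prz pb; set K := \sum_(x < p) _.
have p_gt0 := prime_gt0 pp; have p0 : (0 : algC) < p%:R by rewrite ltr0n.
have tow n : {L : finFieldType | p \in [pchar L] & #|L| = (p ^ 2 ^ n)%N}.
  by apply: pPrimePowerField; rewrite // expn_gt0.
have Kreal : K \is Num.real.
  have [L pL cL] := tow 0%N.
  rewrite /K -(klf_natchar pL cL prz pb); apply: (klf_real (pcharQ pL 0) (Q_gt1 pL 0)).
  - exact: (fchar_natchar pL cL prz).
  - exact: fixpow_natr.
rewrite real_normK // real_leNgt ?realX ?realM ?realn //; apply/negP => Kbig.
pose delta := (K ^+ 2 - 4%:R * p%:R) / p%:R.
have d0 : 0 < delta by rewrite divr_gt0 // subr_gt0.
(* High enough for the excess to pass the bound [14 * p]; adding 2 ensures [p ^ 4 <= p ^ 2 ^ n], and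
   so the size condition of [klcount_ge]. *)
pose n := (Num.Def.archi_bound (14%:R * p%:R / delta)).+2.
have hn : 14%:R * p%:R < n%:R * delta.
  rewrite -ltr_pdivrMr //; apply: lt_trans (archi_boundP _) _.
    exact: divr_ge0 (mulr_ge0 (ler0n _ _) (ler0n _ _)) (ltW d0).
  by rewrite ltr_nat /n.
have [L pL cL] := tow n.+1.
pose psi := natchar (L := L) p zeta; pose b : L := beta%:R.
have fpsi : fchar p psi by exact: fchar_natchar cL prz.
have Fb : fixpow p b by exact: fixpow_natr.
have b0 : b != 0 by rewrite -(dvdn_pcharf pL).
pose T j := klf (p ^ 2 ^ j) (tchar p psi 1 j) b.
have T0 : T 0%N = K.
  rewrite /K -(klf_natchar pL cL prz pb) /T /klf; apply: eq_bigr => x _.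
  by rewrite /tchar mul1r.
have grow := @tower_growth T (fun j => p ^ 2 ^ j)%N delta n.+1 _ _ (ltW d0) _ n (ltnSn n).
have {}grow : (2%:R + n.+1%:R * delta) * (p ^ 2 ^ n)%:R <= - T n.+1.
  apply: grow => [j|j jn|]; first exact: QS.
    apply: (klf_tower_step pL cL fpsi _ (oner_neq0 L) Fb b0 jn); exact: fixpow1.
  by rewrite T0 expn1 mulrDl divfK ?gt_eqF // addrC subrK.
have p3 : (2 < p)%N by rewrite odd_prime_gt2.
have Qbig : (4 * p < p ^ 2 ^ n - 1)%N.
  have : (p ^ 4 <= p ^ 2 ^ n)%N.
    by rewrite leq_exp2l ?prime_gt1 // -[4%N]/(2 ^ 2)%N leq_exp2l.
  have : (p * 27 <= p ^ 4)%N by rewrite expnS leq_mul2l (@leq_exp2r 3 p 3) ?p3 ?orbT.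
  by move: p3; clear; move: (p ^ 4)%N (p ^ 2 ^ n)%N => M N; lia.
have := klcount_ge pL cL oddp b0 Qbig.
rewrite -(ler_nat algC) -addnA natrD -(sum_klf _ pL cL fpsi) => lower.
have := le_trans lower (lerD (sum_klf_le pL cL fpsi Fb b0) (lexx _)).
rewrite -/(T n.+1) -!addrA lerDl -natrD => h.
(* The errors are [4 * p] and [(6 * p + 2) * p ^ 2 ^ n] from the points and [2 * p * p ^ 2 ^ n] from
   the other characters; 14 is a generous total. *)
have {}h : - T n.+1 <= (14 * p * p ^ 2 ^ n)%:R.
  rewrite lerNl -subr_ge0 opprK; apply: le_trans h _.
  rewrite lerD2l ler_nat -!mulnA mulnDl -!mulnA.
  have : (p ^ 2 ^ n <= p * p ^ 2 ^ n)%N by rewrite leq_pmull.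
  by move: Qbig; clear; move: (p ^ 2 ^ n)%N => Q; move: (p * Q)%N => pQ; lia.
have := le_trans grow h.
rewrite natrM ler_pM2r ?ltr0n ?expn_gt0 ?p_gt0 // natrM => h2.
have : 14%:R * p%:R < 2%:R + n.+1%:R * delta.
  apply: lt_le_trans hn _; rewrite -[n.+1%:R]natr1 [(_ + 1) * _]mulrDl addrCA lerDl mul1r.
  by rewrite addr_ge0 ?ler0n // ltW.
by move/(le_lt_trans h2); rewrite ltxx.
Qed.

(** * Composite moduli *)

(** A Kloosterman sum modulo [D]: for [lam] prime to [D], [y] is [lam] divided by [x]. The relation
    is symmetric and needs no modular inverse. *)
Definition kl (D : nat) (z : algC) (lam h n : nat) : algC :=
  \sum_(x < D) \sum_(y < D | (x * y == lam %[mod D])%N) z ^+ (h * x + n * y).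

Lemma klC D z lam h n : kl D z lam h n = kl D z lam n h.
Proof.
rewrite /kl (exchange_big_dep predT) //=; apply: eq_bigr => y _.
by apply: eq_big => [x|x _]; rewrite ?[(x * y)%N]mulnC // addnC.
Qed.

Lemma mulmod_ord_proof D a (x : 'I_D) : ((a * x) %% D < D)%N.
Proof. by rewrite ltn_pmod // (leq_ltn_trans _ (ltn_ord x)). Qed.

Definition mulmod_ord D a (x : 'I_D) : 'I_D := Ordinal (mulmod_ord_proof a x).

Lemma mulmod_ord_inj D a : coprime a D -> injective (@mulmod_ord D a).
Proof.
move=> caD x y /(congr1 val) /= e; apply: val_inj => /=.
wlog xy : x y e / (x <= y)%N.
  by move=> W; case: (leqP x y) => [|/ltnW] h; [|apply/esym]; apply: W.
apply/eqP; rewrite eqn_leq xy -subn_eq0 /=.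
have : (D %| y - x)%N.
  rewrite -(@Gauss_dvdr D a) 1?coprime_sym // mulnBr -eqn_mod_dvd ?leq_mul2l ?xy ?orbT //.
  exact/eqP.
have [//|k0 d] := posnP (y - x).
by have := dvdn_leq k0 d; have := ltn_ord y; lia.
Qed.

Lemma exists_mulmod D a b : (0 < D)%N -> coprime a D ->
  exists x : 'I_D, forall y : 'I_D, (a * y == b %[mod D])%N = (y == x).
Proof.
move=> D0 caD; have inj := mulmod_ord_inj caD.
have /(codomP (f := mulmod_ord a))[x xE] : Ordinal (ltn_pmod b D0) \in codom (@mulmod_ord D a).
  exact/injF_onto.
exists x => y; apply/eqP/eqP => [e|->]; last by have /= -> := congr1 val xE.
by apply: inj; rewrite -xE; apply: val_inj.
Qed.

Lemma sum_prim_root D (z : algC) n : D.-primitive_root z ->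
  \sum_(x < D) z ^+ (n * x) = if (D %| n)%N then D%:R else 0.
Proof.
move=> prz; case: ifP => [/dvdnP[m ->]|Dn].
  under eq_bigr => x _ do rewrite mulnAC mulnC exprM (prim_expr_order prz) expr1n.
  by rewrite sumr_const card_ord.
have zn : z ^+ n != 1 by rewrite -(prim_order_dvd prz) Dn.
apply: (@mulfI _ (z ^+ n - 1)); rewrite ?subr_eq0 // mulr0.
under eq_bigr => x _ do rewrite exprM.
by rewrite -subrX1 exprAC (prim_expr_order prz) expr1n subrr.
Qed.

Lemma norm_prim_expr D (z : algC) k : (0 < D)%N -> z ^+ D = 1 -> `|z ^+ k| = 1.
Proof.
move=> D0 zD; apply/eqP; rewrite -(@pexpr_eq1 _ _ D) // -normrX exprAC zD.
by rewrite expr1n normr1.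
Qed.

(** If [p] divides neither [h] nor [n], scaling [x] and [y] by them reduces to [weil_prime] with
    [h * n * lam]. If it divides just one, a complete sum without its term at 0 gives -1. If it
    divides both, the gcd is [p] and the trivial bound suffices. *)
Lemma kl_prime_le p (z : algC) lam h n :
  prime p -> odd p -> p.-primitive_root z -> coprime lam p ->
  `|kl p z lam h n| ^+ 2 <= (4 * p * gcdn (gcdn h n) p)%:R.
Proof.
move=> pp oddp prz clp; have p0 := prime_gt0 pp.
have plam : ~~ (p %| lam)%N by rewrite -prime_coprime // coprime_sym.
have single w : ~~ (p %| w)%N -> `|kl p z lam 0 w| ^+ 2 <= (4 * p)%:R.
  move=> pw; rewrite klC /kl.
  have -> : \sum_(x < p) \sum_(y < p | (x * y == lam %[mod p])%N) z ^+ (w * x + 0 * y) = - 1.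
    have := sum_prim_root w prz; rewrite (negPf pw) => /eqP.
    rewrite (bigD1 (Ordinal p0)) //= muln0 expr0 addr_eq0 => /eqP ->; rewrite opprK.
    rewrite [LHS](bigD1 (Ordinal p0)) //= big1 ?add0r.
      apply: eq_bigr => x x0.
      have cx : coprime x p.
        rewrite coprime_sym prime_coprime // gtnNdvd // lt0n.
        by apply: contraNneq x0 => x0; apply/eqP/val_inj.
      have [y yE] := exists_mulmod lam p0 cx.
      by rewrite (big_pred1 y) // mul0n addn0.
    move=> y; rewrite mul0n eq_sym => /eqP e; case/negP: plam.
    by rewrite /dvdn e mod0n.
  by rewrite normrN1 expr1n (ler_nat _ 1) muln_gt0.
have red k : (p %| k)%N -> forall w x y, z ^+ (k * x + w * y) = z ^+ (0 * x + w * y).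
  case/dvdnP => m -> w x y; rewrite !exprD mul0n expr0 mul1r.
  by rewrite mulnAC mulnC exprM (prim_expr_order prz) expr1n mul1r.
have red0 k w : (p %| k)%N -> kl p z lam k w = kl p z lam 0 w.
  by move=> pk; apply: eq_bigr => x _; apply: eq_bigr => y _; exact: red.
have mono m : (0 < m)%N -> (4 * p)%:R <= (4 * p * m)%:R :> algC.
  by move=> m0; rewrite ler_nat leq_pmulr.
have g0 : (0 < gcdn (gcdn h n) p)%N by rewrite gcdn_gt0 p0 orbT.
have [ph|ph] := boolP (p %| h)%N.
  have [pn|pn] := boolP (p %| n)%N; last first.
    by rewrite red0 //; apply: le_trans (mono _ g0); exact: single.
  have -> : gcdn (gcdn h n) p = p by apply/gcdn_idPr; rewrite dvdn_gcd ph.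
  have : `|kl p z lam h n| <= p%:R.
    rewrite -[p in p%:R]card_ord -sumr_const; apply: (le_trans (ler_norm_sum _ _ _)).
    apply: ler_sum => x _; have [/eqP x0|x0] := eqVneq (nat_of_ord x) 0%N.
      rewrite big_pred0 ?normr0 ?ler01 // => y; rewrite (eqP x0) mul0n eq_sym.
      by apply: contraNF plam => /eqP e; rewrite /dvdn e mod0n.
    have cx : coprime x p by rewrite coprime_sym prime_coprime // gtnNdvd // lt0n.
    have [y yE] := exists_mulmod lam p0 cx.
    by rewrite (big_pred1 y) // (norm_prim_expr _ p0) ?(prim_expr_order prz).
  move=> hp; apply: le_trans (_ : p%:R ^+ 2 <= _).
    by rewrite lerXn2r // nnegrE ?normr_ge0 ?ler0n.
  by rewrite -natrX ler_nat -mulnn leq_mul2r leq_pmull ?orbT.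
have [pn|pn] := boolP (p %| n)%N.
  by rewrite klC red0 //; apply: le_trans (mono _ g0); exact: single.
apply: le_trans (mono _ g0); rewrite natrM.
have ch : coprime h p by rewrite coprime_sym prime_coprime.
have cn : coprime n p by rewrite coprime_sym prime_coprime.
suff -> : kl p z lam h n =
   \sum_(x < p) \sum_(y < p | (x * y == h * n * lam %[mod p])%N) z ^+ (x + y).
  by apply: weil_prime; rewrite // !Euclid_dvdM // !negb_or ph pn.
rewrite [RHS](reindex_inj (mulmod_ord_inj ch)) /=; apply: eq_bigr => x _.
rewrite [RHS](reindex_inj (mulmod_ord_inj cn)) /=.
apply: eq_big => [y|y _].
  rewrite modnMml modnMmr mulnACA.
  have chn : coprime (h * n) p by rewrite coprimeMl ch.
  apply/eqP/eqP => [e|e].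
    by rewrite -modnMmr e modnMmr.
  have /eqP := e; case: (leqP lam (x * y)) => le.
    rewrite eqn_mod_dvd ?leq_mul2l ?le ?orbT // -mulnBr Gauss_dvdr 1?coprime_sym //.
    by rewrite -eqn_mod_dvd // => /eqP.
  rewrite eq_sym eqn_mod_dvd ?leq_mul2l ?(ltnW le) ?orbT // -mulnBr Gauss_dvdr 1?coprime_sym //.
  by rewrite -eqn_mod_dvd ?(ltnW le) // => /eqP.
by rewrite !exprD !(prim_expr_mod prz).
Qed.

Lemma sum_crt (D1 D2 : nat) (F : nat -> nat -> algC) : coprime D1 D2 ->
  (0 < D1)%N -> (0 < D2)%N ->
  \sum_(x < D1 * D2) F (x %% D1)%N (x %% D2)%N = \sum_(i < D1) \sum_(j < D2) F i j.
Proof.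
move=> c12 D10 D20; rewrite pair_big /=.
have D0 : (0 < D1 * D2)%N by rewrite muln_gt0 D10.
rewrite (reindex (fun x : 'I_(D1 * D2) =>
  (Ordinal (ltn_pmod x D10), Ordinal (ltn_pmod x D20)))) //=.
exists (fun u : 'I_D1 * 'I_D2 => Ordinal (ltn_pmod (chinese D1 D2 u.1 u.2) D0)) => [x _|[i j] _].
  by apply: val_inj; rewrite /= -chinese_mod // modn_small.
congr pair; apply: val_inj => /=.
  by rewrite modn_dvdm ?dvdn_mulr // chinese_modl // modn_small.
by rewrite modn_dvdm ?dvdn_mull // chinese_modr // modn_small.
Qed.

(** The root of unity is split instead of the frequencies, so [lam], [h] and [n] are the same in
    both factors; the customary twists by inverses are hidden in [z1] and [z2]. *)
Lemma kl_mul (D1 D2 : nat) (z1 z2 : algC) lam h n : coprime D1 D2 ->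
  (0 < D1)%N -> (0 < D2)%N -> z1 ^+ D1 = 1 -> z2 ^+ D2 = 1 ->
  kl (D1 * D2) (z1 * z2) lam h n = kl D1 z1 lam h n * kl D2 z2 lam h n.
Proof.
move=> c12 D10 D20 zD1 zD2.
pose F D (z : algC) (a b : nat) := if (a * b == lam %[mod D])%N then z ^+ (h * a + n * b) else 0.
have klE D z : kl D z lam h n = \sum_(x < D) \sum_(y < D) F D z x y.
  by apply: eq_bigr => x _; rewrite big_mkcond.
have expE D (z : algC) x y : z ^+ D = 1 ->
    z ^+ (h * x + n * y) = z ^+ (h * (x %% D) + n * (y %% D)).
  move=> zD; rewrite [in LHS](divn_eq x D) [in LHS](divn_eq y D) !mulnDr !exprD !mulnA.
  by rewrite -!(mulnC D) !(exprM z D) zD !expr1n !mul1r.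
have FE x y : F (D1 * D2)%N (z1 * z2) x y =
    F D1 z1 (x %% D1)%N (y %% D1)%N * F D2 z2 (x %% D2)%N (y %% D2)%N.
  rewrite /F chinese_remainder // !modnMml !modnMmr.
  case: eqP => _ /=; last by rewrite mul0r.
  by case: eqP => _; rewrite ?mulr0 // exprMn -!expE.
rewrite !klE; under eq_bigr => x _ do under eq_bigr => y _ do rewrite FE.
pose G i j := (\sum_(y < D1) F D1 z1 i y) * (\sum_(y < D2) F D2 z2 j y).
transitivity (\sum_(x < D1 * D2) G (x %% D1)%N (x %% D2)%N).
  apply: eq_bigr => x _; rewrite /G big_distrlr /=.
  exact: (sum_crt (fun a b => F D1 z1 (x %% D1)%N a * F D2 z2 (x %% D2)%N b)).
by rewrite (sum_crt G c12) // big_distrlr.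
Qed.

Lemma prim_root_split (D1 D2 : nat) (z : algC) : coprime D1 D2 ->
  (0 < D1)%N -> (0 < D2)%N -> (D1 * D2)%N.-primitive_root z ->
  exists z1 z2, [/\ D1.-primitive_root z1, D2.-primitive_root z2 & z = z1 * z2].
Proof.
move=> c12 D10 D20 prz.
(* The idempotents of the Chinese remainder theorem. *)
pose e1 := chinese D1 D2 1 0; pose e2 := chinese D1 D2 0 1.
have e11 : e1 = 1 %[mod D1] by exact: chinese_modl.
have e12 : e1 = 0 %[mod D2] by exact: chinese_modr.
have e21 : e2 = 0 %[mod D1] by exact: chinese_modl.
have e22 : e2 = 1 %[mod D2] by exact: chinese_modr.
exists (z ^+ e1), (z ^+ e2); split.
- have := exp_prim_root prz e1; rewrite mulnC Gauss_gcdl; last first.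
    by rewrite /coprime -gcdn_modl e11 gcdn_modl gcd1n.
  by rewrite -gcdn_modl e12 mod0n gcd0n mulKn.
- have := exp_prim_root prz e2; rewrite Gauss_gcdl; last first.
    by rewrite /coprime -gcdn_modl e22 gcdn_modl gcd1n.
  by rewrite -gcdn_modl e21 mod0n gcd0n mulKn.
- rewrite -exprD -[LHS]expr1 -(prim_expr_mod prz 1) -(prim_expr_mod prz (_ + _)).
  congr (_ ^+ _); apply/eqP; rewrite chinese_remainder //.
  by rewrite -modnDm e11 e21 modnDm addn0 eqxx /= -modnDm e12 e22 modnDm.
Qed.

Lemma kl_squarefree_le (s : seq nat) (z : algC) lam h n (D := \prod_(p <- s) p) :
  uniq s -> all (fun p => prime p && odd p) s -> coprime lam D -> D.-primitive_root z ->
  `|kl D z lam h n| ^+ 2 <= (4 ^ size s * D * gcdn (gcdn h n) D)%:R.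
Proof.
rewrite /D {D}; elim: s z => [|p s IH] z /=.
  rewrite big_nil => _ _ _ prz; rewrite gcdn1 expn0 !muln1 /kl.
  rewrite big_ord1 (big_pred1 ord0) => [|y]; last by rewrite /= !modn1 [y]ord1 !eqxx.
  by rewrite (norm_prim_expr _ (ltn0Sn 0)) ?(prim_expr_order prz) // expr1n.
move=> /andP[ps us] /andP[/andP[pp oddp] als]; rewrite big_cons; set D := \prod_(i <- s) i.
rewrite coprimeMr => /andP[clp clD] prz.
have p0 := prime_gt0 pp.
have cpD : coprime p D.
  rewrite /D big_seq; apply: (big_ind (fun m => coprime p m)) => [|a b ca cb|q qs].
  - exact: coprimen1.
  - by rewrite coprimeMr ca.
  - move/allP/(_ q qs)/andP: als => [pq _].
    by rewrite prime_coprime // dvdn_prime2 //; apply: contraNneq ps => ->.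
have D0 : (0 < D)%N.
  rewrite /D big_seq; apply: (big_ind (fun m => (0 < m)%N)) => [//|a b a0 b0|q qs].
    by rewrite muln_gt0 a0.
  by move/allP/(_ q qs)/andP: als => [/prime_gt0].
have [z1 [z2 [pr1 pr2 ->]]] := prim_root_split cpD p0 D0 prz.
rewrite kl_mul ?(prim_expr_order pr1) ?(prim_expr_order pr2) // normrM exprMn.
apply: le_trans (_ : (4 * p * gcdn (gcdn h n) p)%:R * (4 ^ size s * D * gcdn (gcdn h n) D)%:R <= _).
  by rewrite ler_pM ?exprn_ge0 //; [exact: kl_prime_le|exact: IH].
rewrite -natrM ler_nat.
have gle : (gcdn (gcdn h n) p * gcdn (gcdn h n) D <= gcdn (gcdn h n) (p * D))%N.
  apply: dvdn_leq; first by rewrite gcdn_gt0 muln_gt0 p0 D0 orbT.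
  rewrite Gauss_dvd; last by rewrite (coprime_dvdl (dvdn_gcdr _ _)) // (coprime_dvdr (dvdn_gcdr _ _)).
  move: (gcdn h n) => g; rewrite !dvdn_gcd !dvdn_gcdl /=.
  by rewrite dvdn_mulr ?dvdn_gcdr // dvdn_mull // dvdn_gcdr.
rewrite expnS; move: gle; move: (gcdn _ (p * D)) (gcdn _ p) (gcdn _ D) (4 ^ size s)%N => c a b m gle.
have -> : (4 * p * a * (m * D * b) = 4 * m * (p * D) * (a * b))%N by ring.
by rewrite leq_mul2l gle orbT.
Qed.

(** * Fourier analysis on the modular hyperbola *)

Lemma prim_root_orth D (z : algC) u v : D.-primitive_root z ->
  \sum_(h < D) z ^+ (h * u) * (z ^+ (h * v))^* = (u == v %[mod D])%N%:R * D%:R.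
Proof.
move=> prz; have D0 := prim_order_gt0 prz; have zD := prim_expr_order prz.
(* [D.-1] serves as -1 modulo [D] in exponents, which are natural numbers. *)
have -> : (u == v %[mod D])%N = (D %| u + v * D.-1)%N.
  by rewrite -(eqn_modDr (v * D.-1) u v) -mulnS prednK // modnMl.
transitivity (\sum_(h < D) z ^+ ((u + v * D.-1) * h)).
  apply: eq_bigr => h _; rewrite (@conj_unity_root _ D) //; last by rewrite -exprM mulnC exprM zD expr1n.
  have zn k : z ^+ k != 0 by rewrite expf_neq0 // (prim_root_eq0 prz) -lt0n.
  apply: (mulIf (zn (h * v)%N)); rewrite mulfVK // -exprD.
  rewrite (_ : ((u + v * D.-1) * h + h * v = D * (v * h) + h * u)%N).
    by rewrite exprD (exprM z D) zD expr1n mul1r.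
  by move: (nat_of_ord h) => k; rewrite -[D in (D * (v * k))%N](prednK D0); ring.
by rewrite sum_prim_root //; case: ifP => _; rewrite ?mul1r ?mul0r.
Qed.

(* Autocorrelation of an interval of length [2 * A]: it majorizes the indicator function of an
   interval of length [A], and its Fourier coefficients have absolute value [`|expsum|^2]. *)
Definition triangle (D x0 A x : nat) : nat :=
  \sum_(i < 2 * A) \sum_(j < 2 * A) (x + j == x0 + i %[mod D])%N.

(** For each of the [A] shifts [j < A], a representation [x = x0 + i] gives [x + j = x0 + (i + j)]
    with [i + j < 2 * A]; hence the doubled length in [triangle] and the factor [A]. *)
Lemma triangle_ge D x0 A x :
  (A * (\sum_(i < A) (x == x0 + i %[mod D])%N) <= triangle D x0 A x)%N.
Proof.
rewrite /triangle exchange_big /=.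
rewrite -[A in (A * _)%N]card_ord -sum_nat_const.
rewrite -(big_mkord xpredT (fun j => (\sum_(i < 2 * A) (x + j == x0 + i %[mod D]))%N)).
rewrite (@big_cat_nat _ _ _ A) //=; last by rewrite mul2n -addnn leq_addr.
apply: leq_trans (leq_addr _ _); rewrite big_mkord; apply: leq_sum => j _.
rewrite -(big_mkord xpredT (fun i => nat_of_bool (x + j == x0 + i %[mod D])%N)).
rewrite (@big_cat_nat _ _ _ j) //=; last by rewrite ltnW // (leq_trans (ltn_ord j)) // mul2n -addnn leq_addr.
apply: leq_trans (leq_addl _ _).
rewrite (@big_cat_nat _ _ _ (j + A)) /=; last first.
- by rewrite mul2n -addnn leq_add2r ltnW.
- exact: leq_addr.
apply: leq_trans (leq_addr _ _); rewrite -{1}[nat_of_ord j]add0n big_addn addKn big_mkord.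
rewrite leq_eqVlt; apply/orP; left; apply/eqP; apply: eq_bigr => i _.
by rewrite addnA eqn_modDr.
Qed.

Definition expsum (z : algC) (n h : nat) : algC := \sum_(i < n) z ^+ (h * i).

Lemma triangle_fourier D (z : algC) x0 A x : D.-primitive_root z ->
  D%:R * (triangle D x0 A x)%:R =
  \sum_(h < D) z ^+ (h * x) * ((z ^+ (h * x0))^* * `|expsum z (2 * A) h| ^+ 2).
Proof.
move=> prz.
have E (h : 'I_D) : z ^+ (h * x) * ((z ^+ (h * x0))^* * `|expsum z (2 * A) h| ^+ 2) =
    \sum_(i < 2 * A) \sum_(j < 2 * A) z ^+ (h * (x + j)) * (z ^+ (h * (x0 + i)))^*.
  rewrite normCK /expsum rmorph_sum big_distrlr /= exchange_big /= mulrA mulr_sumr.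
  apply: eq_bigr => i _; rewrite mulr_sumr; apply: eq_bigr => j _.
  by rewrite !mulnDr !exprD rmorphM /=; ring.
under [RHS]eq_bigr => h _ do rewrite E.
rewrite /triangle natr_sum mulr_sumr [RHS]exchange_big /=; apply: eq_bigr => i _.
rewrite natr_sum mulr_sumr [RHS]exchange_big /=; apply: eq_bigr => j _.
by rewrite mulrC -(prim_root_orth _ _ prz).
Qed.

Lemma sum_dvd_ord (g e : nat) (F : nat -> algC) : (0 < g)%N ->
  \sum_(h < g * e | (g %| h)%N) F h = \sum_(k < e) F (g * k)%N.
Proof.
move=> g0; rewrite -(big_mkord (fun h => (g %| h)%N) F) -(big_mkord xpredT (fun k => F (g * k)%N)).
elim: e => [|e IH]; first by rewrite muln0 !big_geq.
rewrite big_nat_recr //= -IH mulnS addnC (@big_cat_nat _ _ _ (g * e)) ?leq_addr //=.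
congr (_ + _); rewrite big_ltn_cond; last by rewrite -[X in (X < _)%N]addn0 ltn_add2l.
rewrite dvdn_mulr // big_nat_cond big_pred0 ?addr0 // => h.
apply/negP => /andP[/andP[h1 h2] /dvdnP[m hm]]; move: h1 h2.
rewrite hm -mulnSr [(m * g)%N]mulnC !ltn_pmul2l // ltnS => h1 h2.
by have := leq_trans h1 h2; rewrite ltnn.
Qed.

Lemma count_mod_le m n i : (0 < m)%N ->
  (m * (\sum_(j < n) (i == j %[mod m])%N) <= n + m)%N.
Proof.
move=> m0; rewrite -(big_mkord xpredT (fun j => nat_of_bool (i == j %[mod m])%N)).
have per k : (\sum_(0 <= j < k * m) (i == j %[mod m])%N = k)%N.
  elim: k => [|k IH]; first by rewrite mul0n big_geq.
  rewrite (@big_cat_nat _ _ _ (k * m)) ?leq_mul2r ?leqnSn ?orbT //= IH mulSn.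
  rewrite -[X in index_iota X _]add0n big_addn addnK big_mkord.
  rewrite (bigD1 (Ordinal (ltn_pmod i m0))) //= [(_ + k * m)%N]addnC modnMDl modn_mod eqxx.
  rewrite big1 ?addn0 ?addn1 // => j.
  by rewrite -val_eqE /= addnC modnMDl (modn_small (ltn_ord j)) eq_sym => /negPf ->.
apply: (@leq_trans (m * (n %/ m).+1)).
  rewrite leq_mul2l -[X in (_ <= X)%N]per; apply/orP; right.
  rewrite [X in (_ <= X)%N](@big_cat_nat _ _ _ n) //= ?leq_addr //.
  by rewrite ltnW // ltn_ceil.
by rewrite mulnS addnC leq_add2r mulnC leq_divM.
Qed.

(** Parseval modulo [e = D / g], the order of [z ^+ g]: the sum is [e] times the number of pairs
    [i, j < n] congruent modulo [e], and each [i] has at most [n / e + 1] partners. *)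
Lemma expsum_sqr_le D (z : algC) g n : D.-primitive_root z -> (g %| D)%N ->
  \sum_(h < D | (g %| h)%N) `|expsum z n h| ^+ 2 <= (n * (n + D %/ g))%:R.
Proof.
move=> prz /dvdnP[e De]; subst D; rewrite mulnC in prz *.
have := prim_order_gt0 prz; rewrite muln_gt0 => /andP[g0 e0]; rewrite mulKn //.
have prg : e.-primitive_root (z ^+ g).
  by have := exp_prim_root prz g; rewrite gcdnMr mulKn.
rewrite (sum_dvd_ord e (fun h => `|expsum z n h| ^+ 2)) //.
have -> : \sum_(k < e) `|expsum z n (g * k)| ^+ 2 =
  \sum_(i < n) \sum_(j < n) (i == j %[mod e])%N%:R * e%:R.
  under eq_bigr => k _ do rewrite normCK /expsum rmorph_sum mulr_suml.
  rewrite exchange_big /=; apply: eq_bigr => i _.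
  under eq_bigr => k _ do rewrite mulr_sumr.
  rewrite exchange_big /=; apply: eq_bigr => j _.
  rewrite -(prim_root_orth _ _ prg); apply: eq_bigr => k _.
  by rewrite -!exprM !mulnA.
under eq_bigr => i _ do rewrite -mulr_suml -natr_sum -natrM mulnC.
rewrite -natr_sum ler_nat -[n in (_ <= n * _)%N]card_ord -sum_nat_const.
by apply: leq_sum => i _; exact: count_mod_le.
Qed.

Definition hypcount (D lam x0 A y0 B : nat) : nat :=
  \sum_(i < A) \sum_(j < B) ((x0 + i) * (y0 + j) == lam %[mod D])%N.

Lemma sum_residue (D : nat) n x0 (F : nat -> nat) : (0 < D)%N ->
  (\sum_(i < n) F ((x0 + i) %% D) =
   \sum_(x < D) F x * \sum_(i < n) (x == x0 + i %[mod D]))%N.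
Proof.
move=> D0; under [RHS]eq_bigr => x _ do rewrite big_distrr /=.
rewrite [RHS]exchange_big /=; apply: eq_bigr => i _.
rewrite (bigD1 (Ordinal (ltn_pmod (x0 + i) D0))) //= modn_mod eqxx muln1.
rewrite big1 ?addn0 // => x; rewrite -val_eqE /= (modn_small (ltn_ord x)) => /negPf ->.
by rewrite muln0.
Qed.

Lemma hypcount_le_triangle D lam x0 A y0 B : (0 < D)%N ->
  (A * B * hypcount D lam x0 A y0 B <=
   \sum_(x < D) \sum_(y < D | x * y == lam %[mod D])
      triangle D x0 A x * triangle D y0 B y)%N.
Proof.
move=> D0; rewrite /hypcount.
pose G a := (\sum_(j < B) (a * (y0 + j) == lam %[mod D]))%N.
under eq_bigr => i _.
  have -> : (\sum_(j < B) ((x0 + i) * (y0 + j) == lam %[mod D]) = G ((x0 + i) %% D))%N.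
    by apply: eq_bigr => j _; rewrite modnMml.
  over.
rewrite /= sum_residue // big_distrr /=; apply: leq_sum => x _.
have -> : G x = (\sum_(y < D) (x * y == lam %[mod D]) * \sum_(j < B) (y == y0 + j %[mod D]))%N.
  rewrite -(sum_residue _ _ (fun y => nat_of_bool (x * y == lam %[mod D]))) //.
  by apply: eq_bigr => j _; rewrite modnMmr.
rewrite [X in (_ <= X)%N]big_mkcond /= big_distrl /= big_distrr /=.
apply: leq_sum => y _; case: (_ == _); last by rewrite !mul0n muln0.
have hx := triangle_ge D x0 A x; have hy := triangle_ge D y0 B y.
rewrite mul1n [(_ * \sum_(i < A) _)%N]mulnC mulnACA; exact: leq_mul hx hy.
Qed.

Lemma triangle_sum_le (D : nat) (z : algC) lam x0 A y0 B : D.-primitive_root z ->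
  (D ^ 2 * \sum_(x < D) \sum_(y < D | x * y == lam %[mod D])
      triangle D x0 A x * triangle D y0 B y)%N%:R <=
  \sum_(h < D) \sum_(n < D)
    `|expsum z (2 * A) h| ^+ 2 * `|expsum z (2 * B) n| ^+ 2 * `|kl D z lam h n|.
Proof.
move=> prz; have D0 := prim_order_gt0 prz.
pose a h := (z ^+ (h * x0))^* * `|expsum z (2 * A) h| ^+ 2.
pose b n := (z ^+ (n * y0))^* * `|expsum z (2 * B) n| ^+ 2.
have E : (D ^ 2 * \sum_(x < D) \sum_(y < D | x * y == lam %[mod D])
      triangle D x0 A x * triangle D y0 B y)%N%:R =
   \sum_(h < D) \sum_(n < D) a h * b n * kl D z lam h n.
  transitivity (\sum_(x < D) \sum_(y < D | (x * y == lam %[mod D])%N)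
     \sum_(h < D) \sum_(n < D) (z ^+ (h * x) * a h) * (z ^+ (n * y) * b n)).
    rewrite natrM natr_sum mulr_sumr; apply: eq_bigr => x _.
    rewrite natr_sum mulr_sumr; apply: eq_bigr => y _.
    rewrite -big_distrlr /= -(triangle_fourier x0 A x prz) -(triangle_fourier y0 B y prz).
    by rewrite natrM natrX; ring.
  rewrite /kl; under [RHS]eq_bigr => h _ do under eq_bigr => n _ do rewrite mulr_sumr.
  under [RHS]eq_bigr => h _ do rewrite exchange_big /=.
  rewrite [RHS]exchange_big /=; apply: eq_bigr => x _.
  under [RHS]eq_bigr => h _ do under eq_bigr => n _ do rewrite mulr_sumr.
  under [RHS]eq_bigr => h _ do rewrite exchange_big /=.
  rewrite [RHS]exchange_big /=; apply: eq_bigr => y _.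
  apply: eq_bigr => h _; apply: eq_bigr => n _.
  by rewrite exprD; ring.
have real : `|\sum_(h < D) \sum_(n < D) a h * b n * kl D z lam h n| <=
    \sum_(h < D) \sum_(n < D)
    `|expsum z (2 * A) h| ^+ 2 * `|expsum z (2 * B) n| ^+ 2 * `|kl D z lam h n|.
  apply: (le_trans (ler_norm_sum _ _ _)); apply: ler_sum => h _.
  apply: (le_trans (ler_norm_sum _ _ _)); apply: ler_sum => n _.
  rewrite !normrM !norm_conjC !(norm_prim_expr _ D0) ?(prim_expr_order prz) // !mul1r.
  by rewrite !normr_id !expr2.
by move: real; rewrite -E normr_nat.
Qed.

Lemma size_divisors_le (s : seq nat) : all prime s ->
  (size (divisors (\prod_(p <- s) p)) <= 2 ^ size s)%N.
Proof.
elim: s => [|p s IH] /=; first by rewrite big_nil.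
move=> /andP[pp als]; rewrite big_cons; set D := \prod_(i <- s) i.
have D0 : (0 < D)%N.
  rewrite /D big_seq; apply: (big_ind (fun m => (0 < m)%N)) => [//|a b a0 b0|q qs].
    by rewrite muln_gt0 a0.
  by move/allP/(_ q qs): als => /prime_gt0.
have p0 := prime_gt0 pp.
apply: (@leq_trans (size (divisors D ++ map (muln p) (divisors D)))).
  apply: uniq_leq_size; first exact: divisors_uniq.
  move=> g; rewrite mem_cat -!dvdn_divisors ?muln_gt0 ?p0 // => gpD.
  have [pg|pg] := boolP (p %| g)%N; apply/orP; [right|left].
    case/dvdnP: pg => g' gE; apply/mapP; exists g'; last by rewrite mulnC.
    by rewrite -dvdn_divisors // -(dvdn_pmul2l p0) -[(p * g')%N]mulnC -gE.
  by move: gpD; rewrite Gauss_dvdr // coprime_sym prime_coprime.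
by rewrite size_cat size_map addnn expnS mul2n leq_double; exact: IH.
Qed.

Lemma sqrtC_le_nat (D n : nat) : (D <= n ^ 2)%N -> sqrtC (D%:R : algC) <= n%:R.
Proof.
by move=> Dn; rewrite -[leRHS]sqrCK ?ler0n // ler_sqrtC ?qualifE /= ?exprn_ge0 ?ler0n // -natrX ler_nat.
Qed.

Lemma sqrtC_nat_le (g : nat) : sqrtC (g%:R : algC) <= g%:R.
Proof. by apply: sqrtC_le_nat; case: g => // g; rewrite -mulnn leq_pmull. Qed.

(** With [g * e = D] one has [sqrt g <= sqrt D], [sqrt g * e <= D] and [sqrt g * e ^ 2 <= D ^ 2].
    The bound is uniform in [g], so a sum over divisors will cost only their number. *)
Lemma divisor_term_le (D g A B : nat) (r := sqrtC (D%:R : algC)) : (0 < D)%N -> (g %| D)%N ->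
  sqrtC (g%:R : algC) * ((2 * A * (2 * A + D %/ g))%:R * (2 * B * (2 * B + D %/ g))%:R) <=
  (4 * A * B)%:R * ((4 * A * B)%:R * r + (2 * (A + B) * D + D * D)%:R).
Proof.
move=> D0 gD; set e := (D %/ g)%N; have De : (g * e)%N = D by rewrite mulnC divnK.
have g0 := dvdn_gt0 D0 gD.
have eD : (e <= D)%N by rewrite -De leq_pmull.
have s0 : 0 <= sqrtC (g%:R : algC) by rewrite sqrtC_ge0 ler0n.
have sr : sqrtC (g%:R : algC) <= r.
  by rewrite ler_sqrtC ?qualifE /= ?ler0n // ler_nat dvdn_leq.
have se : sqrtC (g%:R : algC) * e%:R <= D%:R.
  by rewrite -De natrM ler_wpM2r ?ler0n // sqrtC_nat_le.
have see : sqrtC (g%:R : algC) * e%:R * e%:R <= (D * D)%:R.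
  by rewrite natrM ler_pM ?mulr_ge0 ?ler0n // ler_nat.
have -> : sqrtC (g%:R : algC) * ((2 * A * (2 * A + e))%:R * (2 * B * (2 * B + e))%:R) =
  (4 * A * B)%:R * ((4 * A * B)%:R * sqrtC g%:R + ((2 * (A + B))%:R * (sqrtC g%:R * e%:R)
    + sqrtC g%:R * e%:R * e%:R)).
  by rewrite !(natrM, natrD); ring.
rewrite ler_wpM2l ?ler0n // lerD ?ler_wpM2l ?ler0n //.
by rewrite natrD lerD // [leRHS]natrM ler_wpM2l ?ler0n.
Qed.

(** The condition splits into [g] dividing [h] and [g] dividing [n], so the double sum is a product
    to which [expsum_sqr_le] applies twice. *)
Lemma sum_divisors_le (D : nat) (z : algC) A B (g : nat) :
  D.-primitive_root z -> (g %| D)%N ->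
  \sum_(h < D) \sum_(n < D) `|expsum z (2 * A) h| ^+ 2 * `|expsum z (2 * B) n| ^+ 2 *
      (if (g %| gcdn h n)%N then sqrtC g%:R else 0)
  <= (4 * A * B)%:R * ((4 * A * B)%:R * sqrtC (D%:R : algC) + (2 * (A + B) * D + D * D)%:R).
Proof.
move=> prz gD; have D0 := prim_order_gt0 prz.
apply: le_trans (divisor_term_le A B D0 gD).
have -> : \sum_(h < D) \sum_(n < D) `|expsum z (2 * A) h| ^+ 2 * `|expsum z (2 * B) n| ^+ 2 *
      (if (g %| gcdn h n)%N then sqrtC g%:R else 0) =
  sqrtC g%:R * ((\sum_(h < D | (g %| h)%N) `|expsum z (2 * A) h| ^+ 2) *
    (\sum_(n < D | (g %| n)%N) `|expsum z (2 * B) n| ^+ 2)).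
  rewrite big_distrlr /= mulr_sumr [RHS]big_mkcond /=; apply: eq_bigr => h _.
  case: ifP => gh; last by apply: big1 => n _; rewrite dvdn_gcd gh mulr0.
  rewrite mulr_sumr [RHS]big_mkcond /=; apply: eq_bigr => n _.
  by rewrite dvdn_gcd gh /=; case: ifP => _; rewrite ?mulr0 // mulrC.
rewrite ler_wpM2l ?sqrtC_ge0 ?ler0n // ler_pM ?sumr_ge0 // => [h _|h _||].
- exact: exprn_ge0.
- exact: exprn_ge0.
- exact: expsum_sqr_le.
- exact: expsum_sqr_le.
Qed.

(** The square root of the gcd in the Kloosterman bound is majorized by the sum of [sqrt g] over all
    [g] dividing [D], [h] and [n]; [g = D] accounts for the main term [4 * A * B]. One factor
    [2 ^ size s] comes from Weil's bound, another from the number of divisors, and the last 4 from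
    the doubled intervals. [sN] is an integer bound for [sqrt D], which keeps the statement in
    natural numbers. *)
Lemma hypcount_le (s : seq nat) (lam x0 A y0 B sN : nat) (D := \prod_(p <- s) p) :
  uniq s -> all (fun p => prime p && odd p) s -> coprime lam D ->
  (0 < A)%N -> (0 < B)%N -> (D <= sN ^ 2)%N ->
  (D * hypcount D lam x0 A y0 B <=
     4 ^ (size s).+1 * (4 * A * B + (2 * (A + B) + D) * sN))%N.
Proof.
move=> us als clD A0 B0 DsN.
have alp : all prime s by apply: sub_all als => p /andP[].
have D0 : (0 < D)%N.
  rewrite /D big_seq; apply: (big_ind (fun m => (0 < m)%N)) => [//|a b a0 b0|q qs].
    by rewrite muln_gt0 a0.
  by move/allP/(_ q qs): alp => /prime_gt0.
have [z prz] := C_prim_root_exists D0.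
set r := sqrtC (D%:R : algC); set w := size s.
have r0 : 0 <= r by rewrite sqrtC_ge0 ler0n.
have rr : r * r = D%:R by rewrite -expr2 sqrtCK.
pose U := (4 * A * B)%:R * ((4 * A * B)%:R * r + (2 * (A + B) * D + D * D)%:R).
have U0 : 0 <= U by rewrite mulr_ge0 ?addr_ge0 ?mulr_ge0 ?ler0n.
have klb h n : `|kl D z lam h n| <= (2 ^ w)%:R * r *
    \sum_(g <- divisors D) (if (g %| gcdn h n)%N then sqrtC (g%:R : algC) else 0).
  set g := gcdn (gcdn h n) D.
  have gD : g \in divisors D by rewrite -dvdn_divisors // dvdn_gcdr.
  apply: (@le_trans _ _ ((2 ^ w)%:R * r * sqrtC g%:R)).
    have h1 := kl_squarefree_le h n us als clD prz.
    have h0 : 0 <= (2 ^ w)%:R * r * sqrtC (g%:R : algC).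
      by rewrite !mulr_ge0 ?ler0n ?sqrtC_ge0 ?ler0n.
    rewrite -(@ler_pXn2r _ 2) ?nnegrE ?normr_ge0 //; apply: le_trans h1 _.
    by rewrite !exprMn !sqrtCK -natrX -!natrM -expnM [(w * 2)%N]mulnC expnM.
  rewrite ler_wpM2l ?mulr_ge0 ?ler0n //.
  rewrite (bigD1_seq g) ?divisors_uniq //= dvdn_gcdl lerDl.
  by apply: sumr_ge0 => i _; case: ifP => // _; rewrite sqrtC_ge0 ler0n.
have main : (D ^ 2 * (A * B * hypcount D lam x0 A y0 B))%N%:R <=
    (2 ^ w)%:R * r * ((2 ^ w)%:R * U).
  have hM := hypcount_le_triangle lam x0 A y0 B D0.
  have := triangle_sum_le lam x0 A y0 B prz; move: hM; set M := (\sum_(x < D) _)%N => hM hM2.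
  apply: (@le_trans _ _ (D ^ 2 * M)%N%:R); first by rewrite ler_nat leq_mul2l hM orbT.
  apply: (le_trans hM2).
  apply: (@le_trans _ _ (\sum_(h < D) \sum_(n < D) (2 ^ w)%:R * r *
      \sum_(g <- divisors D) (`|expsum z (2 * A) h| ^+ 2 * `|expsum z (2 * B) n| ^+ 2 *
      (if (g %| gcdn h n)%N then sqrtC (g%:R : algC) else 0)))).
    apply: ler_sum => h _; apply: ler_sum => n _.
    rewrite -mulr_sumr [leRHS]mulrCA ler_wpM2l ?mulr_ge0 ?exprn_ge0 //; exact: klb.
  under eq_bigr => h _ do rewrite -mulr_sumr.
  rewrite -mulr_sumr ler_wpM2l ?mulr_ge0 ?ler0n //.
  under eq_bigr => h _ do rewrite exchange_big /=.
  rewrite exchange_big /=.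
  apply: (@le_trans _ _ (\sum_(g <- divisors D) U)).
    rewrite big_seq [leRHS]big_seq; apply: ler_sum => g gD.
    by apply: sum_divisors_le; rewrite // dvdn_divisors.
  rewrite big_const_seq count_predT iter_addr_0 -[leLHS]mulr_natl ler_wpM2r // ler_nat.
  exact: size_divisors_le.
have AB0 : (0 : algC) < (A * B * D)%:R by rewrite ltr0n !muln_gt0 A0 B0.
have sr : r <= sN%:R by exact: sqrtC_le_nat.
rewrite -(ler_nat algC) -(ler_pM2l AB0).
apply: (@le_trans _ _ ((2 ^ w)%:R * r * ((2 ^ w)%:R * U))).
  by apply: le_trans main; rewrite -natrM ler_nat; apply: eq_leq; ring.
apply: (@le_trans _ _ ((4 ^ w.+1)%:R * (A * B * D)%:R * ((4 * A * B)%:R + (2 * (A + B) + D)%:R * r))).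
  rewrite /U le_eqVlt; apply/orP; left; apply/eqP.
  have -> : (4 ^ w.+1)%:R = (4%:R * (2 ^ w)%:R * (2 ^ w)%:R) :> algC.
    by rewrite -!natrM expnS -mulnA -expnMn.
  transitivity ((2 ^ w)%:R * (2 ^ w)%:R * (4 * A * B)%:R * ((4 * A * B)%:R * (r * r) + (2 * (A + B) * D + D * D)%:R * r)).
    by ring.
  by rewrite rr !(natrM, natrD); ring.
rewrite [_%:R * _%:R]mulrC -mulrA ler_wpM2l ?ler0n // [leRHS]natrM ler_wpM2l ?ler0n //.
by rewrite [leRHS]natrD lerD2l [leRHS]natrM ler_wpM2l ?ler0n.
Qed.

(** * Counting for a fixed lower right entry *)

Section FixedEntry.

Local Open Scope nat_scope.

Lemma sum_residue_split (E H : nat) (F : nat -> nat) : 0 < E ->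
  \sum_(i < H) F i <= \sum_(i < E) \sum_(j < (H %/ E).+1) F (i + E * j).
Proof.
move=> E0; have per n : \sum_(i < E * n) F i = \sum_(i < E) \sum_(j < n) F (i + E * j).
  elim: n => [|n IH].
    by rewrite muln0 big_ord0 big1 // => i _; rewrite big_ord0.
  under [RHS]eq_bigr => i _ do rewrite big_ord_recr /=.
  rewrite big_split /= -IH mulnSr -[LHS](big_mkord xpredT F).
  rewrite (@big_cat_nat _ _ _ (E * n)) ?leq_addr //= big_mkord; congr (_ + _).
  rewrite -[X in index_iota X]add0n big_addn addKn big_mkord.
  by apply: eq_bigr => i _.
rewrite -per -!(big_mkord xpredT F) (@big_cat_nat _ _ _ H 0 (E * (H %/ E).+1)) //=.
  exact: leq_addr.
by rewrite mulnC ltnW // ltn_ceil.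
Qed.

Lemma sum_bool_le1 n (P : pred nat) :
  (forall i j, i < n -> j < n -> P i -> P j -> i = j) -> \sum_(i < n) P i <= 1.
Proof.
move=> h; case: (pickP (fun i : 'I_n => P i)) => [i Pi|P0]; last first.
  by rewrite big1 // => i _; rewrite P0.
rewrite (bigD1 i) //= big1 ?addn0 ?leq_b1 // => j ji.
case Pj: (P j) => //; case/eqP: ji; apply: val_inj; exact: h (ltn_ord j) (ltn_ord i) Pj Pi.
Qed.

(** The matrices with lower right entry [d], with [a] eliminated: [a * d = b * c + 1] is solvable
    exactly when [d] divides [b * c + 1]. Here [b] is [b0 + i], and [c] lies in the class of [kap]
    modulo [m]. *)
Definition detcount (d m kap b0 H k0 G : nat) : nat :=
  \sum_(i < H) \sum_(j < G) (d %| (b0 + i) * (kap + m * (k0 + j)) + 1).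

(** Multiplying the two factors by inverses [e] of [E] and [f] of [m * E] modulo [D] turns both
    progressions into intervals. The product becomes [- e * f], with [D.-1] in place of -1. *)
Lemma hypcount_ge_class (D E m b0 A c0 B : nat) : 0 < D -> coprime E D -> coprime m D ->
  exists lam x0 y0, coprime lam D /\
  \sum_(i < A) \sum_(j < B) (D %| (b0 + E * i) * (c0 + m * E * j) + 1)
    <= hypcount D lam x0 A y0 B.
Proof.
move=> D0 cE cm; have cmE : coprime (m * E) D by rewrite coprimeMl cm.
have [e /(_ e)] := exists_mulmod 1 D0 cE; rewrite eqxx => /eqP eE.
have [f /(_ f)] := exists_mulmod 1 D0 cmE; rewrite eqxx => /eqP fE.
have inv_coprime a b : a * b = 1 %[mod D] -> coprime b D.
  by move=> ab; apply: (@coprime_dvdl _ (a * b)); rewrite ?dvdn_mull // /coprime -gcdn_modl ab gcdn_modl gcd1n.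
exists (D.-1 * (e * f)), (e * b0), (f * c0); split.
  rewrite !coprimeMl (inv_coprime _ _ eE) (inv_coprime _ _ fE) !andbT.
  by rewrite -[X in coprime _ X](prednK D0) coprimenS.
apply: leq_sum => i _; apply: leq_sum => j _; case: (boolP (D %| _)) => // XY.
rewrite lt0b; set X := b0 + E * i in XY *; set Y := c0 + m * E * j in XY *.
have ex : e * b0 + i = e * X %[mod D].
  by rewrite /X mulnDr mulnA [(e * E)%N]mulnC -modnDmr -[RHS]modnDmr -modnMml eE modnMml mul1n.
have fy : f * c0 + j = f * Y %[mod D].
  by rewrite /Y mulnDr mulnA [(f * (m * E))%N]mulnC -modnDmr -[RHS]modnDmr -modnMml fE modnMml mul1n.
rewrite -modnMm ex fy modnMm mulnACA mulnC -modnMml; apply/eqP.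
suff -> : (X * Y) %% D = D.-1 %% D by rewrite modnMml.
apply/eqP; rewrite -(eqn_modDr 1) [D.-1 + 1]addn1 prednK // modnn.
exact: XY.
Qed.

(** Of the [E ^ 2] pairs of classes modulo [E] at most [E] contribute: [b * c = -1] makes [c]
    invertible modulo [E] and so determines [b]. To each pair [hypcount_le] applies, with sides
    [(H %/ E).+1] and [(G %/ E).+1]. *)
Lemma detcount_le (s : seq nat) (E m kap b0 H k0 G sN : nat) (D := \prod_(p <- s) p) :
  uniq s -> all (fun p => prime p && odd p) s -> coprime E D -> coprime m D -> 0 < E ->
  D <= sN ^ 2 ->
  D * detcount (D * E) m kap b0 H k0 G <=
    E * (4 ^ (size s).+1 * (4 * (H %/ E).+1 * (G %/ E).+1 +
        (2 * ((H %/ E).+1 + (G %/ E).+1) + D) * sN)).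
Proof.
move=> us als cE cm E0 DsN; set A := (H %/ E).+1; set B := (G %/ E).+1.
set bound := 4 ^ (size s).+1 * _.
have D0 : 0 < D.
  rewrite /D big_seq; apply: (big_ind (fun m => 0 < m)) => [//|a b a0 b0'|q qs].
    by rewrite muln_gt0 a0.
  by move/allP/(_ q qs)/andP: als => [/prime_gt0].
pose V i j := E %| (b0 + i) * (kap + m * (k0 + j)) + 1.
have VP i j i' j' : (D * E %| (b0 + (i + E * i')) * (kap + m * (k0 + (j + E * j'))) + 1) ->
    V i j && (D %| (b0 + i + E * i') * (kap + m * (k0 + j) + m * E * j') + 1).
  move=> h; apply/andP; split; last first.
    apply: dvdn_trans (dvdn_mulr E (dvdnn D)) _; move: h.
    by rewrite addnA [(kap + _ + _)](_ : _ = kap + m * (k0 + (j + E * j'))) //; ring.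
  have : E %| (b0 + (i + E * i')) * (kap + m * (k0 + (j + E * j'))) + 1.
    exact: dvdn_trans (dvdn_mull D (dvdnn E)) h.
  rewrite (_ : (b0 + (i + E * i')) * (kap + m * (k0 + (j + E * j'))) + 1 =
    ((b0 + i) * (kap + m * (k0 + j)) + 1) +
     E * ((b0 + i) * m * j' + i' * (kap + m * (k0 + (j + E * j'))))); last by ring.
  by rewrite dvdn_addl // dvdn_mulr.
have split : detcount (D * E) m kap b0 H k0 G <=
  \sum_(j < E) \sum_(i < E) V i j *
    \sum_(i' < A) \sum_(j' < B) (D %| (b0 + i + E * i') * (kap + m * (k0 + j) + m * E * j') + 1).
  rewrite exchange_big /=.
  apply: (leq_trans (sum_residue_split _ (fun i => \sum_(j < G) (D * E %| (b0 + i) * (kap + m * (k0 + j)) + 1)) E0)).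
  apply: leq_sum => i _; rewrite -/A.
  apply: (@leq_trans (\sum_(i' < A) \sum_(j < E) \sum_(j' < B) (V i j && (D %| (b0 + i + E * i') * (kap + m * (k0 + j) + m * E * j') + 1)))).
    apply: leq_sum => i' _.
    apply: (leq_trans (sum_residue_split _ (fun j => nat_of_bool (D * E %| (b0 + (i + E * i')) * (kap + m * (k0 + j)) + 1)) E0)).
    apply: leq_sum => j _; apply: leq_sum => j' _.
    by case: (boolP (D * E %| _)) => // /VP ->.
  rewrite exchange_big /=; apply: leq_sum => j _.
  rewrite big_distrr /=; apply: leq_sum => i' _; rewrite big_distrr /=; apply: leq_sum => j' _.
  by case: (V i j); rewrite ?mul1n ?mul0n.
have inner i j : D * (V i j * \sum_(i' < A) \sum_(j' < B)
    (D %| (b0 + i + E * i') * (kap + m * (k0 + j) + m * E * j') + 1)) <= V i j * bound.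
  case: (V i j); rewrite ?mul0n ?muln0 // !mul1n.
  have [lam [x0 [y0 [cl hle]]]] := hypcount_ge_class (b0 + i) A (kap + m * (k0 + j)) B D0 cE cm.
  apply: (@leq_trans (D * hypcount D lam x0 A y0 B)); first by rewrite leq_mul2l hle orbT.
  exact: hypcount_le.
apply: (@leq_trans (\sum_(j < E) \sum_(i < E) V i j * bound)).
  apply: leq_trans (leq_mul (leqnn D) split) _.
  rewrite big_distrr /=; apply: leq_sum => j _; rewrite big_distrr /=; apply: leq_sum => i _.
  exact: inner.
rewrite -[X in _ <= X * bound]card_ord -sum_nat_const; apply: leq_sum => j _.
rewrite -big_distrl /= -[leqRHS]mul1n leq_mul2r; apply/orP; right.
apply: (sum_bool_le1 (P := fun i => V i j)) => i i' iE i'E.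
wlog ii : i i' iE i'E / i <= i'.
  by move=> W v v'; case: (leqP i i') => [|/ltnW] h; [|apply/esym]; apply: W.
move=> v v'; set y := kap + m * (k0 + j) in v v'.
have cy : coprime E y.
  rewrite /V -/y in v; rewrite coprime_sym; apply: (@coprime_dvdr _ ((b0 + i) * y + 1)) => //.
  by rewrite /coprime gcdnMDl gcdn1.
apply/eqP; rewrite eqn_leq ii -subn_eq0 /=.
have : E %| y * (i' - i).
  have -> : y * (i' - i) = ((b0 + i') * y + 1) - ((b0 + i) * y + 1).
    by rewrite subnDr -mulnBl subnDl mulnC.
  exact: dvdn_sub.
rewrite Gauss_dvdr //; have [//|k1 d1] := posnP (i' - i).
by have := dvdn_leq k1 d1; lia.
Qed.

(** * Factoring the lower right entry *)

Lemma prod_primes_logn d : 0 < d -> d = \prod_(p <- primes d) p ^ logn p d.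
Proof. by move=> d0; rewrite {1}(prod_prime_decomp d0) prime_decompE big_map. Qed.

Lemma prod_primes_dvd (r : seq nat) n : uniq r -> all prime r ->
  (forall p, p \in r -> p %| n) -> \prod_(p <- r) p %| n.
Proof.
elim: r => [|p r IH] /=; first by rewrite big_nil dvd1n.
move=> /andP[pr ur] /andP[pp alr] h; rewrite big_cons Gauss_dvd.
  by rewrite h ?mem_head // IH // => q qr; apply: h; rewrite inE qr orbT.
rewrite big_seq; apply: (big_ind (fun m => coprime p m)) => [|a b ca cb|q qr].
- exact: coprimen1.
- by rewrite coprimeMr ca.
- move/allP/(_ q qr): alr => pq.
  by rewrite prime_coprime // dvdn_prime2 //; apply: contraNneq pr => ->.
Qed.

Lemma coprime_prod (r1 r2 : seq nat) (e : nat -> nat) : all prime r1 -> all prime r2 ->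
  (forall p, p \in r1 -> p \notin r2) ->
  coprime (\prod_(p <- r1) p ^ e p) (\prod_(p <- r2) p).
Proof.
move=> al1 al2 h; rewrite big_seq; apply: (big_ind (fun m => coprime m _)) => [|a b ca cb|p p1].
- exact: coprime1n.
- by rewrite coprimeMl ca.
- apply: coprimeXl; rewrite big_seq; apply: (big_ind (fun m => coprime p m)) => [|a b ca cb|q q2].
  + exact: coprimen1.
  + by rewrite coprimeMr ca.
  + move/allP/(_ p p1): al1 => pp; move/allP/(_ q q2): al2 => pq.
    rewrite prime_coprime // dvdn_prime2 //; apply/eqP => pqE.
    by have := h p p1; rewrite pqE q2.
Qed.

(* Exponents k >= 2 are written k = 2i + 3j with j <= 1; this is the source of [al] and [be]. *)
Lemma unitary_squarefree_part (m d : nat) : 0 < m -> 0 < d ->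
  exists s E al be, [/\ uniq s, all (fun p => prime p && odd p) s,
    d = (\prod_(p <- s) p) * E, coprime E (\prod_(p <- s) p) /\ coprime m (\prod_(p <- s) p) &
    al ^ 2 * be ^ 3 %| d /\ E <= 2 * m * (al ^ 2 * be ^ 3)].
Proof.
move=> m0 d0; have alp : all prime (primes d) by exact: all_prime_primes.
pose P1 p := logn p d == 1; pose P2 p := p %| 2 * m.
pose s := [seq p <- primes d | P1 p && ~~ P2 p].
pose t := [seq p <- primes d | P1 p && P2 p].
pose r := [seq p <- primes d | ~~ P1 p].
pose b p := odd (logn p d) : nat; pose a p := (logn p d - 3 * b p)./2.
pose al := \prod_(p <- r) p ^ a p; pose be := \prod_(p <- r) p ^ b p.
have pw k f : (\prod_(p <- r) f p) ^ k = \prod_(p <- r) f p ^ k.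
  exact: (big_morph (expn^~ k) (fun x y => expnMn x y k) (exp1n k)).
have abE : al ^ 2 * be ^ 3 = \prod_(p <- r) p ^ logn p d.
  rewrite /al /be !pw -big_split /= [LHS]big_seq [RHS]big_seq.
  apply: eq_bigr => p; rewrite mem_filter mem_primes => /andP[np1 /and3P[pp _ pd]].
  rewrite -!expnM -expnD; congr (_ ^ _).
  have : 0 < logn p d by rewrite logn_gt0 mem_primes pp d0.
  move: np1; rewrite /P1 /a /b; case: (logn p d) => [|[|k]] // _ _ /=; rewrite negbK; lia.
have tE : \prod_(p <- t) p ^ logn p d = \prod_(p <- t) p.
  rewrite [LHS]big_seq [RHS]big_seq; apply: eq_bigr => p.
  by rewrite mem_filter => /andP[/andP[/eqP -> _] _]; rewrite expn1.
have sE : \prod_(p <- s) p ^ logn p d = \prod_(p <- s) p.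
  rewrite [LHS]big_seq [RHS]big_seq; apply: eq_bigr => p.
  by rewrite mem_filter => /andP[/andP[/eqP -> _] _]; rewrite expn1.
have dE : d = \prod_(p <- s) p * (\prod_(p <- t) p * (al ^ 2 * be ^ 3)).
  rewrite -sE -tE abE [LHS](prod_primes_logn d0) /s /t /r !big_filter.
  rewrite (bigID (fun p => P1 p && ~~ P2 p)) /=; congr (_ * _).
  rewrite (bigID P1) /=; congr (_ * _); apply: eq_bigl => p.
    by case: (P1 p); case: (P2 p).
  by case: (P1 p); case: (P2 p).
have als : all prime s by rewrite all_filter; apply/allP => p pd /=; rewrite (allP alp p pd) implybT.
have alt : all prime t by rewrite all_filter; apply/allP => p pd /=; rewrite (allP alp p pd) implybT.
have alr : all prime r by rewrite all_filter; apply/allP => p pd /=; rewrite (allP alp p pd) implybT.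
exists s, (\prod_(p <- t) p * (al ^ 2 * be ^ 3)), al, be; split=> //.
- exact: filter_uniq (primes_uniq d).
- apply/allP => p ps; rewrite (allP als p ps) /=; move: ps; rewrite mem_filter => /andP[/andP[_ p2] pd].
  have pp := allP alp p pd; have [p2e|//] := even_prime pp.
  by move: p2; rewrite /P2 p2e dvdn_mulr.
- split.
    rewrite coprimeMl -tE abE !coprime_prod // => p; rewrite !mem_filter.
      by case: (P1 p).
    by case: (P1 p); case: (P2 p); rewrite ?andbF.
  rewrite big_seq; apply: (big_ind (fun n => coprime m n)) => [|x y cx cy|p].
  + exact: coprimen1.
  + by rewrite coprimeMr cx.
  + rewrite mem_filter => /andP[/andP[_ p2] pd].
    rewrite coprime_sym prime_coprime ?(allP alp p pd) //; apply: contra p2 => pm.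
    exact: dvdn_mull.
- split; first by rewrite [X in _ %| X]dE mulnA dvdn_mull.
  rewrite leq_mul2r; apply/orP; right; apply: dvdn_leq; first by rewrite muln_gt0.
  apply: prod_primes_dvd => //; first exact: filter_uniq (primes_uniq d).
  by move=> p; rewrite mem_filter => /andP[/andP[_]].
Qed.

End FixedEntry.

(** * Summation over the lower right entry *)

Lemma powR_nat_ge1 (R : realType) (p : nat) (eps : R) : 0 < eps -> (0 < p)%N ->
  1 <= p%:R `^ eps.
Proof.
by move=> e0 p0; have := @ler_powR R p%:R; rewrite ler1n => /(_ p0 0 eps (ltW e0)); rewrite powRr0.
Qed.

(** Primes with [4 <= p^eps] pay for their own factor 4; the others lie below [P0], so a list
    without repetition contains at most [P0] of them. *)
Lemma expn4_size_primes_le (R : realType) (eps : R) : 0 < eps ->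
  exists2 C : R, 0 < C & forall s : seq nat, uniq s -> all prime s ->
    (4 ^ size s)%:R <= C * (\prod_(p <- s) p)%:R `^ eps.
Proof.
move=> e0; pose P0 := (Num.truncn (4%:R `^ eps^-1 : R)).+1.
have big p : (P0 <= p)%N -> 4%:R <= p%:R `^ eps :> R.
  move=> Pp; have -> : 4%:R = (4%:R `^ eps^-1) `^ eps :> R.
    by rewrite -powRrM mulVf ?gt_eqF // powRr1.
  apply: ge0_ler_powR; rewrite ?nnegrE ?powR_ge0 ?ler0n ?(ltW e0) //.
  by apply/ltW/(lt_le_trans (truncnS_gt _)); rewrite ler_nat.
exists (4 ^ P0)%:R; first by rewrite ltr0n expn_gt0.
move=> s us als.
apply: (@le_trans _ _ ((4 ^ count (fun p => p < P0)%N s)%:R * (\prod_(p <- s) p)%:R `^ eps)).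
  elim: s us als => [|p s IH] /=; first by rewrite big_nil powR1 mulr1.
  move=> /andP[_ us] /andP[pp als]; rewrite big_cons natrM powRM ?ler0n //.
  have p1 := powR_nat_ge1 e0 (prime_gt0 pp).
  rewrite expnS natrM [(p < P0)%N]ltnNge; case: (leqP P0 p) => Pp /=.
    rewrite add0n mulrCA ler_pM ?ler0n ?big //; exact: IH.
  rewrite add1n expnS natrM -mulrA ler_wpM2l ?ler0n //; apply: (le_trans (IH us als)).
  rewrite ler_wpM2l ?ler0n // ler_peMl ?powR_ge0 //.
rewrite ler_wpM2r ?powR_ge0 // ler_nat leq_exp2l // -size_filter.
rewrite -[X in (_ <= X)%N](size_iota 0); apply: uniq_leq_size; first exact: filter_uniq.
by move=> p; rewrite mem_filter mem_iota => /andP[->].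
Qed.

Lemma harmonic_le (R : realType) (n : nat) :
  \sum_(i < n.+1) (i.+1%:R : R)^-1 <= 1 + ln n.+1%:R.
Proof.
elim: n => [|n IH]; first by rewrite big_ord1 invr1 ln1 addr0.
rewrite big_ord_recr /=; apply: (le_trans (lerD IH (lexx _))).
rewrite -addrA lerD2l -lerBrDl.
have n1 : (0 : R) < n.+1%:R by rewrite ltr0n.
have n2 : (0 : R) < n.+2%:R by rewrite ltr0n.
rewrite -[X in _ <= X]opprB lerNr -ln_div ?posrE //.
have -> : n.+1%:R / n.+2%:R = 1 + (- n.+2%:R^-1) :> R.
  have n3 : n.+1%:R + 1 != 0 :> R by rewrite natr1 gt_eqF.
  by rewrite -[n.+2%:R]natr1; field; rewrite nat1r.
by apply: le_ln1Dx; rewrite ltrN2 invf_lt1 // ltr1n.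
Qed.

Lemma log_sqr_le_powR (R : realType) (eps : R) : 0 < eps ->
  exists2 C : R, 0 < C & forall Y : R, 1 <= Y -> (1 + ln Y) ^+ 2 <= C * Y `^ eps.
Proof.
move=> e0; pose e := eps / 2; have e'0 : 0 < e by rewrite divr_gt0.
exists ((1 + e^-1) ^+ 2); first by rewrite exprn_gt0 // addr_gt0 ?invr_gt0.
move=> Y Y1; have Y0 : 0 < Y := lt_le_trans ltr01 Y1.
have -> : Y `^ eps = (Y `^ e) ^+ 2.
  by rewrite -powR_mulrn ?powR_ge0 // -powRrM /e divfK // pnatr_eq0.
have Ye : 1 <= Y `^ e by have := ler_powR Y1 (ltW e'0); rewrite powRr0.
rewrite -exprMn lerXn2r ?nnegrE ?addr_ge0 ?ln_ge0 //.
  by rewrite mulr_ge0 ?powR_ge0 // addr_ge0 ?invr_ge0 // ltW.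
rewrite mulrDl mul1r lerD // -ler_pdivrMl ?invr_gt0 // invrK -ln_powR.
by apply/ltW/ln_sublinear/powR_gt0.
Qed.

Lemma count_dvd_le N M : (M * (\sum_(d < N) (M %| d.+1)) <= N)%N.
Proof.
have [->|M0] := posnP M; first by rewrite mul0n.
suff -> : (\sum_(d < N) (M %| d.+1) = N %/ M)%N by rewrite mulnC leq_divM.
elim: N => [|N IH]; first by rewrite big_ord0 div0n.
by rewrite big_ord_recr /= IH divnS // addnC.
Qed.

(** The weight [al * be ^ 2] is an integer bound for [sqrt (al ^ 2 * be ^ 3)]. At most
    [N / (i ^ 2 * j ^ 3)] of the numbers up to [N] are divisible by [i ^ 2 * j ^ 3], so the pair
    [(i, j)] contributes at most [N / (i * j)]. *)
Lemma sum_square_cube_le (R : realType) (N : nat) (al be : nat -> nat) :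
  (forall d, (0 < d)%N -> (al d ^ 2 * be d ^ 3 %| d)%N) ->
  \sum_(d < N) ((al d.+1 * be d.+1 ^ 2)%:R : R) <=
    N%:R * (\sum_(i < N) (i.+1%:R : R)^-1) ^+ 2.
Proof.
move=> ab.
apply: (@le_trans _ _ (\sum_(d < N) \sum_(i < N) \sum_(j < N)
   (i.+1 * j.+1 ^ 2 * (i.+1 ^ 2 * j.+1 ^ 3 %| d.+1))%:R)).
  apply: ler_sum => d _; have := ab d.+1 (ltn0Sn d).
  move: (al _) (be _) => a b abd.
  have a0 : (0 < a)%N by case: a abd => // ; rewrite exp0n // mul0n dvd0n.
  have b0 : (0 < b)%N by case: b abd => // ; rewrite exp0n // muln0 dvd0n.
  have aN : (a.-1 < N)%N.
    rewrite prednK //; apply: leq_trans (ltn_ord d); apply: dvdn_leq => //.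
    by apply: dvdn_trans abd; rewrite -mulnn -mulnA dvdn_mulr.
  have bN : (b.-1 < N)%N.
    rewrite prednK //; apply: leq_trans (ltn_ord d); apply: dvdn_leq => //.
    by apply: dvdn_trans abd; rewrite expnS mulnCA dvdn_mulr.
  rewrite (bigD1 (Ordinal aN)) //= (bigD1 (Ordinal bN)) //= !prednK // abd muln1.
  by rewrite -addrA lerDl addr_ge0 ?sumr_ge0 // => i _; rewrite sumr_ge0.
rewrite exchange_big /=; under eq_bigr => i _ do rewrite exchange_big /=.
rewrite expr2 big_distrlr /= mulr_sumr; apply: ler_sum => i _.
rewrite mulr_sumr; apply: ler_sum => j _.
rewrite -natr_sum -big_distrr /= natrM -invfM ler_pdivlMr ?mulr_gt0 ?ltr0n //.
rewrite -!natrM ler_nat; apply: leq_trans (count_dvd_le N (i.+1 ^ 2 * j.+1 ^ 3)).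
by apply: eq_leq; ring.
Qed.

(** As [h / e] and [g / e] are at most [c * D], all boundary terms of the box are absorbed into a
    multiple of [c * D * r]. *)
Lemma box_bound_simplify (R : realFieldType) (T w c h g e D r s A B : R) :
  1 <= c -> 0 <= w -> 0 <= h -> 0 <= g -> 1 <= e -> 1 <= D -> 1 <= r ->
  h <= c * (D * e) -> g <= c * (D * e) -> 0 <= s -> s <= 2 * r ->
  0 <= A -> A <= h / e + 1 -> 0 <= B -> B <= g / e + 1 ->
  D * T <= e * (4 * w * (4 * A * B + (2 * (A + B) + D) * s)) ->
  T <= 120 * c * w * (h * g / (D * e) + r * e).
Proof.
move=> c1 w0 h0 g0 e1 D1 r1 hc gc s0 sr A0 Aa B0 Bb DT.
have e0 : 0 < e := lt_le_trans ltr01 e1; have D0 : 0 < D := lt_le_trans ltr01 D1.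
have [a hE] : exists a, h = a * e by exists (h / e); rewrite divfK ?gt_eqF.
have [b gE] : exists b, g = b * e by exists (g / e); rewrite divfK ?gt_eqF.
subst h g; rewrite mulfK ?gt_eqF // in Aa; rewrite mulfK ?gt_eqF // in Bb.
have a0 : 0 <= a by rewrite -(pmulr_lge0 _ e0).
have b0 : 0 <= b by rewrite -(pmulr_lge0 _ e0).
have ac : a <= c * D by rewrite -(ler_pM2r e0) -mulrA.
have bc : b <= c * D by rewrite -(ler_pM2r e0) -mulrA.
rewrite -(ler_pM2l D0); apply: (le_trans DT).
(* In the expansion below, the coefficients of the terms other than [a * b] add up to 30; the
   prefactor 4 makes it 120. *)
have -> : D * (120 * c * w * (a * e * (b * e) / (D * e) + r * e)) =
   e * (4 * w * (30 * c * (a * b + D * r))).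
  by field; rewrite !gt_eqF.
rewrite ler_pM2l // ler_wpM2l ?mulr_ge0 //.
have AB : A * B <= (a + 1) * (b + 1) by rewrite ler_pM.
have step1 : 4 * A * B + (2 * (A + B) + D) * s <=
    4 * ((a + 1) * (b + 1)) + (2 * (a + b + 2) + D) * (2 * r).
  rewrite lerD //; first by rewrite -mulrA ler_wpM2l.
  by rewrite ler_pM // ?addr_ge0 ?mulr_ge0 ?addr_ge0 ?(ltW D0) //; lra.
apply: (le_trans step1).
have r0 : 0 <= r by apply: le_trans r1.
have cD1 : 1 <= c * D by exact: mulr_ege1.
have cD0 : 0 <= c * D by apply: le_trans cD1.
have u1 : a <= c * D * r by apply: (le_trans ac); rewrite ler_peMr.
have u2 : b <= c * D * r by apply: (le_trans bc); rewrite ler_peMr.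
have u3 : a * r <= c * D * r by rewrite ler_wpM2r.
have u4 : b * r <= c * D * r by rewrite ler_wpM2r.
have u5 : r <= c * D * r by rewrite ler_peMl.
have u6 : 1 <= c * D * r by exact: mulr_ege1.
have u7 : D * r <= c * D * r by rewrite -mulrA ler_peMl // mulr_ge0 // ltW.
have u8 : a * b <= c * (a * b) by rewrite ler_peMl // mulr_ge0.
have u9 : 0 <= a * b by exact: mulr_ge0.
have -> : 4 * ((a + 1) * (b + 1)) + (2 * (a + b + 2) + D) * (2 * r) =
  4 * (a * b) + 4 * a + 4 * b + 4 + 4 * (a * r) + 4 * (b * r) + 8 * r + 2 * (D * r) by ring.
have -> : 30 * c * (a * b + D * r) = 30 * (c * (a * b)) + 30 * (c * D * r) by ring.
lra.
Qed.

(** [al] and [be] are quantified before the box, so that for given [m] they can be chosen as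
    functions of [d] and summed over [d]. *)
Lemma detcount_real_le (R : realType) (eps c : R) : 0 < eps -> 1 <= c ->
  exists2 C : R, 0 < C & forall d m : nat, (0 < d)%N -> (0 < m)%N ->
  exists al be : nat, (al ^ 2 * be ^ 3 %| d)%N /\
  forall kap b0 H k0 G : nat, H%:R <= c * d%:R -> G%:R <= c * d%:R ->
    (detcount d m kap b0 H k0 G)%:R <=
    C * d%:R `^ eps * (H%:R * G%:R / d%:R +
       Num.sqrt (2 * m%:R) * Num.sqrt d%:R * (al * be ^ 2)%:R).
Proof.
move=> e0 c1; have [C1 C10 hC1] := @expn4_size_primes_le R eps e0.
have c0 : 0 < c := lt_le_trans ltr01 c1.
exists (120 * c * C1); first by rewrite !mulr_gt0.
move=> d m d0 m0.
have [s [E [al [be [us als dE [cE cm] [abd Eab]]]]]] := unitary_squarefree_part m0 d0.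
exists al, be; split=> // kap b0 H k0 G Hc Gc.
set D := (\prod_(p <- s) p)%N in dE cE cm.
have [D0 E0] : (0 < D)%N /\ (0 < E)%N by move: d0; rewrite dE muln_gt0 => /andP[].
pose r : R := Num.sqrt D%:R; pose sN := (Num.truncn r).+1.
have r0 : 0 <= r by exact: sqrtr_ge0.
have rr : r ^+ 2 = D%:R by rewrite sqr_sqrtr ?ler0n.
have r1 : 1 <= r by rewrite -sqrtr1 ler_sqrt ?ltr0n // ler1n.
have DsN : (D <= sN ^ 2)%N.
  rewrite -(ler_nat R) natrX -rr lerXn2r ?nnegrE ?ler0n //.
  by apply/ltW/truncnS_gt.
have sNr : sN%:R <= 2 * r.
  rewrite /sN -natr1; have /andP[h _] := truncn_itv r0; lra.
have := detcount_le kap b0 H k0 G us als cE cm E0 DsN; rewrite -/D.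
rewrite -(ler_nat R) -dE => hT.
have quo n : (n %/ E).+1%:R <= n%:R / E%:R + 1 :> R.
  by rewrite -natr1 lerD2r ler_pdivlMr ?ltr0n // -natrM ler_nat leq_divM.
have w0 : (0 : R) <= (4 ^ size s)%:R by exact: ler0n.
have hw : (4 ^ size s)%:R <= C1 * d%:R `^ eps.
  apply: (le_trans (hC1 s us _)); first by apply: sub_all als => p /andP[].
  rewrite ler_wpM2l ?(ltW C10) // ge0_ler_powR ?nnegrE ?ler0n ?(ltW e0) //.
  by rewrite ler_nat dE leq_pmulr.
have dR : d%:R = D%:R * E%:R :> R by rewrite dE natrM.
have := @box_bound_simplify R (detcount d m kap b0 H k0 G)%:R (4 ^ size s)%:R c
  H%:R G%:R E%:R D%:R r sN%:R (H %/ E).+1%:R (G %/ E).+1%:R c1 w0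
  (ler0n _ _) (ler0n _ _).
rewrite !ler1n -dR => /(_ E0 D0 r1 Hc Gc (ler0n _ _) sNr (ler0n _ _) (quo H) (ler0n _ _) (quo G)).
have {}hT : D%:R * (detcount d m kap b0 H k0 G)%:R <=
  E%:R * (4 * (4 ^ size s)%:R * (4 * (H %/ E).+1%:R * (G %/ E).+1%:R +
     (2 * ((H %/ E).+1%:R + (G %/ E).+1%:R) + D%:R) * sN%:R)) :> R.
  rewrite -natrM; apply: (le_trans hT).
  by rewrite expnS !(natrM, natrD).
move=> /(_ hT) /le_trans; apply.
have -> : 120 * c * C1 * d%:R `^ eps = 120 * c * (C1 * d%:R `^ eps) by ring.
(* [sqrt D * E = sqrt d * sqrt E], and [E <= 2 * m * (al ^ 2 * be ^ 3)]. *)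
have rE : r * E%:R <= Num.sqrt (2 * m%:R) * Num.sqrt d%:R * (al * be ^ 2)%:R.
  have -> : r * E%:R = Num.sqrt E%:R * Num.sqrt d%:R.
    by rewrite dR sqrtrM ?ler0n // -/r mulrCA -expr2 sqr_sqrtr ?ler0n.
  rewrite mulrAC ler_wpM2r ?sqrtr_ge0 //.
  have -> : (al * be ^ 2)%:R = Num.sqrt ((al * be ^ 2)%:R ^+ 2) :> R.
    by rewrite sqrtr_sqr normr_nat.
  rewrite -sqrtrM ?mulr_ge0 ?ler0n // ler_sqrt; last by rewrite mulr_ge0 ?mulr_ge0 ?exprn_ge0 ?ler0n.
  rewrite -natrX -!natrM ler_nat; apply: (leq_trans Eab).
  rewrite leq_mul2l expnMn leq_mul2l -expnM; apply/orP; right; apply/orP; right.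
  by case: (be) => // b; rewrite leq_pexp2l.
have c120 : 0 <= 120 * c by rewrite mulr_ge0 // ltW.
apply: ler_pM.
- exact: mulr_ge0.
- by rewrite addr_ge0 ?mulr_ge0 ?invr_ge0 ?ler0n.
- exact: ler_wpM2l.
- by rewrite lerD2l.
Qed.

Lemma count_class_le (R : realType) (g d0 : nat) (P : pred nat) (Y : R) : (0 < g)%N -> 0 <= Y ->
  (forall d, P d -> d = d0 %[mod g]) ->
  \sum_(d < (Num.truncn Y).+1 | P d) (1 : R) <= 2 * (Y / g%:R) + 2.
Proof.
move=> g0 Y0 Pd.
rewrite big_mkcond /= -(ler_pM2l (_ : 0 < g%:R :> R)) ?ltr0n //.
apply: (@le_trans _ _ ((Num.truncn Y).+1 + g)%:R); last first.
  have /andP[hY _] := truncn_itv Y0.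
  have -> : g%:R * (2 * (Y / g%:R) + 2) = 2 * Y + 2 * g%:R by field; rewrite pnatr_eq0 -lt0n.
  have g1 : 1 <= g%:R :> R by rewrite ler1n.
  rewrite natrD -natr1; lra.
apply: le_trans (_ : (g * (\sum_(j < (Num.truncn Y).+1) (d0 == j %[mod g])))%N%:R <= _); last first.
  by rewrite ler_nat count_mod_le.
rewrite natrM ler_wpM2l ?ler0n // natr_sum; apply: ler_sum => d _.
by case: ifP => [/Pd ->|_]; rewrite ?eqxx // ler0n.
Qed.

(** Since [d] is comparable to [Y], the first term of [detcount_real_le] has a bound independent of
    [d], which is multiplied by the number of [d] in one class modulo [g]. The second is averaged by
    [sum_square_cube_le]. *)
Lemma sum_detcount_le (R : realType) (eps c kappa : R) : 0 < eps -> 0 < c -> 0 < kappa ->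
  exists2 C : R, 0 < C & forall (Y : R) (m g H G d0 : nat) (P : pred nat) (kap b0 k0 : nat -> nat),
  1 <= Y -> (0 < m)%N -> (0 < g)%N -> H%:R <= c * Y -> G%:R <= c * Y ->
  (forall d, P d -> [/\ (0 < d)%N, d%:R <= Y, Y <= kappa * d%:R & d = d0 %[mod g]]) ->
  (\sum_(d < (Num.truncn Y).+1 | P d) detcount d m (kap d) (b0 d) H (k0 d) G)%:R <=
  C * Y `^ eps * (H%:R * G%:R / Y * (Y / g%:R + 1) + Num.sqrt (2 * m%:R) * (Num.sqrt Y * Y)).
Proof.
(* One half of [eps] pays for the powers of 4, the other for the square of the logarithm. *)
move=> e0 c0 k0'; have e20 : 0 < eps / 2 by rewrite divr_gt0.
(* A length of at most [c * Y] is at most [c * kappa * d]; adding 1 makes the constant at least 1,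
   as [detcount_real_le] requires. *)
have c1 : 1 <= c * kappa + 1 by rewrite lerDr mulr_ge0 // ltW.
have [C1 C10 hC1] := detcount_real_le e20 c1.
have [C2 C20 hC2] := @log_sqr_le_powR R (eps / 2) e20.
exists (C1 * (2 * kappa + C2)); first by rewrite mulr_gt0 // addr_gt0 // mulr_gt0.
move=> Y m g H G d0 P kap b0 k0 Y1 m0 g0 Hc Gc hP.
have Y0 : 0 < Y := lt_le_trans ltr01 Y1.
have /choice[al hal] : forall d, exists al : nat, exists be : nat, (0 < d)%N ->
  (al ^ 2 * be ^ 3 %| d)%N /\
  forall kap b0 H k0 G : nat, H%:R <= (c * kappa + 1) * d%:R -> G%:R <= (c * kappa + 1) * d%:R ->
    (detcount d m kap b0 H k0 G)%:R <=
    C1 * d%:R `^ (eps / 2) * (H%:R * G%:R / d%:R +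
       Num.sqrt (2 * m%:R) * Num.sqrt d%:R * (al * be ^ 2)%:R).
  move=> d; have [->|d0'] := posnP d; first by exists 0%N, 0%N.
  by have [al [be h]] := hC1 d m d0' m0; exists al, be.
have /choice[be hbe] := hal.
set N := Num.truncn Y; have /andP[NY _] := truncn_itv (ltW Y0).
have N0 : (0 < N)%N by rewrite truncn_gt0.
set S := Num.sqrt (2 * m%:R); have S0 : 0 <= S by exact: sqrtr_ge0.
have sY0 : 0 <= Num.sqrt Y by exact: sqrtr_ge0.
have pY1 : 1 <= Y `^ (eps / 2) by have := ler_powR Y1 (ltW e20); rewrite powRr0.
have pYY : Y `^ (eps / 2) * Y `^ (eps / 2) = Y `^ eps.
  rewrite -powRD; last by rewrite gt_eqF // addr_gt0.
  by congr (_ `^ _); rewrite -splitr.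
have each (d : nat) : P d -> (detcount d m (kap d) (b0 d) H (k0 d) G)%:R <=
    C1 * Y `^ (eps / 2) * (kappa * (H%:R * G%:R / Y) * 1 + S * Num.sqrt Y * (al d * be d ^ 2)%:R).
  move=> Pd; have [dpos dY Yd _] := hP d Pd; have [_ hd] := hbe d dpos.
  have dR : (0 : R) < d%:R by rewrite ltr0n.
  have le_c (n : nat) : n%:R <= c * Y -> n%:R <= (c * kappa + 1) * d%:R.
    move=> /le_trans; apply; rewrite mulrDl mul1r -mulrA.
    by rewrite (le_trans (ler_wpM2l (ltW c0) Yd)) // lerDl ltW.
  apply: (le_trans (hd _ _ _ _ _ (le_c _ Hc) (le_c _ Gc))).
  apply: ler_pM.
  - by rewrite mulr_ge0 ?powR_ge0 // ltW.
  - by rewrite addr_ge0 ?mulr_ge0 ?invr_ge0 ?ler0n ?sqrtr_ge0.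
  - by rewrite ler_wpM2l ?(ltW C10) // ge0_ler_powR ?nnegrE ?(ltW e20) ?(ltW Y0) ?ler0n.
  - rewrite mulr1 lerD //.
      rewrite mulrCA ler_wpM2l ?mulr_ge0 ?ler0n //.
      by rewrite -[leLHS]mul1r ler_pdivrMr // mulrAC ler_pdivlMr // mul1r.
    by rewrite ler_wpM2r ?ler0n // ler_wpM2l // ler_wsqrtr.
have sumW : \sum_(d < N.+1 | P d) ((al d * be d ^ 2)%:R : R) <= Y * (C2 * Y `^ (eps / 2)).
  apply: (@le_trans _ _ (\sum_(d < N) ((al d.+1 * be d.+1 ^ 2)%:R : R))).
    rewrite big_mkcond big_ord_recl /=; case: ifP => [/hP[]//|_]; rewrite add0r.
    by apply: ler_sum => d _; case: ifP => // _; rewrite ler0n.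
  apply: (le_trans (sum_square_cube_le R N (fun d hd => (hbe d hd).1))).
  have hs : 0 <= \sum_(i < N) (i.+1%:R : R)^-1.
    by apply: sumr_ge0 => i _; rewrite invr_ge0 ler0n.
  have [n NE] : exists n, N = n.+1 by exists N.-1; rewrite prednK.
  apply: ler_pM => //; first by rewrite exprn_ge0.
  apply: le_trans (hC2 Y Y1); rewrite lerXn2r ?nnegrE //.
  - by rewrite addr_ge0 // ln_ge0.
  rewrite NE (le_trans (harmonic_le R n)) // lerD2l ler_ln ?posrE ?ltr0n //.
  by rewrite -NE.
have cnt : \sum_(d < N.+1 | P d) (1 : R) <= 2 * (Y / g%:R) + 2.
  by apply: (@count_class_le R g d0 P Y g0 (ltW Y0)) => d /hP[].
rewrite natr_sum; apply: (le_trans (ler_sum _ (fun (d : 'I_N.+1) Pd => each d Pd))).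
rewrite -mulr_sumr big_split /= -!mulr_sumr.
set X := H%:R * G%:R / Y; have X0 : 0 <= X by rewrite mulr_ge0 ?invr_ge0 ?mulr_ge0 ?ler0n // ltW.
have t1 : kappa * X * \sum_(d < N.+1 | P d) 1 <= 2 * kappa * (X * (Y / g%:R + 1)).
  have -> : 2 * kappa * (X * (Y / g%:R + 1)) = kappa * X * (2 * (Y / g%:R) + 2) by ring.
  by rewrite ler_wpM2l // mulr_ge0 // ltW.
have t2 : S * Num.sqrt Y * (\sum_(d < N.+1 | P d) (al d * be d ^ 2)%:R) <=
    C2 * Y `^ (eps / 2) * (S * (Num.sqrt Y * Y)).
  have -> : C2 * Y `^ (eps / 2) * (S * (Num.sqrt Y * Y)) = S * Num.sqrt Y * (Y * (C2 * Y `^ (eps / 2))) by ring.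
  by rewrite ler_wpM2l // mulr_ge0.
set U := X * _ in t1 *; set V := S * (_ * _) in t2 *.
have U0 : 0 <= U by rewrite mulr_ge0 // addr_ge0 // mulr_ge0 ?invr_ge0 ?ler0n // ltW.
have V0 : 0 <= V by rewrite !mulr_ge0 // ltW.
apply: (@le_trans _ _ (C1 * Y `^ (eps / 2) * (2 * kappa * U + C2 * Y `^ (eps / 2) * V))).
  by rewrite ler_wpM2l ?lerD // mulr_ge0 ?powR_ge0 // ltW.
rewrite -pYY; set p := Y `^ (eps / 2) in pY1 *.
have -> : C1 * (2 * kappa + C2) * (p * p) * (U + V) = C1 * p * ((2 * kappa + C2) * p * (U + V)) by ring.
have p0 : 0 <= p := le_trans ler01 pY1.
rewrite ler_wpM2l ?mulr_ge0 ?(ltW C10) //.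
have h1 : kappa * U <= kappa * (p * U) by rewrite ler_wpM2l ?(ltW k0') // ler_peMl.
have h2 : 0 <= C2 * (p * U) := mulr_ge0 (ltW C20) (mulr_ge0 p0 U0).
have h3 : 0 <= kappa * (p * V) := mulr_ge0 (ltW k0') (mulr_ge0 p0 V0).
have -> : (2 * kappa + C2) * p * (U + V) = 2 * (kappa * (p * U)) + C2 * (p * U) + 2 * (kappa * (p * V)) + C2 * p * V by ring.
rewrite -mulrA; lra.
Qed.

(** * Geometry of the set and conclusion *)

Lemma modn_mul_cancel (q x a b : nat) : (0 < q)%N ->
  (a * x = b * x %[mod q] -> a = b %[mod q %/ gcdn x q])%N.
Proof.
move=> q0; wlog ab : a b / (a <= b)%N.
  by move=> W; case: (leqP a b) => [|/ltnW] h; [|move/esym=> e; apply/esym]; exact: W.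
move=> /esym/eqP; rewrite eqn_mod_dvd ?leq_mul2r ?ab ?orbT // -mulnBl => d.
apply/esym/eqP; rewrite eqn_mod_dvd //.
have g0 : (0 < gcdn x q)%N by rewrite gcdn_gt0 q0 orbT.
have cop : coprime (q %/ gcdn x q) (x %/ gcdn x q).
  rewrite /coprime -(eqn_pmul2r g0) muln_gcdl !divnK ?dvdn_gcdl ?dvdn_gcdr // mul1n.
  by rewrite gcdnC.
rewrite -(Gauss_dvdl _ cop) -(dvdn_pmul2r g0) -mulnA.
by rewrite !divnK ?dvdn_gcdl ?dvdn_gcdr.
Qed.

(** The interval starts at the least element of [P], or at 0 if there is none. *)
Lemma nat_window (R : realType) (P : nat -> Prop) (len : R) : 0 <= len ->
  (forall k k', P k -> P k' -> k'%:R - k%:R <= len) ->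
  exists k0 : nat, forall k, P k -> exists2 i : nat, (i < (Num.truncn len).+1)%N & k = (k0 + i)%N.
Proof.
move=> len0 h; have [[k Pk]|nP] := pselect (exists k, P k); last first.
  by exists 0%N => k Pk; case: nP; exists k.
have ex : exists k, `[< P k >] by exists k; apply/asboolP.
case: (ex_minnP ex) => k0 /asboolP Pk0 kmin; exists k0 => k' Pk'.
have kk : (k0 <= k')%N by apply: kmin; apply/asboolP.
exists (k' - k0)%N; last by rewrite subnKC.
by rewrite ltnS truncn_ge_nat // natrB // h.
Qed.

(** With [d] fixed, the two windows give [(c' - c) * x <= 2 * X / K], and [x] is at least
    [c1 * X / (A * Y)]. *)
Lemma column_entry_diff (R : realFieldType) (X Y K A c1 x y v c c' d : R) :
  0 < X -> 0 < Y -> 0 < K -> 0 < A -> 0 < c1 -> 0 < x ->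
  y / A <= x -> c1 * (X / Y) <= y ->
  `|c * x + d * y - v| <= X / K -> `|c' * x + d * y - v| <= X / K ->
  c' - c <= 2 * A / c1 * (Y / K).
Proof.
move=> X0 Y0 K0 A0 c10 x0 yx cy h h'.
have hx : c1 * (X / Y) / A <= x by apply: le_trans yx; rewrite ler_pM2r // invr_gt0.
have d2 : (c' - c) * x <= 2 * (X / K).
  by move: h h'; rewrite !ler_norml => /andP[h1 h2] /andP[h3 h4]; lra.
have w0 : 0 < c1 * (X / Y) / A by rewrite !mulr_gt0 ?invr_gt0.
have [cc|cc] := leP (c' - c) 0.
  by apply: (le_trans cc); rewrite !mulr_ge0 ?invr_ge0 // ltW.
rewrite -(ler_pM2r w0); apply: le_trans (_ : (c' - c) * x <= _); first by rewrite ler_pM2l.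
apply: (le_trans d2); rewrite le_eqVlt; apply/orP; left; apply/eqP.
by field; rewrite !gt_eqF.
Qed.

(** The determinant eliminates [a]: [b * v1 = d * u1 - x], where [(u1, v1)] is the image vector. So
    [b] is, up to a small correction, [d] times the slope [u1 / v1], and the windows confine the
    slope. *)
Lemma row_entry_diff (R : realFieldType) (X Y K c2 c3 x y u v d a b c a' b' c' : R) :
  0 < X -> 1 <= Y -> 0 < K -> 0 < c2 -> 0 < c3 -> 0 < x -> 0 < u ->
  x <= y -> y <= c2 * (X / Y) -> u <= v -> c3 * X <= v -> 2 * X / K <= v ->
  0 < d -> d <= Y -> a * d = b * c + 1 -> a' * d = b' * c' + 1 ->
  `|a * x + b * y - u| <= X / K -> `|c * x + d * y - v| <= X / K ->
  `|a' * x + b' * y - u| <= X / K -> `|c' * x + d * y - v| <= X / K ->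
  b - b' <= (16 / c3 + 8 * c2 / c3 ^+ 2) * (Y / K).
Proof.
move=> X0 Y1 K0 c20 c30 x0 u0 xy yc uv cv Kv d0 dY det det'.
have Y0 : 0 < Y := lt_le_trans ltr01 Y1.
set rho := X / K; have r0 : 0 < rho by rewrite divr_gt0.
have {}Kv : 2 * rho <= v by rewrite /rho mulrA.
set u1 := a * x + b * y; set v1 := c * x + d * y.
set u1' := a' * x + b' * y; set v1' := c' * x + d * y.
rewrite !ler_norml => /andP[hu hu'] /andP[hv hv'] /andP[ku ku'] /andP[kv kv'].
have cX0 : 0 < c3 * X by rewrite mulr_gt0.
(* By [2 * X / K <= v], the window leaves [v1] at least [v / 2]. *)
have v1X : c3 * X / 2 <= v1 by lra.
have v1X' : c3 * X / 2 <= v1' by lra.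
have v10 : 0 < v1 by lra.
have v10' : 0 < v1' by lra.
have bv : b * v1 = d * u1 - x.
  rewrite /v1 /u1; transitivity (d * (a * x + b * y) - (a * d - b * c) * x); first by ring.
  by rewrite det addrAC subrr add0r mul1r.
have bv' : b' * v1' = d * u1' - x.
  rewrite /v1' /u1'; transitivity (d * (a' * x + b' * y) - (a' * d - b' * c') * x); first by ring.
  by rewrite det' addrAC subrr add0r mul1r.
(* The 8 is 2 + 6: [u1] varies by at most [2 * rho], and [u1'], at most [3 * v1'], is multiplied by
   a variation of [v1] of at most [2 * rho]. *)
have key : (b - b') * (v1 * v1') <= 8 * d * rho * v1' + 2 * x * rho.
  have -> : (b - b') * (v1 * v1') = d * ((u1 - u1') * v1' + u1' * (v1' - v1)) - x * (v1' - v1).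
    transitivity (b * v1 * v1' - b' * v1' * v1); first by ring.
    by rewrite bv bv'; ring.
  have e1 : (u1 - u1') * v1' <= 2 * rho * v1' by rewrite ler_pM2r //; lra.
  have e2 : u1' * (v1' - v1) <= 3 * v1' * (2 * rho).
    apply: le_trans (ler_norm _) _; rewrite normrM ler_pM ?normr_ge0 //.
      by rewrite ler_norml; apply/andP; split; lra.
    by rewrite ler_norml; apply/andP; split; lra.
  have e3 : - (x * (v1' - v1)) <= 2 * x * rho.
    have -> : - (x * (v1' - v1)) = x * (v1 - v1') by ring.
    have -> : 2 * x * rho = x * (2 * rho) by ring.
    by rewrite ler_pM2l //; lra.
  apply: lerD => //.
  have -> : 8 * d * rho * v1' = d * (2 * rho * v1' + 3 * v1' * (2 * rho)) by ring.
  by rewrite ler_pM2l // lerD.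
have vv0 : 0 < v1 * v1' by rewrite mulr_gt0.
rewrite -(ler_pM2r vv0); apply: (le_trans key).
have -> : (16 / c3 + 8 * c2 / c3 ^+ 2) * (Y / K) * (v1 * v1') =
  16 / c3 * (v1 * v1') * (Y / K) + 8 * c2 / c3 ^+ 2 * (v1 * v1') * (Y / K) by ring.
apply: lerD.
  have -> : 8 * d * rho * v1' = 8 * d / K * v1' * X by rewrite /rho; field; rewrite gt_eqF.
  apply: (@le_trans _ _ (16 / c3 * (c3 * X / 2 * v1') * (Y / K))).
    have -> : 16 / c3 * (c3 * X / 2 * v1') * (Y / K) = 8 * Y / K * v1' * X.
      by field; rewrite !gt_eqF.
    by rewrite !ler_wpM2r ?invr_ge0 ?(ltW K0) ?(ltW X0) ?(ltW v10') // ler_wpM2l.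
  rewrite ler_wpM2r ?divr_ge0 ?(ltW Y0) ?(ltW K0) // ler_wpM2l ?divr_ge0 ?(ltW c30) //.
  by rewrite ler_wpM2r ?(ltW v10').
apply: (@le_trans _ _ (8 * c2 / c3 ^+ 2 * (c3 * X / 2 * (c3 * X / 2)) * (Y / K))); last first.
  rewrite ler_wpM2r ?divr_ge0 ?(ltW Y0) ?(ltW K0) // ler_wpM2l //.
    by rewrite divr_ge0 ?mulr_ge0 ?exprn_ge0 ?(ltW c20) ?(ltW c30).
  by rewrite ler_pM // divr_ge0 ?(ltW cX0).
have -> : 8 * c2 / c3 ^+ 2 * (c3 * X / 2 * (c3 * X / 2)) * (Y / K) = 2 * (c2 * X * Y) * rho.
  by rewrite /rho; field; rewrite !gt_eqF.
rewrite ler_pM2r // ler_pM2l //; apply: (le_trans xy); apply: (le_trans yc).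
rewrite mulrA ler_wpM2l ?mulr_ge0 ?(ltW c20) ?(ltW X0) //.
by apply: le_trans (_ : 1 <= _); rewrite // invf_le1.
Qed.

(** With [K >= k0], the inequality [K ^+ 4 * q ^+ 3 < Y] bounds [Y / K / m] and [Y / g] from below,
    so that every added 1 is absorbed. For the error term it gives [K ^+ 2 * q <= sqrt Y]. *)
Lemma final_inequality (R : realType) (k0 Cb Cc : R) : 0 < k0 -> 0 < Cb -> 0 < Cc ->
  exists2 c : R, 0 < c & forall (Y K : R) (q m g H G : nat),
  k0 <= K -> 1 <= Y -> (0 < m)%N -> (0 < g)%N -> (m * g)%N = q -> K ^+ 4 * q%:R ^+ 3 < Y ->
  H%:R <= Cb * (Y / K) + 1 -> G%:R <= Cc * (Y / K) / m%:R + 1 ->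
  [/\ H%:R <= c * Y, G%:R <= c * Y &
   H%:R * G%:R / Y * (Y / g%:R + 1) + Num.sqrt (2 * m%:R) * (Num.sqrt Y * Y) <=
     c * (Y ^+ 2 / K ^+ 2 / Num.sqrt q%:R)].
Proof.
move=> k00 Cb0 Cc0.
pose e3 := (k0 ^+ 3)^-1; pose e4 := (k0 ^+ 4)^-1.
have e30 : 0 < e3 by rewrite invr_gt0 exprn_gt0.
have e40 : 0 < e4 by rewrite invr_gt0 exprn_gt0.
pose CH := Cb + e3; pose CG := Cc + e3.
have CH0 : 0 < CH by exact: addr_gt0.
have CG0 : 0 < CG by exact: addr_gt0.
have x1 : 0 < CH / k0 by exact: divr_gt0.
have x2 : 0 < CG / k0 by exact: divr_gt0.
have x3 : 0 < CH * CG * (1 + e4) := mulr_gt0 (mulr_gt0 CH0 CG0) (addr_gt0 ltr01 e40).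
have cp : 0 < CH / k0 + CG / k0 + CH * CG * (1 + e4) + 2 by lra.
exists (CH / k0 + CG / k0 + CH * CG * (1 + e4) + 2) => //.
move=> Y K q m g H G kK Y1 m0 g0 mg KY hH hG.
set c := _ + 2 in cp *.
have K0 : 0 < K := lt_le_trans k00 kK.
have Y0 : 0 < Y := lt_le_trans ltr01 Y1.
have q0 : (0 < q)%N by rewrite -mg muln_gt0 m0.
have [qR mR gR] : [/\ 1 <= q%:R :> R, 1 <= m%:R :> R & 1 <= g%:R :> R] by rewrite !ler1n.
have mgR : m%:R * g%:R = q%:R :> R by rewrite -natrM mg.
have [qR0 mR0 gR0] : [/\ 0 < q%:R :> R, 0 < m%:R :> R & 0 < g%:R :> R] by rewrite !ltr0n.
have k3K : k0 ^+ 3 <= K ^+ 3 by rewrite lerXn2r // nnegrE ltW.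
have k4K : k0 ^+ 4 <= K ^+ 4 by rewrite lerXn2r // nnegrE ltW.
have mq : m%:R <= q%:R :> R by rewrite -mgR ler_peMr // ltW.
have gq : g%:R <= q%:R :> R by rewrite -mgR ler_peMl // ltW.
have q3 : q%:R <= q%:R ^+ 3 :> R by rewrite exprS ler_peMr ?(ltW qR0) // exprn_ege1.
have q2 : q%:R ^+ 2 <= q%:R ^+ 3 :> R by rewrite [leRHS]exprS ler_peMl ?exprn_ge0 ?(ltW qR0).
have YKm : 1 <= e3 * (Y / K / m%:R).
  rewrite /e3 mulrC ler_pdivlMr ?exprn_gt0 // mul1r; apply: (le_trans k3K).
  rewrite !ler_pdivlMr //; apply: le_trans (ltW KY).
  have -> : K ^+ 3 * m%:R * K = K ^+ 4 * m%:R by ring.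
  by rewrite ler_wpM2l ?exprn_ge0 ?(ltW K0) // (le_trans mq).
have YK : 1 <= e3 * (Y / K).
  apply: (le_trans YKm); rewrite ler_wpM2l ?(ltW e30) // ler_pdivrMr //.
  by rewrite ler_peMr // divr_ge0 ?(ltW Y0) ?(ltW K0).
have Yg : 1 <= e4 * (Y / g%:R).
  rewrite /e4 mulrC ler_pdivlMr ?exprn_gt0 // mul1r; apply: (le_trans k4K).
  rewrite ler_pdivlMr //; apply: le_trans (ltW KY).
  by rewrite ler_wpM2l ?exprn_ge0 ?(ltW K0) // (le_trans gq).
have hH2 : H%:R <= CH * (Y / K) by rewrite mulrDl; apply: (le_trans hH); rewrite lerD2l.
have hG2 : G%:R <= CG * (Y / K / m%:R).
  by rewrite mulrDl; apply: (le_trans hG); rewrite -mulrA lerD.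
have YKk : Y / K <= Y / k0 by rewrite ler_pM2l // lef_pV2.
split.
- apply: (le_trans hH2); apply: (le_trans (ler_wpM2l (ltW CH0) YKk)).
  have -> : CH * (Y / k0) = CH / k0 * Y by ring.
  by rewrite ler_pM2r // /c; lra.
- apply: (le_trans hG2); apply: (@le_trans _ _ (CG * (Y / k0))).
    rewrite ler_pM2l // ler_pdivrMr //; apply: (le_trans YKk).
    by rewrite ler_peMr // divr_ge0 ?(ltW Y0) ?(ltW k00).
  have -> : CG * (Y / k0) = CG / k0 * Y by ring.
  by rewrite ler_pM2r // /c; lra.
set S := Num.sqrt q%:R; have SS : S ^+ 2 = q%:R by rewrite sqr_sqrtr // ltW.
set t := Num.sqrt Y; have tt : t ^+ 2 = Y by rewrite sqr_sqrtr // ltW.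
have S1 : 1 <= S by rewrite -sqrtr1 ler_wsqrtr.
have S0 : 0 < S := lt_le_trans ltr01 S1.
have t0 : 0 < t by rewrite sqrtr_gt0.
have Kqt : K ^+ 2 * q%:R <= t.
  rewrite -(@ler_pXn2r _ 2) ?nnegrE ?mulr_ge0 ?exprn_ge0 ?(ltW K0) ?(ltW qR0) ?(ltW t0) //.
  rewrite tt exprMn -exprM; apply: le_trans (ltW KY).
  by rewrite ler_wpM2l // exprn_ge0 // ltW.
have W0 : 0 <= Y ^+ 2 / K ^+ 2 / S by rewrite !divr_ge0 ?exprn_ge0 ?(ltW Y0) ?(ltW K0) ?(ltW S0).
have t1 : H%:R * G%:R / Y * (Y / g%:R + 1) <= CH * CG * (1 + e4) * (Y ^+ 2 / K ^+ 2 / S).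
  have s1 : Y / g%:R + 1 <= (1 + e4) * (Y / g%:R) by rewrite mulrDl mul1r lerD2l.
  have s2 : H%:R * G%:R <= CH * (Y / K) * (CG * (Y / K / m%:R)) by rewrite ler_pM.
  apply: (@le_trans _ _ (CH * (Y / K) * (CG * (Y / K / m%:R)) / Y * ((1 + e4) * (Y / g%:R)))).
    rewrite ler_pM ?addr_ge0 ?mulr_ge0 ?invr_ge0 ?ler0n ?(ltW Y0) //.
    by rewrite ler_pM2r // invr_gt0.
  have -> : CH * (Y / K) * (CG * (Y / K / m%:R)) / Y * ((1 + e4) * (Y / g%:R)) =
     CH * CG * (1 + e4) * (Y ^+ 2 / K ^+ 2 / q%:R).
    by rewrite -mgR; field; rewrite !gt_eqF.
  rewrite ler_wpM2l ?(ltW x3) //.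
  rewrite ler_wpM2l ?divr_ge0 ?exprn_ge0 ?(ltW Y0) ?(ltW K0) // lef_pV2 ?posrE //.
  by rewrite -SS expr2 ler_peMr // ltW.
have t2 : Num.sqrt (2 * m%:R) * (t * Y) <= 2 * (Y ^+ 2 / K ^+ 2 / S).
  have s1 : Num.sqrt (2 * m%:R) <= 2 * S.
    have -> : 2 * S = Num.sqrt ((2 * S) ^+ 2) by rewrite sqrtr_sqr ger0_norm // mulr_ge0 // ltW.
    by rewrite ler_wsqrtr // exprMn SS; nra.
  apply: (@le_trans _ _ (2 * S * (t * Y))).
    by rewrite ler_pM2r // mulr_gt0.
  rewrite -mulrA ler_pM2l // ler_pdivlMr // ler_pdivlMr ?exprn_gt0 //.
  have -> : S * (t * Y) * S * K ^+ 2 = (t * Y) * (K ^+ 2 * S ^+ 2) by ring.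
  rewrite SS; apply: (@le_trans _ _ (t * Y * t)); first by rewrite ler_pM2l // mulr_gt0.
  by rewrite -tt le_eqVlt; apply/orP; left; apply/eqP; ring.
apply: (le_trans (lerD t1 t2)); rewrite -mulrDl ler_wpM2r //.
by rewrite /c; lra.
Qed.

(** * Integer matrices as points of boxes, and the conclusion *)

Local Open Scope classical_set_scope.
Local Open Scope ring_scope.

Definition mat2 (a b c d : nat) : 'M[int]_2 :=
  \matrix_(i, j) (if i == 0 then (if j == 0 then a else b) else (if j == 0 then c else d))%:Z.

Lemma mx2P (g h : 'M[int]_2) : g 0 0 = h 0 0 -> g 0 1 = h 0 1 -> g 1 0 = h 1 0 ->
  g 1 1 = h 1 1 -> g = h.
Proof.
move=> e00 e01 e10 e11; apply/matrixP => i j.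
have ord2 (k : 'I_2) : k = 0 \/ k = 1.
  by case: k => [[|[|k]] hk]; [left|right|]; try exact: val_inj.
by case: (ord2 i) => ->; case: (ord2 j) => ->.
Qed.

Lemma det2E (g : 'M[int]_2) : \det g = g 0 0 * g 1 1 - g 0 1 * g 1 0.
Proof.
rewrite (expand_det_row _ 0) !big_ord_recl big_ord0 addr0 /cofactor !det_mx11 !mxE /=.
have l0 : lift ord0 ord0 = 1 :> 'I_2 by exact: val_inj.
have l1 : lift 1 0 = 0 :> 'I_2 by exact: val_inj.
by rewrite !l0 !l1 /= expr0 expr1 mul1r mulN1r mulrN.
Qed.

Lemma calM_nat (R : realType) (X Y K kappa1 : R) (q x y u v : nat) (eta eta' : 'cV[int]_2) g :
  eta 0 0 = x%:Z -> eta 1 0 = y%:Z -> eta' 0 0 = u%:Z -> eta' 1 0 = v%:Z ->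
  calM X Y K kappa1 q eta eta' g ->
  exists a b c d : nat, g = mat2 a b c d /\
  [/\ (a * d = b * c + 1)%N, [/\ (0 < d)%N, Y / kappa1 <= d%:R & d%:R <= Y],
      `|a%:R * x%:R + b%:R * y%:R - u%:R| <= X / K,
      `|c%:R * x%:R + d%:R * y%:R - v%:R| <= X / K &
      (c * x + d * y = v %[mod q])%N].
Proof.
move=> ex ey eu ev [[/andP[a0 ab] /andP[c1 cd] /andP[b1 bd] det] win con /andP[dY dY']].
have toN (z : int) : 0 <= z -> exists n : nat, z = n%:Z by case: z => // n _; exists n.
have [a aE] := toN _ a0.
have [b bE] := toN _ (le_trans ler01 b1).
have [c cE] := toN _ (le_trans ler01 c1).
have [d dE] := toN _ (le_trans (le_trans ler01 c1) cd).
have prod0 : (g *m eta) 0 0 = (a * x + b * y)%N%:Z.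
  rewrite mxE !big_ord_recl big_ord0 addr0 (_ : lift ord0 ord0 = 1); last exact: val_inj.
  by rewrite aE bE ex ey PoszD !PoszM.
have prod1 : (g *m eta) 1 0 = (c * x + d * y)%N%:Z.
  rewrite mxE !big_ord_recl big_ord0 addr0 (_ : lift ord0 ord0 = 1); last exact: val_inj.
  by rewrite cE dE ex ey PoszD !PoszM.
have sub_nat (m n : nat) : (m%:Z - n%:Z)%:~R = m%:R - n%:R :> R.
  by rewrite rmorphB /= -!pmulrn.
exists a, b, c, d; split.
  by apply: mx2P; rewrite !mxE.
split.
- move: det; rewrite det2E aE bE cE dE => det.
  apply/eqP; rewrite -eqz_nat PoszD !PoszM; apply/eqP.
  by rewrite -[Posz 1]det addrC subrK.
- rewrite /Mnorm dE -pmulrn in dY dY'; split=> //.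
  by rewrite -ltz_nat -dE (lt_le_trans ltr01) // (le_trans c1).
- have := win 0; rewrite mxE [X in _ + X]mxE prod0 eu sub_nat.
  by rewrite natrD !natrM.
- have := win 1; rewrite mxE [X in _ + X]mxE prod1 ev sub_nat.
  by rewrite natrD !natrM.
- by have := con 1; rewrite prod1 ev !modz_nat => -[].
Qed.

Lemma finite_set_cover (T : choiceType) (A : set T) (l : seq T) :
  (forall x, A x -> x \in l) ->
  finite_set A /\ (#|` fset_set A|%fset <= size l)%N.
Proof.
move=> Al; have fA : finite_set A.
  by apply: (@sub_finite_set _ A [set` l]); [move=> x /Al|exact: finite_seq].
split=> //; apply: uniq_leq_size; first exact: fset_uniq.
by move=> x; rewrite in_fset_set // inE => /Al.
Qed.

(** The triple [(d, i, j)] determines the matrix, as [a] is [(b * c + 1) %/ d]. So the set is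
    covered by the image of the triples that [detcount] counts. *)
Lemma card_le_detcount (A : set 'M[int]_2) (N m H G : nat) (P : pred nat) (kap b0 k0 : nat -> nat) :
  (forall g, A g -> exists a b c d : nat,
    [/\ g = mat2 a b c d, (a * d = b * c + 1)%N, (0 < d < N)%N && P d,
        exists2 i, (i < H)%N & b = (b0 d + i)%N &
        exists2 j, (j < G)%N & c = (kap d + m * (k0 d + j))%N]) ->
  finite_set A /\
  (#|` fset_set A|%fset <= \sum_(d < N | P d) detcount d m (kap d) (b0 d) H (k0 d) G)%N.
Proof.
move=> hA.
pose bb (t : 'I_N * ('I_H * 'I_G)) := (b0 t.1 + t.2.1)%N.
pose cc (t : 'I_N * ('I_H * 'I_G)) := (kap t.1 + m * (k0 t.1 + t.2.2))%N.
pose Q := [pred t : 'I_N * ('I_H * 'I_G) | P t.1 && (t.1 %| bb t * cc t + 1)%N].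
pose F (t : 'I_N * ('I_H * 'I_G)) := mat2 ((bb t * cc t + 1) %/ t.1) (bb t) (cc t) t.1.
have cQ : #|Q| = (\sum_(d < N | P d) detcount d m (kap d) (b0 d) H (k0 d) G)%N.
  rewrite -sum1_card big_mkcond [RHS]big_mkcond /=.
  transitivity (\sum_(d < N) \sum_(u : 'I_H * 'I_G)
     (if (d, u) \in Q then 1 else 0))%N.
    by rewrite pair_big; apply: eq_bigr => -[].
  apply: eq_bigr => d _; rewrite /detcount; case: ifP => Pd.
    rewrite pair_big /=; apply: eq_bigr => -[i j] _.
    by rewrite inE /= Pd /bb /cc /=; case: (_ %| _)%N.
  by apply: big1 => u _; rewrite inE /= Pd.
rewrite -cQ cardE -(size_map F); apply: finite_set_cover => g /hA.
move=> [a [b [c [d [gE det /andP[/andP[d0 dN] Pd] [i iH bE] [j jG cE]]]]]].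
apply/mapP; exists (Ordinal dN, (Ordinal iH, Ordinal jG)).
  by rewrite mem_enum inE /= Pd /bb /cc /= -bE -cE -det dvdn_mull.
by rewrite gE /F /bb /cc /= -bE -cE -det mulnK.
Qed.

Theorem theorem3 (R : realType) (A : nat) (kappa1 c1 c2 c3 c4 eps : R)
    (hA : (1 <= A)%N) (hkappa1 : 0 < kappa1)
    (hc1 : 0 < c1) (hc2 : 0 < c2) (hc3 : 0 < c3) (hc4 : 0 < c4)
    (heps : 0 < eps) :
  exists C : R, 0 < C /\
  forall (X Y K : R) (q : nat) (eta eta' : 'cV[int]_2),
  let x := eta 0 0 in let y := eta 1 0 in
  let u := eta' 0 0 in let v := eta' 1 0 in
  0 < Y -> Y < X -> 0 < K -> (0 < q)%N ->
  0 < x -> 0 < y -> 0 < u -> 0 < v ->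
  y%:~R / A%:R <= x%:~R :> R -> x <= y ->
  c1 * (X / Y) <= y%:~R <= c2 * (X / Y) ->
  gcdz x y = 1 ->
  v%:~R / A%:R <= u%:~R :> R -> u <= v ->
  c3 * X <= v%:~R <= c4 * X ->
  2 * X / K <= v%:~R ->
  gcdz u v = 1 ->
  K ^+ 4 * q%:R ^+ 3 < Y ->
  finite_set (calM X Y K kappa1 q eta eta') /\
  (#|` fset_set (calM X Y K kappa1 q eta eta')|%fset)%:R
    <= C * (Y `^ (2 + eps) / K ^+ 2 * (q%:R `^ eps / Num.sqrt q%:R)).
Proof.
have AR : 0 < A%:R :> R by rewrite ltr0n.
(* [2 / c4] will be the lower bound for [K], by [2 * X / K <= v <= c4 * X]. *)
have kk0 : 0 < 2 / c4 by rewrite divr_gt0.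
have Cb0 : 0 < 16 / c3 + 8 * c2 / c3 ^+ 2.
  by rewrite addr_gt0 // divr_gt0 ?mulr_gt0 ?exprn_gt0.
have Cc0 : 0 < 2 * A%:R / c1 by rewrite divr_gt0 ?mulr_gt0.
have [c cpos hfin] := final_inequality kk0 Cb0 Cc0.
have [C Cpos hsum] := sum_detcount_le heps cpos hkappa1.
exists (C * c); split; first exact: mulr_gt0.
move=> X Y K q eta eta' x0 y0 u0 v0 Y0 YX K0 q0.
have toN (z : int) : 0 < z -> exists2 n : nat, z = n%:Z & (0 < n)%N.
  by case: z => // n; exists n.
move=> /toN[x ex xpos] /toN[y ey ypos] /toN[u eu upos] /toN[v ev vpos].
rewrite ex ey eu ev -!pmulrn !lez_nat.
move=> yx xy /andP[y1 y2] gxy vu uv /andP[v1 v2] Kv _ KY.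
set M := calM X Y K kappa1 q eta eta'.
have X0 : 0 < X := lt_trans Y0 YX.
have bound0 : 0 <= C * c * (Y `^ (2 + eps) / K ^+ 2 * (q%:R `^ eps / Num.sqrt q%:R)).
  by rewrite !mulr_ge0 ?invr_ge0 ?powR_ge0 ?exprn_ge0 ?sqrtr_ge0 // ltW.
(* The empty case is separate because an element of the set provides [1 <= Y] and a representative
   [d0] of the class of [d]. *)
have [Mne|Mempty] := pselect (exists g, M g); last first.
  have -> : M = set0 by rewrite -subset0 => g Mg; case: Mempty; exists g.
  by rewrite fset_set0 cardfs0; split; [exact: finite_set0|].
have repr := @calM_nat R X Y K kappa1 q x y u v eta eta' _ ex ey eu ev.
have Y1 : 1 <= Y.
  have [g /repr[a [b [c' [d [_ [_ [d0 _ dY] _ _ _]]]]]]] := Mne.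
  by apply: le_trans dY; rewrite ler1n.
have kK : 2 / c4 <= K.
  rewrite ler_pdivrMr // -(ler_pM2r X0).
  have := le_trans Kv v2; rewrite ler_pdivrMr // => h; apply: (le_trans h).
  by rewrite le_eqVlt; apply/orP; left; apply/eqP; ring.
pose g := gcdn x q; pose m := (q %/ g)%N.
have g0 : (0 < g)%N by rewrite gcdn_gt0 q0 orbT.
have mg : (m * g)%N = q by rewrite divnK // dvdn_gcdr.
have m0 : (0 < m)%N by move: q0; rewrite -mg muln_gt0 => /andP[].
have copgy : coprime y g.
  rewrite coprime_sym; apply: (coprime_dvdl (dvdn_gcdl x q)).
  by move: gxy; rewrite /coprime /gcdz /= => -[->].
pose facts (a b c' d : nat) := [/\ (a * d = b * c' + 1)%N,
      [/\ (0 < d)%N, Y / kappa1 <= d%:R & d%:R <= Y],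
      `|a%:R * x%:R + b%:R * y%:R - u%:R| <= X / K,
      `|c'%:R * x%:R + d%:R * y%:R - v%:R| <= X / K &
      (c' * x + d * y = v %[mod q])%N].
pose good (d : nat) := `[< exists a b c' : nat, facts a b c' d >].
(* Modulo [g], a divisor of [x], the second row of the congruence reads [d * y = v], and [y] is
   prime to [g] because it is prime to [x]. *)
have class_good d d' : good d -> good d' -> d = d' %[mod g].
  move=> /asboolP[a [b [c1' [_ _ _ _ e]]]] /asboolP[a' [b' [c2' [_ _ _ _ e']]]].
  have red n : n = v %[mod q] -> n = v %[mod g].
    by move=> h; rewrite -(modn_dvdm n (dvdn_gcdr x q)) h modn_dvdm // dvdn_gcdr.
  have xg n k : n * x + k * y = k * y %[mod g].
    by rewrite -(divnK (dvdn_gcdl x q)) mulnA modnMDl.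
  have dy : d * y = d' * y %[mod g] by rewrite -(xg c1' d) -(xg c2' d') (red _ e) (red _ e').
  by have := modn_mul_cancel g0 dy; rewrite (eqP copgy) divn1.
pose lenb : R := (16 / c3 + 8 * c2 / c3 ^+ 2) * (Y / K).
pose lenc : R := 2 * A%:R / c1 * (Y / K) / m%:R.
have YK0 : 0 <= Y / K := divr_ge0 (ltW Y0) (ltW K0).
have lenb0 : 0 <= lenb := mulr_ge0 (ltW Cb0) YK0.
have lenc0 : 0 <= lenc := divr_ge0 (mulr_ge0 (ltW Cc0) YK0) (ler0n _ _).
pose H := (Num.truncn lenb).+1; pose G := (Num.truncn lenc).+1.
(* For each [d] the triple holds the class of [c'] modulo [m], the start of the interval for [b] and
   the start of that for the quotient of [c'] by [m]; passing to the quotient is what divides [lenc]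
   by [m]. *)
have slices d : exists t : nat * nat * nat, forall a b c', facts a b c' d ->
    (exists2 i, (i < H)%N & b = (t.1.2 + i)%N) /\
    (exists2 j, (j < G)%N & c' = (t.1.1 + m * (t.2 + j))%N).
  have [[a0 [b0 [c0' fact0]]]|nofact] := pselect (exists a b c', facts a b c' d); last first.
    by exists (0, 0, 0)%N => a b c' fact; case: nofact; exists a, b, c'.
  have xR : (0 : R) < x%:R by rewrite ltr0n.
  (* For fixed [d] the congruence determines [c' * x] modulo [q], hence [c'] modulo [m = q / g]. *)
  have cmod a b c' : facts a b c' d -> (c' %% m = c0' %% m)%N.
    move=> [_ _ _ _ e]; case: fact0 => _ _ _ _ e0.
    by apply: (modn_mul_cancel q0); apply/eqP; rewrite -(eqn_modDr (d * y)) e e0.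
  have [b1 hb1] := @nat_window R (fun b => exists a c', facts a b c' d) lenb lenb0 ltac:(
    move=> b b' [a [e [det [dpos _ dY] hu hv _]]] [a' [e' [det' _ hu' hv' _]]];
    apply: (@row_entry_diff R X Y K c2 c3 x%:R y%:R u%:R v%:R d%:R a'%:R b'%:R e'%:R a%:R b%:R e%:R);
    rewrite ?ltr0n ?ler_nat // -!natrM ?natr1 -?natrD ?det ?det' ?addn1 //).
  have [k1 hk1] := @nat_window R (fun k => exists a b c', facts a b c' d /\ (c' %/ m)%N = k) lenc lenc0 ltac:(
    move=> k k' [a [b [e [fact <-]]]] [a' [b' [e' [fact' <-]]]];
    rewrite /lenc ler_pdivlMr ?ltr0n //;
    have := cmod _ _ _ fact; have := cmod _ _ _ fact'; move: fact fact';
    move=> [_ _ _ hv _] [_ _ _ hv' _] em' em;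
    have := @column_entry_diff R X Y K A%:R c1 x%:R y%:R v%:R e%:R e'%:R d%:R X0 Y0 K0 AR hc1 xR yx y1 hv hv';
    apply: le_trans; rewrite {2}(divn_eq e m) {2}(divn_eq e' m) em em' !natrD !natrM;
    rewrite opprD addrACA subrr addr0 mulrBl //).
  exists (c0' %% m, b1, k1)%N => a b c' fact; split; first by apply: hb1; exists a, c'.
  have [|j jG kE] := hk1 (c' %/ m)%N; first by exists a, b, c'.
  exists j => //=; rewrite -kE -(cmod _ _ _ fact) addnC mulnC.
  exact: divn_eq.
have /choice[t tP] := slices.
have [d0 good0] : exists d0, good d0.
  have [gm /repr[a [b [c' [d [_ fact]]]]]] := Mne.
  by exists d; apply/asboolP; exists a, b, c'.
have goodP d : good d -> [/\ (0 < d)%N, d%:R <= Y, Y <= kappa1 * d%:R & d = d0 %[mod g]].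
  move=> gd; have cl := class_good _ _ gd good0.
  move: gd => /asboolP[a [b [c' [_ [dpos Yd dY] _ _ _]]]]; split=> //.
  by rewrite mulrC -ler_pdivrMr.
have HR : H%:R <= lenb + 1 by rewrite -natr1 lerD2r; case/andP: (truncn_itv lenb0).
have GR : G%:R <= lenc + 1 by rewrite -natr1 lerD2r; case/andP: (truncn_itv lenc0).
have [HY GY fin] := hfin Y K q m g H G kK Y1 m0 g0 mg KY HR GR.
have [finM cardM] : finite_set M /\ (#|` fset_set M|%fset <= \sum_(d < (Num.truncn Y).+1 | good d)
    detcount d m (t d).1.1 (t d).1.2 H (t d).2 G)%N.
  apply: (@card_le_detcount M _ m H G good (fun d => (t d).1.1) (fun d => (t d).1.2) (fun d => (t d).2)).
  move=> gm /repr[a [b [c' [d [gE fact]]]]]; exists a, b, c', d.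
  have [hb hc'] := tP d a b c' fact.
  have gd : good d by apply/asboolP; exists a, b, c'.
  case: fact => det [dpos _ dY] _ _ _; split=> //.
  by rewrite dpos gd andbT ltnS truncn_ge_nat // ltW.
split=> //.
rewrite -(ler_nat R) in cardM; apply: (le_trans cardM).
apply: (le_trans (hsum Y m g H G d0 good (fun d => (t d).1.1) (fun d => (t d).1.2) (fun d => (t d).2) Y1 m0 g0 HY GY goodP)).
have -> : C * c * (Y `^ (2 + eps) / K ^+ 2 * (q%:R `^ eps / Num.sqrt q%:R)) =
   C * Y `^ eps * (c * (Y ^+ 2 / K ^+ 2 / Num.sqrt q%:R)) * q%:R `^ eps.
  rewrite powRD; last by rewrite gt_eqF // addr_gt0.
  by rewrite (powR_mulrn 2 (ltW Y0)); ring.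
have CY : 0 <= C * Y `^ eps by rewrite mulr_ge0 ?powR_ge0 // ltW.
have T0 : 0 <= c * (Y ^+ 2 / K ^+ 2 / Num.sqrt q%:R).
  by rewrite mulr_ge0 ?(ltW cpos) // !divr_ge0 ?exprn_ge0 ?sqrtr_ge0 // ltW.
apply: (le_trans (ler_wpM2l CY fin)).
by apply: ler_peMr; [exact: mulr_ge0|exact: powR_nat_ge1].
Qed.
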